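(* Let $\mathcal{F}=\mathcal{F}_{\sigma_0}\in\mathbf{Fl}_A(V)$ (with $\sigma_0\in\mathfrak{S}(E,A)$) be a generalized flag compatible with $E$, and let $\mathbf{P}=\mathbf{P}_{\mathcal{F}}$ be the corresponding splitting parabolic subgroup of $\mathbf{G}(E)$ containing $\mathbf{H}(E)$. Let $\mathbf{B}$ be any splitting Borel subgroup of $\mathbf{G}(E)$ containing $\mathbf{H}(E)$. (a) We have the decomposition $$\mathbf{G}(E)/\mathbf{P}_{\mathcal{F}}=\mathbf{Fl}(\mathcal{F},E)=\bigsqcup_{\sigma\in\mathbf{W}(E)\cdot\sigma_0}\mathbf{B}\mathcal{F}_\sigma=\bigsqcup_{w\in\mathbf{W}(E)/\mathbf{W}_{\mathbf{P}}(E)}\mathbf{B}\mathcal{F}_{\sigma_0\circ w^{-1}}.$$ (b) A generalized flag $\mathcal{G}\in\mathbf{Fl}(\mathcal{F},E)$ belongs to the $\mathbf{B}$-orbit $\mathbf{B}\mathcal{F}_\sigma$ ($\sigma\in\mathbf{W}(E)\cdot\sigma_0$) if and only if $\sigma_{\mathcal{G}}=\sigma$. (c) The orbit $\mathbf{B}\mathcal{F}_\sigma$ ($\sigma\in\mathbf{W}(E)\cdot\sigma_0$) is a locally closed ind-subvariety of $\mathbf{Fl}(\mathcal{F},E)$ isomorphic to the affine space $\mathbb{A}^{n_{\mathrm{inv}}(\sigma)}$ (which is the infinite-dimensional affine space $\mathbb{A}^\infty$ if $n_{\mathrm{inv}}(\sigma)$ is infinite). (d) For $\sigma,\tau\in\mathbf{W}(E)\cdot\sigma_0$,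 the inclusion $\mathbf{B}\mathcal{F}_\sigma\subset\overline{\mathbf{B}\mathcal{F}_\tau}$ holds if and only if $\sigma\leq\tau$.
   Context: $\mathbb{K}$ is an algebraically closed field of characteristic zero; $V$ is a $\mathbb{K}$-vector space of countably infinite dimension with a fixed basis $E$ and a filtration $E=\bigcup_{n\geq1}E_n$ by finite subsets $E_n\subset E_{n+1}$. $\langle\cdot\rangle$ denotes linear span. Ind-varieties: an ind-variety is a union $\mathbf{X}=\bigcup_{n\ge1}X_n$ of a chain of inclusions of algebraic varieties $X_1\subset X_2\subset\cdots$; a subset is open (closed) if its intersection with every $X_n$ is open (closed); a morphism is a map that restricts, for each $n$, to a morphism of varieties from $X_n$ into some member of the exhaustion of the target. Locally closed subsets inherit an ind-variety structure (ind-subvarieties). $\mathbb{A}^\infty=\bigcup_n\mathbb{A}^n$ (affine subspaces). Groups: $\mathbf{G}(E)$ is the group of linear automorphisms $g$ of $V$ with $g(e)=e$ for all but finitely many $e\in E$; it is the ind-group $\bigcup_nG(E_n)$ with $G(E_n)=GL(\langle E_n\rangle)$ (acting trivially on $E\setminus E_n$). $\mathbf{H}(E)\subset\mathbf{G}(E)$ is the subgroup of elements diagonal in $E$. A splitting Borel subgroup containing $\mathbf{H}(E)$ is a closed ind-subgroup containing $\mathbf{H}(E)$ which is locally solvable (all its algebraic subgroups are solvable) and maximal with this property. A splitting parabolic subgroup is a closed ind-subgroup containing such a splitting Borel subgroup. Generalized flags: a generalized flag is a set $\mathcal{F}$ of subspaces of $V$, totally ordered by inclusion, such that (i) every $F\in\mathcal{F}$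 has an immediate predecessor or an immediate successor in $\mathcal{F}$; (ii) for every nonzero $v\in V$ there is a pair $(F',F'')$ of consecutive elements of $\mathcal{F}$ with $v\in F''\setminus F'$. For a totally ordered set $(A,\preceq_A)$, $\mathbf{Fl}_A(V)$ is the set of generalized flags whose set of pairs of consecutive elements (ordered by inclusion) is isomorphic to $A$; such $\mathcal{F}$ is written $\mathcal{F}=\{F'_\alpha,F''_\alpha:\alpha\in A\}$, where $(F'_\alpha,F''_\alpha)$ are the consecutive pairs. Let $\mathfrak{S}(E,A)$ be the set of surjective maps $\sigma:E\to A$. For $\sigma\in\mathfrak{S}(E,A)$ put $\mathcal{F}_\sigma=\{F'_{\sigma,\alpha},F''_{\sigma,\alpha}:\alpha\in A\}$, $F'_{\sigma,\alpha}=\langle e\in E:\sigma(e)\prec_A\alpha\rangle$, $F''_{\sigma,\alpha}=\langle e\in E:\sigma(e)\preceq_A\alpha\rangle$. The $\mathcal{F}_\sigma$ are exactly the elements of $\mathbf{Fl}_A(V)$ compatible with $E$ (compatibility with another basis $L$ is defined likewise by a surjection $L\to A$). $\mathcal{F}\mapsto\mathbf{P}_{\mathcal{F}}$ (the stabilizer of $\mathcal{F}$ in $\mathbf{G}(E)$) is a known bijection between $E$-compatible generalized flags and splitting parabolic subgroups containing $\mathbf{H}(E)$; $\mathbf{P}_{\mathcal{F}}$ is a splitting Borel subgroup iff $\mathcal{F}$ is maximal (i.e. $\dim F''/F'=1$ for all consecutive $F'\subset F''$). $\mathbf{Fl}(\mathcal{F},E)$: a generalized flag is weakly compatible with $E$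 if it is compatible with a basis $L$ such that $E\setminus(E\cap L)$ is finite. $\mathcal{F},\mathcal{G}$ are $E$-commensurable if both are weakly compatible with $E$ and there are an isomorphism of ordered sets $\phi:\mathcal{F}\to\mathcal{G}$ and a finite-dimensional subspace $U\subset V$ with $\phi(F)+U=F+U$ and $\dim\phi(F)\cap U=\dim F\cap U$ for all $F\in\mathcal{F}$. $\mathbf{Fl}(\mathcal{F},E)$ is the set of generalized flags $E$-commensurable with $\mathcal{F}$ (these lie in $\mathbf{Fl}_A(V)$). For finite $I\subset E$, $\mathrm{Fl}(\mathcal{F},I)$ is the projective variety of flags $\{M'_\alpha\subset M''_\alpha:\alpha\in A\}$ in $\langle I\rangle$ with $M''_\alpha\subset M'_\beta$ for $\alpha\prec_A\beta$, $\dim M'_\alpha=\dim F'_\alpha\cap\langle I\rangle$, $\dim M''_\alpha=\dim F''_\alpha\cap\langle I\rangle$; with $\mathcal{F}=\mathcal{F}_{\sigma_0}$, it is embedded in $\mathbf{Fl}(\mathcal{F},E)$ by adding $\langle e\in E\setminus I:\sigma_0(e)\prec_A\alpha\rangle$ to $M'_\alpha$ and $\langle e\in E\setminus I:\sigma_0(e)\preceq_A\alpha\rangle$ to $M''_\alpha$. Then $\mathbf{Fl}(\mathcal{F},E)=\bigcup_n\mathrm{Fl}(\mathcal{F},E_n)$, which defines its ind-variety structure, and $g\mapsto g\mathcal{F}$ induces an isomorphism $\mathbf{G}(E)/\mathbf{P}_{\mathcal{F}}\cong\mathbf{Fl}(\mathcal{F},E)$. Weyl group: $\mathbf{W}(E)$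 is the group of permutations of $E$ fixing all but finitely many elements; $\mathbf{W}(E)\cdot\sigma_0=\{\sigma_0\circ w^{-1}:w\in\mathbf{W}(E)\}$; $\mathbf{W}_{\mathbf{P}}(E)=\{w\in\mathbf{W}(E):\sigma_0\circ w^{-1}=\sigma_0\}$. Borel data: $\mathbf{B}=\mathbf{P}_{\mathcal{F}_0}$ for a unique maximal $E$-compatible generalized flag $\mathcal{F}_0$, equivalently $\mathbf{B}$ corresponds to a total order $\preceq_{\mathbf{B}}$ on $E$, with $\mathcal{F}_0=\{F'_{0,e},F''_{0,e}:e\in E\}$, $F'_{0,e}=\langle e'\in E:e'\prec_{\mathbf{B}}e\rangle$, $F''_{0,e}=\langle e'\in E:e'\preceq_{\mathbf{B}}e\rangle$. Inversions: $n_{\mathrm{inv}}(\sigma)=|\{(e,e')\in E\times E:e\prec_{\mathbf{B}}e',\ \sigma(e)\succ_A\sigma(e')\}|$ (possibly infinite). Order on $\mathfrak{S}(E,A)$: for $e\neq e'$ let $t_{e,e'}\in\mathbf{W}(E)$ be the transposition of $e$ and $e'$. Write $\sigma\,\hat{<}\,\tau$ if $\tau=\sigma\circ t_{e,e'}$ for some $e\prec_{\mathbf{B}}e'$ with $\sigma(e)\prec_A\sigma(e')$; write $\sigma<\tau$ if there is a chain $\sigma=\tau_0\,\hat{<}\,\tau_1\,\hat{<}\cdots\hat{<}\,\tau_k=\tau$ with $k\geq1$; $\sigma\leq\tau$ means $\sigma<\tau$ or $\sigma=\tau$. Relative position: for $\mathcal{G}=\{G'_\alpha,G''_\alpha:\alpha\in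 A\}\in\mathbf{Fl}_A(V)$ weakly compatible with $E$, $\sigma_{\mathcal{G}}:E\to A$ is $\sigma_{\mathcal{G}}(e)=\min\{\alpha\in A:G''_\alpha\cap F''_{0,e}\neq G''_\alpha\cap F'_{0,e}\}$. *)

(* Defs.v *)
From HB Require Import structures.
From Stdlib Require Export Relation_Operators.
From mathcomp Require Export all_boot all_order all_algebra.
From mathcomp Require Export finmap.
From mathcomp Require Export boolp classical_sets functions cardinality.

Import Order.TTheory GRing.Theory.
Local Open Scope classical_set_scope.
Local Open Scope ring_scope.

(** * Varieties and ind-varieties

    A variety is handled as a set of points of a type [T] sitting in a product
    of projective and affine spaces: [cone] is the type of systems of
    coordinates, [over c x] says that [c] is a system of coordinates of [x],
    [cfac] indexes the projective factors, and [ccoord j] is a coordinate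
    function, of multidegree [cdeg j] ([0] for affine coordinates). *)
Record coordsys (K : fieldType) (T : Type) := CoordSys {
  cone : Type;
  over : cone -> T -> Prop;
  cfac : Type;
  cidx : Type;
  ccoord : cidx -> cone -> K;
  cdeg : cidx -> cfac -> nat }.

Arguments CoordSys {K T}.
Arguments cone {K T}.
Arguments over {K T} {c}.
Arguments cfac {K T}.
Arguments cidx {K T}.
Arguments ccoord {K T}.
Arguments cdeg {K T}.

Section Varieties.
Variable K : fieldType.

(* Multihomogeneous polynomials in the coordinates. *)
Inductive form {T : Type} (x : coordsys K T) :
  (cfac x -> nat) -> (cone x -> K) -> Prop :=
| form_const a : form x (fun=> 0%N) (fun=> a)
| form_coord j : form x (cdeg x j) (ccoord x j)
| form_add d P Q : form x d P -> form x d Q -> form x d (fun c => P c + Q c)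
| form_mul d d' P Q : form x d P -> form x d' Q ->
    form x (fun i => (d i + d' i)%N) (fun c => P c * Q c).

Definition zclosed {T : Type} (x : coordsys K T) (X Z : set T) : Prop :=
  exists S : set (cone x -> K),
    (forall P, S P -> exists d, form x d P) /\
    Z = [set p | X p /\ forall P c, S P -> over c p -> P c = 0].

Definition zopen {T : Type} (x : coordsys K T) (X U : set T) : Prop :=
  U `<=` X /\ zclosed x X (X `\` U).

(* [f] is a regular function on the open subset [U] of [X]. *)
Definition regular_on {T : Type} (x : coordsys K T) (X U : set T)
    (f : T -> K) : Prop :=
  forall p, U p -> exists U', [/\ zopen x X U', U' p, U' `<=` U &
    exists d P Q, [/\ form x d P, form x d Q &
      forall q c, U' q -> over c q -> Q c != 0 /\ f q = P c / Q c]].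

Definition var_morphism {T T' : Type} (x : coordsys K T) (X : set T)
    (y : coordsys K T') (Y : set T') (phi : T -> T') : Prop :=
  (forall p, X p -> Y (phi p)) /\
  (forall U f, zopen y Y U -> regular_on y Y U f ->
     zopen x X (X `&` phi @^-1` U) /\
     regular_on x X (X `&` phi @^-1` U) (f \o phi)).

End Varieties.

Arguments form {K T}.
Arguments zclosed {K T}.
Arguments zopen {K T}.
Arguments regular_on {K T}.
Arguments var_morphism {K T T'}.

Record indvar (K : fieldType) := IndVar {
  ipt : Type;
  ilev : nat -> set ipt;
  icoord : nat -> coordsys K ipt }.

Arguments IndVar {K ipt}.
Arguments ipt {K}.
Arguments ilev {K}.
Arguments icoord {K}.

Section IndVarieties.
Variable K : fieldType.
Implicit Types X Y : indvar K.

Definition icarrier X : set (ipt X) := \bigcup_n ilev X n.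

Definition iclosed X (Z : set (ipt X)) : Prop :=
  Z `<=` icarrier X /\
  forall n, zclosed (icoord X n) (ilev X n) (Z `&` ilev X n).

Definition iopen X (U : set (ipt X)) : Prop :=
  U `<=` icarrier X /\
  forall n, zopen (icoord X n) (ilev X n) (U `&` ilev X n).

Definition iclosure X (Z : set (ipt X)) : set (ipt X) := smallest (iclosed X) Z.

Definition ilocally_closed X (Z : set (ipt X)) : Prop :=
  exists U C, [/\ iopen X U, iclosed X C & Z = U `&` C].

Definition subind X (Z : set (ipt X)) : indvar K :=
  IndVar (fun n => ilev X n `&` Z) (icoord X).

Definition ind_morphism X Y (phi : ipt X -> ipt Y) : Prop :=
  forall n, exists m,
    var_morphism (icoord X n) (ilev X n) (icoord Y m) (ilev Y m) phi.

Definition ind_isomorphic X Y : Prop :=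
  exists (phi : ipt X -> ipt Y) (psi : ipt Y -> ipt X),
    [/\ ind_morphism X Y phi, ind_morphism Y X psi,
        (forall p, icarrier X p -> psi (phi p) = p) &
        (forall q, icarrier Y q -> phi (psi q) = q)].

Definition affine_coord : coordsys K (nat -> K) :=
  CoordSys (nat -> K) eq void nat
    (fun i c => c i) (fun _ _ => 0%N).

(* [Some N] gives the affine space of dimension [N] (as a constant chain),
   [None] the infinite-dimensional one. *)
Definition affine_space (N : option nat) : indvar K :=
  IndVar (fun n => [set p : nat -> K |
                     forall i, (odflt n N <= i)%N -> p i = 0])
         (fun=> affine_coord).

End IndVarieties.

Arguments icarrier {K}.
Arguments iclosed {K}.
Arguments iopen {K}.
Arguments iclosure {K}.
Arguments ilocally_closed {K}.
Arguments subind {K}.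
Arguments ind_morphism {K}.
Arguments ind_isomorphic {K}.

Set Implicit Arguments.
Unset Strict Implicit.
Unset Printing Implicit Defensive.

(** * Linear algebra in an arbitrary vector space *)
Section Linear.
Variables (K : fieldType) (V : lmodType K).
Implicit Types (M N S L : set V) (s : seq V).

Definition subspace M : Prop :=
  M 0 /\ forall (a : K) u v, M u -> M v -> M (a *: u + v).

Definition lspan S : set V := smallest subspace S.

Definition is_basis L : Prop :=
  lspan L = setT /\ forall v, L v -> ~ lspan (L `\ v) v.

Definition seq_basis M s : Prop :=
  lspan [set` s] = M /\
  forall c : 'I_(size s) -> K,
    \sum_i c i *: s`_i = 0 -> forall i, c i = 0.

Definition same_dim M N : Prop :=
  exists s t, [/\ seq_basis M s, seq_basis N t & size s = size t].

Definition sumset M N : set V := [set u + v | u in M & v in N].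

(** * Generalized flags *)
Implicit Types F G : set (set V).

Definition consecutive F (X Y : set V) : Prop :=
  [/\ F X, F Y, X `<` Y & forall Z, F Z -> X `<=` Z -> Z `<=` Y -> Z = X \/ Z = Y].

Definition gen_flag F : Prop :=
  [/\ forall X, F X -> subspace X,
      forall X Y, F X -> F Y -> X `<=` Y \/ Y `<=` X,
      forall X, F X -> exists Y, consecutive F Y X \/ consecutive F X Y &
      forall v, v != 0 -> exists X Y, [/\ consecutive F X Y, Y v & ~ X v]].

Definition strict (T : eqType) (le : rel T) : rel T :=
  fun x y => (x != y) && le x y.

(* [fpart le s a false] and [fpart le s a true] are the spaces F'_{s,a} and
   F''_{s,a} attached to the map [s] from the basis [L] to the set [T] ordered
   by [le]. *)
Definition fpart (T : eqType) (le : rel T) L (s : L -> T) (a : T) (b : bool) :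
    set V :=
  lspan [set \val e | e in [set e : L | (if b then le else strict le) (s e) a]].

Definition flag_of (T : eqType) (le : rel T) L (s : L -> T) : set (set V) :=
  [set X | exists a b, X = fpart le s a b].

Definition act (g : V -> V) F : set (set V) := [set g @` X | X in F].

Definition commensuration F G (phi : set V -> set V) : Prop :=
  [/\ set_bij F G phi,
      forall X Y, F X -> F Y -> (phi X `<=` phi Y <-> X `<=` Y) &
      exists U, (exists s, seq_basis U s) /\
        forall X, F X -> sumset (phi X) U = sumset X U /\
                         same_dim (phi X `&` U) (X `&` U)].

End Linear.

(** * Groups of finitary automorphisms *)
Section Groups.
Variables (K : fieldType) (V : lmodType K) (E : set V) (En : nat -> set V).
Implicit Types (g h : V -> V) (S B : set (V -> V)).

Definition GE : set (V -> V) :=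
  [set g | [/\ linear g, bijective g & finite_set [set e | E e /\ g e <> e]]].

Definition HE : set (V -> V) :=
  [set g | GE g /\ forall e, E e -> exists c : K, g e = c *: e].

Definition GEn (n : nat) : set (V -> V) :=
  [set g | [/\ GE g, g @` lspan (En n) = lspan (En n) &
               forall e, E e -> ~ En n e -> g e = e]].

(* The matrix coefficients l (g v). *)
Definition GE_coord : coordsys K (V -> V) :=
  CoordSys (V -> V) eq void ({scalar V} * V)%type
    (fun lv g => lv.1 (g lv.2)) (fun _ _ => 0%N).

Definition GE_ind : indvar K := IndVar GEn (fun=> GE_coord).

Definition is_subgroup S : Prop :=
  [/\ S id, forall g h, S g -> S h -> S (g \o h) &
      forall g h, S g -> cancel g h -> cancel h g -> S h].

Definition derived_subgroup S : set (V -> V) :=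
  smallest is_subgroup
    [set k | exists g g' h h', [/\ S g, S h,
       cancel g g' /\ cancel g' g, cancel h h' /\ cancel h' h &
       k = g \o h \o g' \o h']].

Definition solvable_subgroup S : Prop :=
  exists n, iter n derived_subgroup S `<=` [set id].

Definition closed_ind_subgroup S : Prop :=
  [/\ is_subgroup S, S `<=` GE & iclosed GE_ind S].

Definition algebraic_subgroup S : Prop :=
  is_subgroup S /\ exists n, S `<=` GEn n /\ zclosed GE_coord (GEn n) S.

Definition locally_solvable S : Prop :=
  forall S', algebraic_subgroup S' -> S' `<=` S -> solvable_subgroup S'.

Definition splitting_borel B : Prop :=
  let good S := [/\ closed_ind_subgroup S, HE `<=` S & locally_solvable S] in
  good B /\ forall S, good S -> B `<=` S -> S = B.

Definition stab (F : set (set V)) : set (V -> V) :=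
  [set g | GE g /\ act g F = F].

Definition lcoset g S : set (V -> V) := [set g \o p | p in S].

End Groups.

Record weyl (E : eqType) := Weyl {
  wfun :> E -> E;
  winv : E -> E;
  wfunK : cancel wfun winv;
  winvK : cancel winv wfun;
  w_finite : finite_set [set e | wfun e <> e] }.

(** * The ind-variety Fl(F, E) *)
Section FlagVariety.
Variables (K : fieldType) (V : lmodType K) (E : set V) (En : nat -> set V).
Variables (d : Order.disp_t) (A : orderType d).
Implicit Types (G : set (set V)) (M : A -> bool -> set V).

Definition Fsig (L : set V) (s : L -> A) : A -> bool -> set V :=
  fpart (<=%O : rel A) s.

Definition Fl_sig (L : set V) (s : L -> A) : set (set V) :=
  flag_of (<=%O : rel A) s.

Definition compatible (L : set V) G : Prop :=
  exists s : L -> A, (forall a, exists e, s e = a) /\ G = Fl_sig s.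

Definition weakly_compatible G : Prop :=
  exists L : set V, [/\ is_basis L, finite_set (E `\` (E `&` L)) & compatible L G].

Variable sigma0 : E -> A.

(* The generalized flags E-commensurable with F_{sigma0}. *)
Definition FlE : set (set (set V)) :=
  [set G | [/\ gen_flag G, weakly_compatible (Fl_sig sigma0),
               weakly_compatible G &
               exists phi, commensuration (Fl_sig sigma0) G phi]].

(* [M a false], [M a true] are the spaces G'_a, G''_a of a point [G] of [FlE].
   The ordered set [A] may have automorphisms (e.g. [A] the integers), so the
   labelling of [G] by [A] has to be the one transported from F_{sigma0} by the
   commensuration, which is unique. *)
Definition labelling G M : Prop :=
  exists phi, commensuration (Fl_sig sigma0) G phi /\
    forall a b, M a b = phi (Fsig sigma0 a b).

(* The points of Fl(F, I). *)
Definition fin_flag (I : set V) M : Prop :=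
  [/\ forall a b, [/\ subspace (M a b), M a b `<=` lspan I &
                      same_dim (M a b) (Fsig sigma0 a b `&` lspan I)],
      forall a, M a false `<=` M a true &
      forall a a', (a < a')%O -> M a true `<=` M a' false].

Definition embed (I : set V) M : set (set V) :=
  [set X | exists a b, X = sumset (M a b)
     (lspan [set \val e | e in [set e : E | ~ I (\val e) /\
        (if b then (sigma0 e <= a)%O else (sigma0 e < a)%O)]])].

Definition plucker (l : nat -> {scalar V}) (s : seq V) : K :=
  \det (\matrix_(i < size s, j < size s) l i s`_j).

(* The Pluecker embedding of Fl(F, I) in a product of projective spaces indexed
   by [A * bool]; a coordinate system of a flag is obtained by choosing a basis
   of each of its members. *)
Definition Fl_coord (I : set V) : coordsys K (set (set V)) :=
  CoordSys (A -> bool -> seq V)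
    (fun c G => exists M, [/\ fin_flag I M, G = embed I M &
                              forall a b, seq_basis (M a b) (c a b)])
    (A * bool)%type ((A * bool) * (nat -> {scalar V}))%type
    (fun j c => plucker j.2 (c j.1.1 j.1.2))
    (fun j i => (i == j.1) : nat).

Definition Fl_ind : indvar K :=
  IndVar (fun n => [set G | exists2 M, fin_flag (En n) M & G = embed (En n) M])
         (fun n => Fl_coord (En n)).

(** * Combinatorics of the maps from E to A *)
Implicit Types s t : E -> A.

Definition Worbit : set (E -> A) :=
  [set s | exists w : weyl E, s = sigma0 \o winv w].

Definition W_P (w : weyl E) : Prop := sigma0 \o winv w = sigma0.

Definition same_coset (w w' : weyl E) : Prop :=
  exists u, W_P u /\ w' =1 w \o u.

Variable leB : rel E.

Definition inversions s : set (E * E) :=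
  [set p | strict leB p.1 p.2 /\ (s p.2 < s p.1)%O].

Definition n_inv s : option nat :=
  if `[< finite_set (inversions s) >]
  then Some #|` fset_set (inversions s)|%fset else None.

Definition hat_lt s t : Prop :=
  exists e e' : E, [/\ strict leB e e', (s e < s e')%O &
    t = s \o [eta idfun with e |-> e', e' |-> e]].

Definition bruhat_le s t : Prop := clos_trans _ hat_lt s t \/ s = t.

(* [F0 e false] = F'_{0,e} and [F0 e true] = F''_{0,e}. *)
Definition F0 : E -> bool -> set V := fpart leB (@id E).

(* For M = {G'_a, G''_a}, this says that sigma_G exists and is equal to [s]. *)
Definition relative_position M s : Prop :=
  forall e : E,
    let D := [set a | M a true `&` F0 e true <> M a true `&` F0 e false] in
    D (s e) /\ forall a, D a -> (s e <= a)%O.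

Definition Borbit (B : set (V -> V)) s : set (set (set V)) :=
  [set act g (Fl_sig s) | g in B].

End FlagVariety.

(* Main.v *)
(* Order the support of a vector by [leB] and call its greatest element the leading
   term. The group [B] consists of the finitary automorphisms preserving leading
   terms, and the relative position [s] of a flag [G] records, for each basis vector
   [e], the first member of [G] containing a vector with leading term [e]; choosing
   such vectors defines [b] in [B] with [G = b F_s], which gives (a) and (b).
   For (c), the orbit of [F_s] consists of the flags with non-zero Pluecker
   coordinates at the coordinate subspaces [s <= a] such that the Pluecker
   coordinates at [{s <= a} - e + f] vanish unless [e], [f] form an inversion; the
   quotients of the remaining coordinates of this kind parametrize the orbit.
   For (d), a chain of elementary steps is realised by degenerations along the lines
   [e + y f], [y -> 0]. Conversely, if a rank of [s] is smaller than that of [t], a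
   Pluecker coordinate vanishes on the orbit of [t] and not at [F_s], and the
   comparison of all ranks implies [s <= t] by a finite combinatorial argument. *)

From HB Require Import structures.
Require Import Defs.

Set Implicit Arguments.
Unset Strict Implicit.
Unset Printing Implicit Defensive.
Import Order.TTheory GRing.Theory.
Local Open Scope classical_set_scope.
Local Open Scope ring_scope.

(** The members of a flag, the set [A] and the number of inversions may all be infinite, so nothing
    is counted globally. Every dimension argument is made on the trace of a subspace on [W n], the
    span of [E_n], as the rank [rk (In n)] of a matrix. Commensurable members of one chain are equal
    by such a count, which makes the labelling by [A] unique and lets a stabilizer fix every member.
    Closedness may be tested at large levels only: passing from level [n] to level [m] adds fixed
    basis vectors to the members, and the Laplace expansion makes the Pluecker coordinates of level
    [m] linear in those of level [n]. The infinitely many conditions defining the open part of an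
    orbit reduce at each level to finitely many, one for each value of [sigma0] on [E_n]. The
    isomorphism with affine space rests on a unique normal form: each point of the orbit is the
    image of [F_s] under one matrix with ones on the diagonal and other non-zero entries at
    inversions only, and Cramer's rule expresses these entries. *)

(** * Subspaces, linear maps and finite bases *)

Section Subspaces.
Variables (K : fieldType) (V : lmodType K).
Implicit Types (M N S : set V) (g h : V -> V).

Lemma subspace0 M : subspace M -> M 0.
Proof. by case. Qed.

Lemma subspaceD M u v : subspace M -> M u -> M v -> M (u + v).
Proof. by case=> _ h Mu Mv; rewrite -[u]scale1r; apply: h. Qed.

Lemma subspaceZ [M] [a : K] [u] : subspace M -> M u -> M (a *: u).
Proof. by case=> M0 h Mu; rewrite -[_ *: _]addr0; apply: h. Qed.

Lemma subspaceN M u : subspace M -> M u -> M (- u).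
Proof. by move=> h Mu; rewrite -scaleN1r; apply: subspaceZ. Qed.

Lemma subspaceB M u v : subspace M -> M u -> M v -> M (u - v).
Proof. by move=> h Mu Mv; apply: subspaceD => //; apply: subspaceN. Qed.

Lemma subspace_sum (T : eqType) (r : seq T) (F : T -> V) M :
  subspace M -> (forall i, i \in r -> M (F i)) -> M (\sum_(i <- r) F i).
Proof.
move=> hM; elim: r => [|i r IH] h; first by rewrite big_nil; apply: subspace0.
rewrite big_cons; apply: subspaceD => //; first by apply: h; rewrite mem_head.
by apply: IH => j jr; apply: h; rewrite inE jr orbT.
Qed.

Lemma subspace_sumI (T : finType) (F : T -> V) M :
  subspace M -> (forall i, M (F i)) -> M (\sum_i F i).
Proof. by move=> hM h; apply: subspace_sum. Qed.

Lemma subspaceI M N : subspace M -> subspace N -> subspace (M `&` N).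
Proof.
move=> [M0 hM] [N0 hN]; split=> // a u v [Mu Nu] [Mv Nv].
by split; [apply: hM | apply: hN].
Qed.

Lemma lspan_subspace S : subspace (lspan S).
Proof.
split=> [M [[M0 _] _] //|a u v hu hv M [hM SM]].
by apply: (proj2 hM); [apply: hu | apply: hv].
Qed.

Lemma sub_lspan S : S `<=` lspan S.
Proof. exact: sub_gen_smallest. Qed.

Lemma lspan_min S M : subspace M -> S `<=` M -> lspan S `<=` M.
Proof. exact: smallest_sub. Qed.

Lemma subspace_sumset M N : subspace M -> subspace N -> subspace (sumset M N).
Proof.
move=> hM hN; split; first by exists 0; [apply: subspace0|
  exists 0; [apply: subspace0| rewrite addr0]].
move=> a _ _ [u Mu [v Nv <-]] [u' Mu' [v' Nv' <-]].
exists (a *: u + u'); first by apply: (proj2 hM).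
exists (a *: v + v'); first by apply: (proj2 hN).
by rewrite scalerDr addrACA.
Qed.

Lemma sumset_subl M N : subspace N -> M `<=` sumset M N.
Proof. by move=> hN u Mu; exists u => //; exists 0; [apply: subspace0|rewrite addr0]. Qed.

Lemma sumset_subr M N : subspace M -> N `<=` sumset M N.
Proof. by move=> hM u Mu; exists 0; [apply: subspace0|exists u => //; rewrite add0r]. Qed.

Lemma sumset_min M N S : subspace S -> M `<=` S -> N `<=` S -> sumset M N `<=` S.
Proof. by move=> hS MS NS _ [u Mu [v Nv <-]]; apply: subspaceD; [|apply: MS|apply: NS]. Qed.

Lemma lin0 g : linear g -> g 0 = 0.
Proof. by move=> h; have := h (-1) 0 0; rewrite scaleN1r oppr0 addr0 /= scaleN1r addNr. Qed.

Lemma linD g u v : linear g -> g (u + v) = g u + g v.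
Proof. by move=> h; have := h 1 u v; rewrite !scale1r. Qed.

Lemma linZ g a u : linear g -> g (a *: u) = a *: g u.
Proof. by move=> h; have := h a u 0; rewrite !addr0 lin0 // addr0. Qed.

Lemma linB g u v : linear g -> g (u - v) = g u - g v.
Proof. by move=> h; rewrite -!scaleN1r linD // linZ. Qed.

Lemma lin_sum (T : Type) (r : seq T) (F : T -> V) g :
  linear g -> g (\sum_(i <- r) F i) = \sum_(i <- r) g (F i).
Proof.
move=> h; elim: r => [|i r IH]; first by rewrite !big_nil lin0.
by rewrite !big_cons linD // IH.
Qed.

Lemma lin_comp g h : linear g -> linear h -> linear (g \o h).
Proof. by move=> lg lh a u v; rewrite /= lh lg. Qed.

Lemma lin_cancel g h : linear g -> cancel g h -> cancel h g -> linear h.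
Proof. by move=> lg gh hg a u v; rewrite -{1}(hg u) -{1}(hg v) -lg gh. Qed.

Lemma image_subspace g M : linear g -> subspace M -> subspace (g @` M).
Proof.
move=> lg hM; split; first by exists 0; [apply: subspace0|apply: lin0].
move=> a _ _ [u Mu <-] [v Mv <-]; exists (a *: u + v); last exact: lg.
exact: (proj2 hM).
Qed.

Lemma preimage_subspace g M : linear g -> subspace M -> subspace (g @^-1` M).
Proof.
move=> lg hM; split; first by rewrite /preimage /= lin0 //; apply: subspace0.
by move=> a u v Mu Mv; rewrite /preimage /= lg; apply: (proj2 hM).
Qed.

Lemma lspan_seqP (s : seq V) v :
  lspan [set` s] v <-> exists c : 'I_(size s) -> K, v = \sum_i c i *: s`_i.
Proof.
split=> [|[c ->]]; last first.
  apply: subspace_sumI => [|i]; first exact: lspan_subspace.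
  by apply: (subspaceZ (lspan_subspace _)); apply: sub_lspan => /=; apply: mem_nth.
have h : subspace [set v | exists c : 'I_(size s) -> K, v = \sum_i c i *: s`_i].
  split; first by exists (fun=> 0); rewrite big1 // => i _; rewrite scale0r.
  move=> a _ _ [c ->] [c' ->]; exists (fun i => a * c i + c' i).
  rewrite scaler_sumr -big_split /=; apply: eq_bigr => i _.
  by rewrite scalerA scalerDl.
move=> /(lspan_min h); apply=> u /= us.
have iu : (index u s < size s)%N by rewrite index_mem.
exists (fun i => (i == Ordinal iu)%:R).
rewrite (bigD1 (Ordinal iu)) //= eqxx scale1r nth_index // big1 ?addr0 //.
by move=> i /negbTE ->; rewrite scale0r.
Qed.

Lemma seq_basis_image g M s : linear g -> injective g ->
  seq_basis M s -> seq_basis (g @` M) (map g s).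
Proof.
move=> lg ig [<- ind]; split.
  apply/seteqP; split.
    apply: lspan_min; first by apply: image_subspace => //; exact: lspan_subspace.
    by move=> x /= /mapP[y ys ->]; exists y => //; apply: sub_lspan.
  move=> _ [x /lspan_seqP[c ->] <-]; rewrite lin_sum //.
  apply: subspace_sumI => [|i]; first exact: lspan_subspace.
  rewrite linZ //; apply: (subspaceZ (lspan_subspace _)).
  by apply: sub_lspan => /=; apply: map_f; apply: mem_nth.
move=> c h i.
have sz : size (map g s) = size s by rewrite size_map.
have -> : c i = (fun j => c (cast_ord (esym sz) j)) (cast_ord sz i).
  by rewrite /= cast_ordK.
apply: (ind (fun j => c (cast_ord (esym sz) j))); apply: ig; rewrite lin0 // -[RHS]h lin_sum //.
rewrite (reindex (cast_ord sz)) /=; last first.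
  by exists (cast_ord (esym sz)) => j _; rewrite ?cast_ordK ?cast_ordKV.
by apply: eq_bigr => j _; rewrite cast_ordK linZ // (nth_map 0) -?sz.
Qed.

End Subspaces.

(** * Coordinates in the basis [E] *)

Section Basis.
Variables (K : fieldType) (V : lmodType K) (E : set V) (bE : is_basis E).
Implicit Types (M N S : set V) (g h : V -> V).

(** The coefficient of [e] in [v]. The vacuous [let] makes [bE] an argument of [crd], so that a
    linear structure can be attached to [crd bE e]. *)
Definition crd (e : E) (v : V) : K :=
  let _ := bE in xget 0 [set k | lspan (E `\ \val e) (v - k *: \val e)].

Let H (e : E) := lspan (E `\ \val e).
Let hH e : subspace (H e) := lspan_subspace _.

Lemma crd_subproof e v : exists k, H e (v - k *: \val e).
Proof.
have [spE indE] := bE.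
have : lspan E v by rewrite spE.
apply: (@lspan_min _ _ E [set v | exists k, H e (v - k *: \val e)]).
  split; first by exists 0; rewrite scale0r subr0; apply: subspace0.
  move=> a u w [k hk] [l hl]; exists (a * k + l).
  rewrite scalerDl -scalerA opprD addrACA -scalerBr.
  by apply: (proj2 (hH e)).
move=> u Eu; have [->|ue] := pselect (u = \val e).
  by exists 1; rewrite scale1r subrr; apply: subspace0.
by exists 0; rewrite scale0r subr0; apply: sub_lspan; split.
Qed.

Lemma crdP e v : H e (v - crd e v *: \val e).
Proof. by have [k hk] := crd_subproof e v; rewrite /crd; exact: (xgetI _ (hk : [set k | lspan (E `\ \val e) (v - k *: \val e)] k)). Qed.

Lemma crd_uniq e v k : H e (v - k *: \val e) -> crd e v = k.
Proof.
move=> hk; apply/eqP; rewrite -subr_eq0; apply/negPn/negP => ne.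
have [_ indE] := bE; apply: (indE (\val e)); first exact: set_valP.
have h : H e ((crd e v - k) *: \val e).
  have -> : (crd e v - k) *: \val e =
     (v - k *: \val e) - (v - crd e v *: \val e).
    by rewrite scalerBl opprB [RHS]addrC addrA subrK.
  by apply: (subspaceB (hH e)) => //; exact: crdP.
by have := subspaceZ (a := (crd e v - k)^-1) (hH e) h; rewrite scalerK.
Qed.

Lemma crd_scalar e : scalar (crd e).
Proof.
move=> a u v; apply: crd_uniq.
rewrite scalerDl -scalerA opprD addrACA -scalerBr.
by apply: (proj2 (hH e)); apply: crdP.
Qed.

HB.instance Definition _ e :=
  GRing.isLinear.Build K V K^o *%R (crd e) (crd_scalar e).

Lemma crdE e f : crd e (\val f) = (f == e)%:R.
Proof.
apply: crd_uniq; have [->|/eqP ne] := eqVneq f e.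
  by rewrite scale1r subrr; apply: subspace0.
rewrite scale0r subr0; apply: sub_lspan; split; first exact: set_valP.
by move=> /= /val_inj.
Qed.

Lemma crdZ e a v : crd e (a *: v) = a * crd e v.
Proof. by rewrite linearZ. Qed.

Lemma crdL e a u v : crd e (a *: u + v) = a * crd e u + crd e v.
Proof. exact: crd_scalar. Qed.

Lemma crd0 e : crd e 0 = 0.
Proof. exact: linear0. Qed.

Lemma crdD e u v : crd e (u + v) = crd e u + crd e v.
Proof. exact: linearD. Qed.

Lemma crdB e u v : crd e (u - v) = crd e u - crd e v.
Proof. exact: linearB. Qed.

Lemma crd_sum e (T : Type) (r : seq T) (F : T -> V) :
  crd e (\sum_(i <- r) F i) = \sum_(i <- r) crd e (F i).
Proof. by rewrite linear_sum. Qed.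

Lemma basis_expand v : exists (s : seq E) (c : E -> K),
  uniq s /\ v = \sum_(e <- s) c e *: \val e.
Proof.
have [spE _] := bE; have : lspan E v by rewrite spE.
apply: (@lspan_min _ _ E [set v | exists (s : seq E) (c : E -> K),
  uniq s /\ v = \sum_(e <- s) c e *: \val e]); last first.
  move=> u Eu; exists [:: SigSub (mem_set Eu)], (fun=> 1); split=> //.
  by rewrite big_seq1 scale1r.
split; first by exists [::], (fun=> 0); split=> //; rewrite big_nil.
move=> a _ _ [s [c [us ->]]] [t [c' [ut ->]]].
have ext (r r' : seq E) (b : E -> K) : uniq r -> uniq r' -> {subset r <= r'} ->
    \sum_(e <- r) b e *: \val e =
    \sum_(e <- r') (if e \in r then b e else 0) *: \val e.
  move=> ur ur' rr'; rewrite [RHS](bigID (mem r)) /= [X in _ + X]big1 ?addr0; last first.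
    by move=> e /negbTE ->; rewrite scale0r.
  transitivity (\sum_(e <- [seq i <- r' | i \in r]) b e *: \val e).
    apply: perm_big; apply: uniq_perm => //; first exact: filter_uniq.
    by move=> e; rewrite mem_filter; have [/rr' ->|_] := boolP (e \in r).
  by rewrite big_filter; apply: eq_bigr => e ->.
exists (undup (s ++ t)), (fun e => a * (if e \in s then c e else 0) +
  (if e \in t then c' e else 0)); split; first exact: undup_uniq.
rewrite (ext s (undup (s ++ t))) ?undup_uniq //; last first.
  by move=> e es; rewrite mem_undup mem_cat es.
rewrite (ext t (undup (s ++ t))) ?undup_uniq //; last first.
  by move=> e es; rewrite mem_undup mem_cat es orbT.
rewrite scaler_sumr -big_split /=; apply: eq_bigr => e _.
by rewrite scalerA scalerDl.
Qed.

Lemma crd_lincomb (s : seq E) (c : E -> K) e : uniq s ->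
  crd e (\sum_(f <- s) c f *: \val f) = if e \in s then c e else 0.
Proof.
move=> us; rewrite crd_sum; case: ifPn => es.
  rewrite (bigD1_seq e) //= crdZ crdE eqxx mulr1 big1 ?addr0 // => f fe.
  by rewrite crdZ crdE (negbTE fe) mulr0.
rewrite big_seq big1 // => f fs; rewrite crdZ crdE; case: eqP => [fe|]; last by rewrite mulr0.
by rewrite -fe fs in es.
Qed.

Lemma crd_inj u v : (forall e, crd e u = crd e v) -> u = v.
Proof.
move=> h; apply/eqP; rewrite -subr_eq0; apply/eqP.
have {}h e : crd e (u - v) = 0 by rewrite linearB /= h subrr.
have [s [c [us eq]]] := basis_expand (u - v); rewrite eq big_seq big1 // => e es.
by have := h e; rewrite eq crd_lincomb // es => ->; rewrite scale0r.
Qed.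

Lemma crd_eq0 u : (forall e, crd e u = 0) -> u = 0.
Proof. by move=> h; apply: crd_inj => e; rewrite h linear0. Qed.

Lemma crd_expand (s : seq E) v : uniq s ->
  (forall e, e \notin s -> crd e v = 0) -> v = \sum_(e <- s) crd e v *: \val e.
Proof.
move=> us h; apply: crd_inj => e; rewrite crd_lincomb //.
by case: ifPn => // /h.
Qed.

Lemma crd_supp v : exists s : seq E,
  [/\ uniq s, forall e, (e \in s) = (crd e v != 0) &
      v = \sum_(e <- s) crd e v *: \val e].
Proof.
have [s [c [us eq]]] := basis_expand v.
have h e : (e \in [seq e <- s | crd e v != 0]) = (crd e v != 0).
  rewrite mem_filter; have [ne|//] := boolP (crd e v != 0).
  by move: ne; rewrite {1}eq crd_lincomb //; case: ifP; rewrite ?eqxx.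
exists [seq e <- s | crd e v != 0]; split=> //; first exact: filter_uniq.
apply: crd_expand; first exact: filter_uniq.
by move=> e; rewrite h negbK => /eqP.
Qed.

(** Coordinate subspaces. All of [W n], [F0] and [Fsig] are of this form, so that inclusions and
    intersections among them reduce to those of subsets of [E]. *)
Definition CS (P : set E) : set V := [set v | forall e, ~ P e -> crd e v = 0].

Lemma CS_subspace P : subspace (CS P).
Proof.
split=> [e _|a u v hu hv e nP]; first by rewrite linear0.
by rewrite linearP /= hu // hv // mulr0 addr0.
Qed.

Lemma CS_val (P : set E) e : P e -> CS P (\val e).
Proof. by move=> Pe f nP; rewrite crdE; case: eqP => // ef; rewrite ef in Pe. Qed.

Lemma CS_min (P : set E) M : subspace M -> (forall e, P e -> M (\val e)) -> CS P `<=` M.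
Proof.
move=> hM h v Pv; have [s [_ hs ->]] := crd_supp v.
apply: subspace_sum => // e; rewrite hs => ne; apply: subspaceZ => //; apply: h.
by apply: contrapT => /Pv e0; rewrite e0 eqxx in ne.
Qed.

Lemma lspan_CS (P : set E) : lspan [set \val e | e in P] = CS P.
Proof.
apply/seteqP; split.
  by apply: lspan_min; [exact: CS_subspace|move=> _ [e Pe <-]; apply: CS_val].
by apply: CS_min; [exact: lspan_subspace|move=> e Pe; apply: sub_lspan; exists e].
Qed.

Lemma lspan_subset_CS (S : set V) : S `<=` E -> lspan S = CS [set e | S (\val e)].
Proof.
move=> SE; rewrite -lspan_CS; congr lspan; apply/seteqP; split=> [v Sv|_ [e Se <-] //].
by exists (SigSub (mem_set (SE v Sv))).
Qed.

Lemma CS_mono P Q : P `<=` Q -> CS P `<=` CS Q.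
Proof. by move=> PQ v h e nQ; apply: h => /PQ. Qed.

Lemma CS_I P Q : CS P `&` CS Q = CS (P `&` Q).
Proof.
apply/seteqP; split=> [v [hP hQ] e nPQ|v h].
  by have [Pe|/hP //] := pselect (P e); apply: hQ => Qe; apply: nPQ.
by split; apply: CS_mono h => e [].
Qed.

Lemma CS_split P v : exists u, CS P u /\ CS (~` P) (v - u).
Proof.
have [s [us hs eq]] := crd_supp v.
exists (\sum_(e <- [seq e <- s | `[<P e>]]) crd e v *: \val e); split=> e nP.
  rewrite crd_lincomb ?filter_uniq // mem_filter.
  by case: asboolP => // Pe; case: nP.
rewrite linearB /= crd_lincomb ?filter_uniq // mem_filter.
case: asboolP => [Pe|/nP //] /=; case: ifPn; rewrite ?subrr // hs negbK => /eqP ->.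
by rewrite subr0.
Qed.

Lemma CS_val_iff P e : CS P (\val e) <-> P e.
Proof.
split=> [h|/CS_val //]; apply: contrapT => /h; rewrite crdE eqxx => /eqP.
by rewrite oner_eq0.
Qed.

Lemma lin_ext g h : linear g -> linear h ->
  (forall e : E, g (\val e) = h (\val e)) -> g =1 h.
Proof.
move=> lg lh gh v; have [s [_ _ ->]] := crd_supp v; rewrite !lin_sum //.
by apply: eq_bigr => e _; rewrite !linZ // gh.
Qed.

(** A finite-rank correction of the identity is visibly linear and moves only basis vectors in [I];
    no expansion of [v] has to be chosen. *)
Definition extend (I : seq E) (f : E -> V) (v : V) : V :=
  v + \sum_(e <- I) crd e v *: (f e - \val e).

Lemma extend_linear I f : linear (extend I f).
Proof.
move=> a u v; rewrite /extend scalerDr addrACA scaler_sumr -big_split /=.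
congr (_ + _); apply: eq_bigr => e _.
by rewrite linearP /= scalerDl scalerA.
Qed.

Lemma extendE I f e : uniq I ->
  extend I f (\val e) = if e \in I then f e else \val e.
Proof.
move=> uI; rewrite /extend; case: ifPn => eI.
  rewrite (bigD1_seq e) //= crdE eqxx scale1r big1 => [|f' ne].
    by rewrite addr0 addrC subrK.
  by rewrite crdE eq_sym (negbTE ne) scale0r.
rewrite big_seq big1 ?addr0 // => f' f'I; rewrite crdE.
by case: eqP => [ef|]; [rewrite ef f'I in eI | rewrite scale0r].
Qed.

End Basis.

(** * Dimensions of traces on finite coordinate subspaces *)

Section Rank.
Variables (K : fieldType) (V : lmodType K) (E : set V) (bE : is_basis E).
Implicit Types (M N S : set V) (g h : V -> V) (I : seq E).

Definition inI I : set E := [set e | e \in I].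

Definition vec I (x : 'rV[K]_(size I)) : V :=
  \sum_i x 0 i *: \val (tnth (in_tuple I) i).

Definition cvec I (v : V) : 'rV[K]_(size I) :=
  \row_i crd bE (tnth (in_tuple I) i) v.

Lemma vec_linear I a x y : @vec I (a *: x + y) = a *: vec x + vec y.
Proof.
rewrite /vec scaler_sumr -big_split /=; apply: eq_bigr => i _.
by rewrite !mxE scalerDl scalerA.
Qed.

HB.instance Definition _ I :=
  GRing.isLinear.Build K 'rV[K]_(size I) V *:%R (@vec I) (@vec_linear I).

Lemma cvec_linear I a u v : cvec I (a *: u + v) = a *: cvec I u + cvec I v.
Proof. by apply/rowP => i; rewrite !mxE crdL. Qed.

HB.instance Definition _ I :=
  GRing.isLinear.Build K V 'rV[K]_(size I) *:%R (@cvec I) (@cvec_linear I).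

Lemma crd_vec I (x : 'rV_(size I)) i : uniq I ->
  crd bE (tnth (in_tuple I) i) (vec x) = x 0 i.
Proof.
move=> uI; rewrite crd_sum (bigD1 i) //= crdZ crdE eqxx mulr1 big1 ?addr0 // => j ji.
rewrite crdZ crdE; case: eqP => [ij|]; last by rewrite mulr0.
by case/eqP: ji; apply: (elimT (tuple_uniqP (in_tuple I)) uI).
Qed.

Lemma vecK I : uniq I -> cancel (@vec I) (@cvec I).
Proof. by move=> uI x; apply/rowP => i; rewrite mxE crd_vec. Qed.

Lemma vec_CS I (x : 'rV_(size I)) : CS bE (inI I) (vec x).
Proof.
apply: subspace_sumI => [|i]; first exact: CS_subspace.
by apply: (subspaceZ (CS_subspace _ _)); apply: CS_val; apply: mem_tnth.
Qed.

Lemma cvecK I v : uniq I -> CS bE (inI I) v -> vec (cvec I v) = v.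
Proof.
move=> uI Iv; apply: (crd_inj (bE := bE)) => e.
have [eI|eI] := boolP (e \in I); last first.
  by rewrite Iv; [apply: vec_CS; apply/negP|apply/negP].
have [i ->] : exists i, e = tnth (in_tuple I) i.
  by exists (Ordinal (n := size I) (m := index e I) (ltac:(by rewrite index_mem)));
    rewrite (tnth_nth e) /= nth_index.
by rewrite crd_vec // mxE.
Qed.

(** Among the matrices whose row space lies in [M], one of maximal rank already contains every row
    vector of [M]: adjoining a further one would raise the rank. *)
Lemma mat_ex I M : subspace M ->
  exists A : 'M[K]_(size I), forall x : 'rV_(size I), (x <= A)%MS <-> M (vec x).
Proof.
move=> hM; pose good k := exists A : 'M[K]_(size I),
  (forall x : 'rV_(size I), (x <= A)%MS -> M (vec x)) /\ \rank A = k.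
have ex0 : exists k, `[<good k>].
  exists 0%N; apply/asboolP; exists 0; split; last exact: mxrank0.
  by move=> x; rewrite submx0 => /eqP ->; rewrite linear0; apply: subspace0.
have bd k : `[<good k>] -> (k <= size I)%N.
  by move=> /asboolP[A [_ <-]]; apply: rank_leq_row.
case: (ex_maxnP ex0 bd) => k /asboolP[A [hA rA]] kmax.
exists A => x; split; first exact: hA.
move=> Mx; have h : `[<good (\rank (A + x)%MS)>].
  apply/asboolP; exists (A + x)%MS; split=> // y /sub_addsmxP[[u v] /= ->].
  rewrite linearD /=; apply: (subspaceD hM); first by apply: hA; apply: submxMl.
  have -> : v *m x = v 0 0 *: x by rewrite [v]mx11_scalar mul_scalar_mx mxE eqxx mulr1n.
  by rewrite linearZ; apply: (subspaceZ hM).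
have := kmax _ h; rewrite -rA => le.
apply: submx_trans (addsmxSr A x) _.
by have := mxrank_leqif_sup (addsmxSl A x); rewrite /= => -[_ <-]; rewrite eqn_leq le mxrankS // addsmxSl.
Qed.

Definition mat I M : 'M[K]_(size I) :=
  xget 0 [set A | forall x : 'rV_(size I), (x <= A)%MS <-> M (vec x)].

Lemma matP I M x : subspace M -> (x <= mat I M)%MS <-> M (vec x).
Proof.
move=> hM; have := xgetPex 0 (mat_ex I hM); exact.
Qed.

(** The dimension of the trace of [M] on the span of [I], meaningful for [M] of any dimension. *)
Definition rk I M : nat := \rank (mat I M).

Lemma mat_sub I M N : uniq I -> subspace M -> subspace N ->
  (mat I M <= mat I N)%MS <-> M `&` CS bE (inI I) `<=` N.
Proof.
move=> uI hM hN; split=> [h v [Mv Iv]|h].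
  rewrite -(cvecK uI Iv); apply/matP => //; apply: submx_trans h; apply/matP => //.
  by rewrite cvecK.
apply/row_subP => i; apply/matP => //; apply: h; split; last exact: vec_CS.
by apply/matP => //; apply: row_sub.
Qed.

Lemma rk_le I M N : uniq I -> subspace M -> subspace N ->
  M `&` CS bE (inI I) `<=` N -> (rk I M <= rk I N)%N.
Proof. by move=> uI hM hN h; apply: mxrankS; apply/mat_sub. Qed.

(** The form in which dimension counts are used throughout: on the span of [I], an inclusion that
    loses no dimension can be reversed. *)
Lemma rk_eq_sub I M N : uniq I -> subspace M -> subspace N ->
  M `&` CS bE (inI I) `<=` N -> (rk I N <= rk I M)%N ->
  N `&` CS bE (inI I) `<=` M.
Proof.
move=> uI hM hN h rkNM; apply/(mat_sub uI hN hM).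
have hMN : (mat I M <= mat I N)%MS by apply/mat_sub.
by have [le <-] := mxrank_leqif_sup hMN; rewrite eqn_leq le.
Qed.

Lemma eq_rk I M N : uniq I -> subspace M -> subspace N ->
  M `&` CS bE (inI I) `<=` N -> N `&` CS bE (inI I) `<=` M -> rk I M = rk I N.
Proof. by move=> *; apply/eqP; rewrite eqn_leq !rk_le. Qed.

(** The matrix [S] of the vectors of [s] is row free by independence and has the row space of
    [mat I M] by generation. *)
Lemma rk_basis I M s : uniq I -> subspace M -> seq_basis (M `&` CS bE (inI I)) s ->
  size s = rk I M.
Proof.
move=> uI hM [sp ind].
have Is i : CS bE (inI I) s`_i.
  have [/(mem_nth 0) h|/(nth_default 0) ->] := ltnP i (size s).
    have : lspan [set` s] s`_i by apply: sub_lspan.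
    by rewrite sp => -[].
  exact: subspace0 (CS_subspace _ _).
pose S := \matrix_(i < size s) cvec I s`_i.
have vS (x : 'rV_(size s)) : vec (x *m S) = \sum_i x 0 i *: s`_i.
  rewrite mulmx_sum_row linear_sum; apply: eq_bigr => i _.
  by rewrite linearZ rowK /= cvecK.
have fS : row_free S.
  rewrite -kermx_eq0; apply/rowV0P => x /sub_kermxP xS0; apply/rowP => i.
  by rewrite mxE; apply: ind; rewrite -vS xS0 linear0.
have eqS : (S == mat I M)%MS.
  apply/andP; split; apply/row_subP => i.
    apply/(matP _ hM); rewrite rowK cvecK //.
    have [] : (M `&` CS bE (inI I)) s`_i => //.
    by rewrite -sp; apply: sub_lspan; apply: mem_nth.
  have : (M `&` CS bE (inI I)) (vec (row i (mat I M))).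
    by split; [apply/(matP _ hM); apply: row_sub|apply: vec_CS].
  rewrite -sp => /lspan_seqP[c eq].
  rewrite -[row i _](vecK uI) eq.
  have -> : \sum_j c j *: s`_j = vec ((\row_j c j) *m S).
    by rewrite vS; apply: eq_bigr => j _; rewrite mxE.
  by rewrite vecK // submxMl.
by rewrite /rk -(eqmx_rank eqS) (eqP fS).
Qed.

Lemma ex_basis I M : uniq I -> subspace M ->
  exists s, seq_basis (M `&` CS bE (inI I)) s.
Proof.
move=> uI hM; pose B := row_base (mat I M).
pose s := [seq vec (row i B) | i <- enum 'I_(rk I M)].
have sz : size s = rk I M by rewrite size_map size_enum_ord.
have sE (i : 'I_(size s)) : s`_i = vec (row (cast_ord sz i) B).
  have hi : (i < rk I M)%N by rewrite -[X in (_ < X)%N]sz.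
  rewrite (nth_map (cast_ord sz i)) ?size_enum_ord //.
  by congr (vec (row _ B)); apply: val_inj; rewrite /= nth_enum_ord.
have sumE (c : 'I_(size s) -> K) : \sum_i c i *: s`_i =
    vec ((\row_j c (cast_ord (esym sz) j)) *m B).
  rewrite mulmx_sum_row linear_sum (reindex (cast_ord (esym sz))) /=; last first.
    by exists (cast_ord sz) => j _; rewrite ?cast_ordK ?cast_ordKV.
  by apply: eq_bigr => j _; rewrite linearZ /= -[s`_j]/(s`_(cast_ord (esym sz) j)) sE cast_ordKV mxE.
exists s; split=> [|c].
  apply/seteqP; split.
    apply: lspan_min; first by apply: subspaceI => //; apply: CS_subspace.
    move=> _ /= /mapP[i _ ->]; split; last exact: vec_CS.
    apply/(matP _ hM); apply: submx_trans (row_sub _ _) _.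
    by rewrite eq_row_base.
  move=> v [Mv Iv]; have : (cvec I v <= B)%MS.
    by rewrite eq_row_base; apply/(matP _ hM); rewrite cvecK.
  move=> /submxP[D eq]; apply/lspan_seqP; exists (fun i => D 0 (cast_ord sz i)).
  rewrite sumE -(cvecK uI Iv) eq; congr (vec (_ *m _)).
  by apply/rowP => j; rewrite mxE cast_ordKV.
rewrite sumE => h i.
have /row_freeP[C BC] : row_free B by apply: row_base_free.
have := congr1 (fun x => cvec I x *m C) h.
rewrite vecK // linear0 mul0mx -mulmxA BC mulmx1 => /rowP /(_ (cast_ord sz i)).
by rewrite !mxE cast_ordK.
Qed.

Lemma same_dim_rk I M N : uniq I -> subspace M -> subspace N ->
  same_dim (M `&` CS bE (inI I)) (N `&` CS bE (inI I)) <-> rk I M = rk I N.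
Proof.
move=> uI hM hN; split=> [[s [t [hs ht st]]]|eq].
  by rewrite -(rk_basis uI hM hs) -(rk_basis uI hN ht).
have [s hs] := ex_basis uI hM; have [t ht] := ex_basis uI hN.
by exists s, t; split=> //; rewrite (rk_basis uI hM hs) (rk_basis uI hN ht).
Qed.

Lemma rk_sumI I M N : uniq I -> subspace M -> subspace N ->
  M `<=` CS bE (inI I) -> N `<=` CS bE (inI I) ->
  (rk I (sumset M N) + rk I (M `&` N) = rk I M + rk I N)%N.
Proof.
move=> uI hM hN MI NI; rewrite /rk -(mxrank_sum_cap (mat I M) (mat I N)).
have hMN := subspace_sumset hM hN; have hI := subspaceI hM hN.
congr (_ + _)%N; apply: eqmx_rank; apply/andP; split.
- apply/row_subP => i; have : sumset M N (vec (row i (mat I (sumset M N)))).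
    by apply/(matP _ hMN); apply: row_sub.
  move=> [u Mu [v Nv eq]]; rewrite -[row i _](vecK uI) -eq linearD /=.
  by apply: addmx_sub_adds; apply/matP => //; rewrite cvecK //; [apply: MI|apply: NI].
- rewrite addsmx_sub; apply/andP; split; apply/mat_sub => // v [hv _].
    exact: (sumset_subl hN).
  exact: (sumset_subr hM).
- by rewrite sub_capmx; apply/andP; split; apply/mat_sub => // v [[]].
apply/row_subP => i; apply/matP => //.
by split; apply/matP => //; apply: submx_trans (row_sub _ _) _; [apply: capmxSl|apply: capmxSr].
Qed.

(** If the traces met in zero only, their sum would have rank [rk I M + rk I N], more than a space
    containing it. *)
Lemma rk_meet I M N S : uniq I -> subspace M -> subspace N -> subspace S ->
  M `&` CS bE (inI I) `<=` S -> N `&` CS bE (inI I) `<=` S ->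
  (rk I S < rk I M + rk I N)%N ->
  exists v, [/\ v != 0, M v, N v & CS bE (inI I) v].
Proof.
move=> uI hM hN hS MS NS lt.
have sub : (mat I M + mat I N <= mat I S)%MS.
  by rewrite addsmx_sub; apply/andP; split; apply/mat_sub.
have : (mat I M :&: mat I N)%MS != 0.
  rewrite -mxrank_eq0; apply/eqP => eq0; have := mxrank_sum_cap (mat I M) (mat I N).
  by move=> eq; move: lt; rewrite /rk -eq eq0 addn0 ltnNge mxrankS.
move=> /rowV0Pn[x]; rewrite sub_capmx => /andP[/(matP _ hM) xM /(matP _ hN) xN] x0.
exists (vec x); split=> //; last exact: vec_CS.
by apply: contra_neq x0 => eq; rewrite -[x](vecK uI) eq linear0.
Qed.

Lemma basis_CS (r : seq E) : uniq r -> seq_basis (CS bE (inI r)) (map val r).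
Proof.
move=> ur; have szr : size (map val r) = size r by rewrite size_map.
split.
  rewrite -lspan_CS; congr lspan; apply/seteqP; split=> v /=.
    by move=> /mapP[e er ->]; exists e.
  by move=> [e er <-]; apply: map_f.
move=> c; rewrite (reindex (cast_ord (esym szr))) /=; last first.
  by exists (cast_ord szr) => j _; rewrite ?cast_ordK ?cast_ordKV.
move=> h i; have eN (j : 'I_(size r)) : exists e, e \in r /\ (map val r)`_j = val e /\ index e r = j.
  clear -ur; case: r ur j => [|e0 r] ur j; first by case: j.
  exists (nth e0 (e0 :: r) j); split; first exact: mem_nth.
  by rewrite (nth_map e0) // index_uniq.
have [e [er [eq ie]]] := eN (cast_ord szr i).
have := congr1 (crd bE e) h; rewrite crd0 crd_sum.
rewrite (bigD1 (cast_ord szr i)) //= big1 => [|j ji].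
  by rewrite crdZ eq crdE eqxx mulr1 addr0 cast_ordK.
have [f [fr [eqf jf]]] := eN j; rewrite crdZ eqf crdE.
case: eqP => [ef|]; last by rewrite mulr0.
by case/eqP: ji; apply: val_inj; rewrite /= -jf -[RHS]ie ef.
Qed.

Lemma rk_CS I (P : set E) : uniq I -> rk I (CS bE P) = count (fun e => `[<P e>]) I.
Proof.
move=> uI; rewrite -size_filter -(size_map val).
apply/esym; apply: (rk_basis uI (CS_subspace _ _)); rewrite CS_I.
rewrite (_ : P `&` _ = inI [seq e <- I | `[<P e>]]); first by apply: basis_CS; apply: filter_uniq.
apply/seteqP; split=> e; rewrite /inI /= mem_filter.
  by move=> [Pe ->]; rewrite andbT; apply/asboolP.
by move=> /andP[/asboolP Pe ->].
Qed.

Lemma rk_image I M g : uniq I -> subspace M -> linear g -> injective g ->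
  (forall v, CS bE (inI I) v <-> CS bE (inI I) (g v)) -> rk I (g @` M) = rk I M.
Proof.
move=> uI hM lg ig gI.
have [s hs] := ex_basis uI hM; rewrite -(rk_basis uI hM hs) -(size_map g).
apply/esym; apply: (rk_basis uI (image_subspace lg hM)).
have -> : g @` M `&` CS bE (inI I) = g @` (M `&` CS bE (inI I)).
  apply/seteqP; split=> [_ [[v Mv <-] /(proj2 (gI _)) Iv]|_ [v [Mv Iv] <-]].
    by exists v.
  by split; [exists v|apply: (proj1 (gI _))].
exact: seq_basis_image.
Qed.

(* A linear map which moves every vector by an element of a finite-dimensional
   space [U] restricts to [U], and its surjectivity is decided there. *)
Lemma finitary_bij I g : uniq I -> linear g -> injective g ->
  (forall v, CS bE (inI I) (g v - v)) -> bijective g.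
Proof.
move=> uI lg ig hg; have hI := CS_subspace bE (inI I).
have gI v : CS bE (inI I) v -> CS bE (inI I) (g v).
  by move=> Iv; rewrite -[g v](subrK v); apply: (subspaceD hI).
have surj w : CS bE (inI I) w -> exists2 v, CS bE (inI I) v & g v = w.
  move=> Iw; have : (g @` CS bE (inI I)) `&` CS bE (inI I) `<=` CS bE (inI I).
    by move=> v [].
  move=> /(rk_eq_sub uI (image_subspace lg hI) hI).
  rewrite rk_image // => [/(_ (leqnn _) w)|v].
    by case=> // v Iv <-; exists v.
  split=> [|Igv]; first exact: gI; by have := subspaceB hI Igv (hg v); rewrite subKr.
have : forall w, exists v, g v = w.
  move=> w; have [v _ eq] := surj _ (hg w); exists (w - v).
  by rewrite linB // eq opprB addrC subrK.
move=> /choice[h hK]; exists h => // v; apply: ig; exact: hK.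
Qed.

End Rank.

(** * Finite maxima and rearrangements of maps to [A] *)

Lemma max_seq (T : eqType) (le : rel T) : reflexive le -> transitive le ->
  total le -> forall s : seq T, s != [::] ->
  exists2 e, e \in s & forall f, f \in s -> le f e.
Proof.
move=> le_refl le_trans le_total; elim=> [//|e [_ _|e' s IH _]].
  by exists e; rewrite ?mem_head // => f; rewrite inE => /eqP ->.
have [//|m ms hm] := IH; have [em|me] := orP (le_total e m).
  by exists m; [rewrite inE ms orbT|move=> f; rewrite inE => /orP[/eqP -> //|/hm]].
exists e; first exact: mem_head.
by move=> f; rewrite inE => /orP[/eqP -> //|/hm fm]; apply: le_trans me.
Qed.

Lemma argmax_seq (T : eqType) d (A : orderType d) (s : T -> A) (r : seq T) : r != [::] ->
  exists2 e, e \in r & forall f, f \in r -> (s f <= s e)%O.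
Proof.
apply: max_seq => [e|f e g|e f]; [exact: lexx|exact: le_trans|exact: le_total].
Qed.

Definition dnb (T : Type) d (A : orderType d) (s : T -> A) a (b : bool) : pred T :=
  fun e => if b then (s e <= a)%O else (s e < a)%O.

Section Rearrangements.
Variables (T : eqType) (d : Order.disp_t) (A : orderType d).
Implicit Types (I : seq T) (s : T -> A).

(** An injective self-map of a finite set is onto. The map is realised as [winv], since [Worbit] is
    defined by composition with inverses. *)
Lemma weyl_of_inj I (f : T -> T) : uniq I -> {in I &, injective f} ->
  (forall e, e \in I -> f e \in I) -> (forall e, e \notin I -> f e = e) ->
  exists w : weyl T, winv w =1 f.
Proof.
move=> uI injI fI foff.
have inj : injective f.
  move=> x y; have [xI|xI] := boolP (x \in I); have [yI|yI] := boolP (y \in I).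
  - exact: injI.
  - by rewrite (foff y) // => eq; rewrite -eq fI in yI.
  - by rewrite (foff x) // => eq; rewrite eq fI in xI.
  by rewrite !foff.
have : forall y, exists x, f x = y.
  move=> y; have [yI|yI] := boolP (y \in I); last by exists y; apply: foff.
  have ufI : uniq (map f I) by rewrite map_inj_in_uniq.
  have sub : {subset map f I <= I} by move=> _ /mapP[x xI ->]; apply: fI.
  have [|_ eq] := uniq_min_size ufI sub; first by rewrite size_map.
  by move: yI; rewrite -eq => /mapP[x _ ->]; exists x.
move=> /choice[h hK].
have fK : cancel f h by move=> x; apply: inj.
have fin : finite_set [set e | h e <> e].
  apply: (sub_finite_set (B := [set` I])); last exact: finite_seq.
  move=> e he /=; apply: contrapT => /negP eI; apply: he; apply: inj.
  by rewrite hK foff.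
by exists (Weyl hK fK fin).
Qed.

Lemma perm_rearrange s s0 I : uniq I -> perm_eq (map s I) (map s0 I) ->
  exists f : T -> T, [/\ {in I &, injective f},
    forall e, e \in I -> f e \in I, forall e, e \in I -> s e = s0 (f e) &
    forall e, e \notin I -> f e = e].
Proof.
case: I => [|e0 I0] uI; first by exists id.
set I := e0 :: I0 in uI *; move=> /(perm_iotaP (s0 e0))[Is pIs eqs].
have szI : size Is = size I by rewrite (perm_size pIs) size_iota size_map.
have Ilt i : i \in Is -> (i < size I)%N.
  by rewrite (perm_mem pIs) mem_iota size_map add0n.
have ltI e : e \in I -> (index e I < size Is)%N by rewrite szI index_mem.
(* [Is] lists, for each position in [I], a position carrying under [s0] the value found there under
   [s]. *)
pose f e := if e \in I then nth e0 I (nth 0%N Is (index e I)) else e.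
exists f; split=> [x y xI yI|e eI|e eI|e /negbTE]; rewrite /f.
- rewrite xI yI => /eqP; rewrite nth_uniq ?Ilt ?mem_nth ?ltI // nth_uniq ?ltI //.
    by move=> /eqP; apply: index_inj.
  by rewrite (perm_uniq pIs) iota_uniq.
- by rewrite eI mem_nth // Ilt // mem_nth // ltI.
- rewrite eI -{1}(nth_index e0 eI) -(nth_map e0 (s0 e0)) ?index_mem //.
  rewrite eqs (nth_map 0%N) ?ltI // (nth_map e0) //.
  by rewrite Ilt // mem_nth // ltI.
by move=> ->.
Qed.

(** A fibre over [a] is the difference of the sets cut out by [<= a] and [< a], so the counts
    determine the multiset of values. *)
Lemma count_perm s s0 I :
  (forall a b, count (dnb s a b) I = count (dnb s0 a b) I) ->
  perm_eq (map s I) (map s0 I).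
Proof.
move=> h; rewrite /perm_eq; apply/allP => a _; apply/eqP; rewrite !count_map.
have split1 (t : T -> A) : count (dnb t a true) I =
    (count (dnb t a false) I + count (preim t (pred1 a)) I)%N.
  elim: I {h} => //= e I ->; rewrite addnACA; congr (_ + _)%N.
  by rewrite /dnb le_eqVlt; case: ltgtP.
by have := split1 s; rewrite !h split1 => /addnI.
Qed.

End Rearrangements.

(** * Forms, lifts to coordinates and morphisms *)

Arguments form_const {K T}.
Arguments form_coord {K T}.
Arguments form_add {K T x d P Q}.
Arguments form_mul {K T x d d' P Q}.

Section Morphisms.
Variable K : fieldType.

Lemma form_eq T (x : coordsys K T) d d' P : form x d P -> d =1 d' -> form x d' P.
Proof. by move=> h /funext <-. Qed.

Lemma form_scale T (x : coordsys K T) d a P : form x d P -> form x d (fun c => a * P c).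
Proof. by move=> h; apply: (form_eq (form_mul (form_const x a) h)). Qed.

Lemma form_mulC T (x : coordsys K T) (d d' e : cfac x -> nat) P Q : form x d P -> form x d' Q ->
  (forall i, d i + d' i = e i)%N -> form x e (fun c => P c * Q c).
Proof. by move=> hP hQ h; apply: form_eq (form_mul hP hQ) h. Qed.

Lemma form_sum T (x : coordsys K T) d (I : Type) (r : seq I) (F : I -> cone x -> K) P0 :
  form x d P0 -> (forall i, form x d (F i)) -> form x d (fun c => \sum_(i <- r) F i c).
Proof.
move=> h0 hF; elim: r => [|i r IH].
  rewrite (_ : (fun c => _) = (fun c => 0 * P0 c)); first exact: form_scale.
  by apply/funext => c; rewrite big_nil mul0r.
rewrite (_ : (fun c => _) = (fun c => F i c + \sum_(j <- r) F j c)); first exact: form_add.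
by apply/funext => c; rewrite big_cons.
Qed.

(** The relation expected between two systems of coordinates of one point: the scaling factor of a
    form depends only on its multidegree and is not zero, so that vanishing does not depend on the
    choice of coordinates. *)
Definition homog_at T (y : coordsys K T) (c c' : cone y) := exists mu : (cfac y -> nat) -> K,
  forall d P, form y d P -> mu d != 0 /\ P c' = mu d * P c.

(* A map of sets of points which lifts to systems of coordinates, so that the
   coordinates pull back to quotients of forms; the pull-back of a form of
   multidegree [d] has multidegree [D d]. *)
Record liftmap T T' (x : coordsys K T) (X : set T) (y : coordsys K T') (Y : set T')
    (phi : T -> T') := LiftMap {
  lm_lift : T -> cone x -> cone y;
  lm_D : (cfac y -> nat) -> (cfac x -> nat);
  lm_fun : forall p, X p -> Y (phi p);
  lm_cone : forall p, X p -> exists c : cone x, over c p;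
  lm_over : forall p c, X p -> over c p -> over (lm_lift p c) (phi p);
  lm_hom : forall q c c', Y q -> @over _ _ y c q -> @over _ _ y c' q -> homog_at c c';
  lm_D0 : forall i, lm_D (fun=> 0%N) i = 0%N;
  lm_DD : forall d d' i, lm_D (fun j => (d j + d' j)%N) i = (lm_D d i + lm_D d' i)%N;
  lm_coord : forall j, exists e P R,
    [/\ form x (fun i => (e i + lm_D (cdeg y j) i)%N) P, form x e R &
     forall p c, X p -> over c p -> R c != 0 /\ ccoord y j (lm_lift p c) * R c = P c] }.

Section Pullback.
Variables (T T' : Type) (x : coordsys K T) (X : set T) (y : coordsys K T') (Y : set T').
Variables (phi : T -> T') (lm : liftmap x X y Y phi).
Let D := lm_D lm.
Let lift := lm_lift lm.

Let pulled d P (e : cfac x -> nat) P' R := [/\ form x (fun i => (e i + D d i)%N) P', form x e R &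
     forall p c, X p -> over c p -> R c != 0 /\ P (lift p c) * R c = P' c].

(** Coordinates pull back to fractions, and sums and products are brought to a common denominator,
    which again has no zero on [X]. *)
Lemma pull_form d P : form y d P -> exists e P' R, pulled d P e P' R.
Proof.
elim=> {d P} [a|j|d P Q _ [e [P' [R [hP hR h]]]] _ [e2 [Q' [R2 [hQ hR2 h2]]]]
  |d d' P Q _ [e [P' [R [hP hR h]]]] _ [e2 [Q' [R2 [hQ hR2 h2]]]]].
- exists (fun=> 0%N), (fun=> a), (fun=> 1); split; [|exact: form_const|].
    by apply: form_eq (form_const x a) _ => i; rewrite /D lm_D0.
  by move=> p c _ _; rewrite mulr1 oner_neq0.
- exact: lm_coord.
- exists (fun i => e i + e2 i)%N, (fun c => P' c * R2 c + Q' c * R c), (fun c => R c * R2 c).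
  split; last first.
  + move=> p c Xp cp; have [r0 <-] := h p c Xp cp; have [r20 <-] := h2 p c Xp cp.
    by split; [exact: mulf_neq0|rewrite mulrDl !mulrA; congr (_ + _); rewrite mulrAC].
  + exact: form_mul.
  by apply: form_add; [apply: (form_mulC hP hR2)|apply: (form_mulC hQ hR)] => i;
    rewrite addnAC // [(e2 i + e i)%N]addnC.
exists (fun i => e i + e2 i)%N, (fun c => P' c * Q' c), (fun c => R c * R2 c); split; last first.
+ move=> p c Xp cp; have [r0 <-] := h p c Xp cp; have [r20 <-] := h2 p c Xp cp.
  by split; [exact: mulf_neq0|rewrite mulrACA].
+ exact: form_mul.
by apply: (form_mulC hP hQ) => i; rewrite /D lm_DD addnACA.
Qed.

(** The numerators of the pulled back equations cut out the preimage. They test vanishing at the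
    lifted coordinates only, and [lm_hom] carries it to every system of coordinates of the image. *)
Lemma zclosed_pull Z : zclosed y Y Z -> zclosed x X (X `&` phi @^-1` Z).
Proof.
move=> [S [hS ->]].
exists [set P' | exists P d e R, [/\ S P, form y d P & pulled d P e P' R]]; split.
  by move=> P' [P [d [e [R [_ _ [h _ _]]]]]]; exists (fun i => e i + D d i)%N.
apply/seteqP; split=> p [Xp].
  move=> [_ hp]; split=> // P' c [P [d [e [R [SP _ [_ _ hc]]]]]] cp.
  have [_ <-] := hc p c Xp cp; rewrite (hp P) ?mul0r //; exact: lm_over.
move=> hp; split=> //; split; first exact: (lm_fun lm).
move=> P c' SP c'p; have [d hd] := hS P SP; have [e [P' [R hpull]]] := pull_form hd.
have [c cp] := lm_cone lm Xp; have [_ _ h] := hpull; have [r0 eq] := h p c Xp cp.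
have P0 : P (lift p c) = 0.
  have : P (lift p c) * R c = 0 by rewrite eq; apply: hp cp; exists P, d, e, R.
  by move=> /eqP; rewrite mulf_eq0 (negbTE r0) orbF => /eqP.
have [mu hmu] := lm_hom lm (lm_fun lm Xp) (lm_over lm Xp cp) c'p.
by have [_ ->] := hmu d P hd; rewrite -/lift P0 mulr0.
Qed.

Lemma zopen_pull U : zopen y Y U -> zopen x X (X `&` phi @^-1` U).
Proof.
move=> [_ /zclosed_pull hc]; split; first by move=> p [].
rewrite (_ : _ `\` _ = X `&` phi @^-1` (Y `\` U)) //.
apply/seteqP; split=> p [Xp h]; split=> //; last by move=> [_ /(proj2 h)].
by split; [exact: (lm_fun lm)|move=> Up; apply: h].
Qed.

(** If P and Q pull back to P'/R1 and Q'/R2, then P/Q becomes P'R2/(Q'R1), a quotient of forms of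
    equal multidegree. *)
Lemma liftmap_morphism : var_morphism x X y Y phi.
Proof.
split; first exact: (lm_fun lm).
move=> U f oU rf; split; first exact: zopen_pull.
move=> p [Xp Up]; have [U' [oU' U'p U'U [d [P [Q [hP hQ h]]]]]] := rf _ Up.
exists (X `&` phi @^-1` U'); split=> //; first exact: zopen_pull.
  by move=> q [Xq /U'U].
have [e1 [P' [R1 [hP' hR1 h1]]]] := pull_form hP.
have [e2 [Q' [R2 [hQ' hR2 h2]]]] := pull_form hQ.
exists (fun i => e1 i + D d i + e2 i)%N, (fun c => P' c * R2 c), (fun c => Q' c * R1 c).
split; [exact: form_mul| |].
  by apply: (form_mulC hQ' hR1) => i; rewrite addnAC [(e2 i + e1 i)%N]addnC addnAC.
move=> q c [Xq U'q] cq; have [r1 <-] := h1 q c Xq cq; have [r2 <-] := h2 q c Xq cq.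
have [Q0 /= ->] := h _ _ U'q (lm_over lm Xq cq); rewrite -/lift in Q0 *.
split; first by rewrite !mulf_neq0.
rewrite -(mulrA (P _)) -(mulrA (Q _)) [R2 c * R1 c]mulrC -mulf_div divff ?mulr1 //.
exact: mulf_neq0.
Qed.

End Pullback.

Lemma var_morphism_comp T1 T2 T3 (x : coordsys K T1) X (y : coordsys K T2) Y
    (z : coordsys K T3) Z phi psi :
  var_morphism x X y Y phi -> var_morphism y Y z Z psi ->
  var_morphism x X z Z (psi \o phi).
Proof.
move=> [f1 m1] [f2 m2]; split=> [p Xp|U f oU rf]; first by apply: f2; apply: f1.
have [oU' rf'] := m2 U f oU rf; have := m1 _ _ oU' rf'.
have -> : X `&` phi @^-1` (Y `&` psi @^-1` U) = X `&` (psi \o phi) @^-1` U.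
  by apply/seteqP; split=> p [Xp h]; split=> //; [case: h|split=> //; apply: f1].
by [].
Qed.

(** There is no projective factor, so all multidegrees coincide. *)
Lemma affine_form_deg (d d' : void -> nat) P :
  form (affine_coord K) d P -> form (affine_coord K) d' P.
Proof. by move=> h; apply: form_eq h _; case. Qed.

Definition polyfun (P : (nat -> K) -> K) := form (affine_coord K) (fun=> 0%N) P.

Lemma polyfun_const a : polyfun (fun=> a). Proof. exact: form_const. Qed.

Lemma polyfun_coord i : polyfun (fun p => p i).
Proof. by apply: affine_form_deg (form_coord (affine_coord K) i). Qed.

Lemma polyfun_add P Q : polyfun P -> polyfun Q -> polyfun (fun p => P p + Q p).
Proof. exact: form_add. Qed.

Lemma polyfun_mul P Q : polyfun P -> polyfun Q -> polyfun (fun p => P p * Q p).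
Proof. by move=> hP hQ; apply: affine_form_deg (form_mul hP hQ). Qed.

Lemma polyfun_sum (I : Type) (r : seq I) F : (forall i, polyfun (F i)) ->
  polyfun (fun p => \sum_(i <- r) F i p).
Proof. by move=> h; apply: (@form_sum _ (affine_coord K) _ I r F (fun=> 0)) => //; exact: polyfun_const. Qed.

Lemma polyfun_prod (I : Type) (r : seq I) F : (forall i, polyfun (F i)) ->
  polyfun (fun p => \prod_(i <- r) F i p).
Proof.
move=> h; elim: r => [|i r IH].
  rewrite (_ : (fun p => _) = (fun=> 1)); first exact: polyfun_const.
  by apply/funext => p; rewrite big_nil.
rewrite (_ : (fun p => _) = (fun p => F i p * \prod_(j <- r) F j p)).
  exact: polyfun_mul.
by apply/funext => p; rewrite big_cons.
Qed.

Lemma polyfun_det n (F : (nat -> K) -> 'M[K]_n) :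
  (forall i j, polyfun (fun p => F p i j)) -> polyfun (fun p => \det (F p)).
Proof.
move=> h; apply: polyfun_sum => s; apply: polyfun_mul; first exact: polyfun_const.
by apply: polyfun_prod.
Qed.

(** The affine line, as the first coordinate axis of the space of sequences. *)
Definition line (y : K) : nat -> K := fun i => if i == 0%N then y else 0.

Lemma polyfun_line P : polyfun P -> exists q : {poly K}, forall y, P (line y) = q.[y].
Proof.
suff h d : form (affine_coord K) d P -> exists q : {poly K}, forall y, P (line y) = q.[y].
  exact: h.
elim=> {d P} [a|[|j]|d P Q _ [p hp] _ [q hq]|d d' P Q _ [p hp] _ [q hq]].
- by exists a%:P => y; rewrite hornerC.
- by exists 'X => y; rewrite hornerX.
- by exists 0 => y; rewrite horner0.
- by exists (p + q) => y; rewrite hornerD hp hq.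
by exists (p * q) => y; rewrite hornerM hp hq.
Qed.

Lemma homog_affine (c c' : cone (affine_coord K)) p : over c p -> over c' p -> homog_at c c'.
Proof.
by move=> /= -> ->; exists (fun=> 1) => d P _; rewrite mul1r oner_neq0.
Qed.

(** On the line an equation is a polynomial in one variable; it has infinitely many roots and is
    therefore zero. *)
Lemma zclosed_line (Z : set (nat -> K)) : (forall s : seq K, exists y, y \notin s) ->
  zclosed (affine_coord K) (range line) Z -> (forall y, y != 0 -> Z (line y)) -> Z (line 0).
Proof.
move=> inf [S [hS ->]] h; split; first by exists 0.
move=> P _ SP ->; have [d hd] := hS P SP.
have [q hq] := polyfun_line (affine_form_deg _ hd); rewrite hq.
suff -> : q = 0 by rewrite horner0.
apply/eqP/negPn/negP => q0.
have roots n : exists s : seq K, [/\ size s = n, uniq s & all (root q) s].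
  elim: n => [|n [s [sz us rs]]]; first by exists [::].
  have [y] := inf (0 :: s); rewrite inE negb_or => /andP[y0 ys].
  exists (y :: s); rewrite /= sz ys us rs; split=> //; rewrite andbT.
  by rewrite /root -hq; have [_ -> //] := h y y0.
have [s [sz us rs]] := roots (size q).
by have := max_poly_roots q0 rs us; rewrite sz ltnn.
Qed.

End Morphisms.

Lemma form_prod (K : fieldType) T (x : coordsys K T) (I : Type) (r : seq I)
    (F : I -> cone x -> K) : (forall i, exists d, form x d (F i)) ->
  exists d, form x d (fun c => \prod_(i <- r) F i c).
Proof.
move=> h; elim: r => [|i r [d hd]].
  exists (fun=> 0%N); rewrite (_ : (fun c : cone x => _) = (fun=> 1)); first exact: form_const.
  by apply/funext => c; rewrite big_nil.
have [e he] := h i; exists (fun j => e j + d j)%N.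
rewrite (_ : (fun c : cone x => _) = (fun c => F i c * \prod_(j <- r) F j c)); first exact: form_mul.
by apply/funext => c; rewrite big_cons.
Qed.

(** * Bases and Pluecker coordinates *)

Section Bases.
Variables (K : fieldType) (V : lmodType K).
Implicit Types (M N : set V) (s t : seq V) (l : nat -> {scalar V}).

Lemma seq_basis_nat s (c : nat -> K) M : seq_basis M s ->
  \sum_(0 <= i < size s) c i *: s`_i = 0 -> forall i, (i < size s)%N -> c i = 0.
Proof.
move=> [_ ind]; rewrite big_mkord => /ind h i lt; exact: (h (Ordinal lt)).
Qed.

Lemma seq_basis_cat M N s t : M `&` N `<=` [set 0] ->
  seq_basis M s -> seq_basis N t -> seq_basis (sumset M N) (s ++ t).
Proof.
move=> MN0 bs bt; have [eM _] := bs; have [eN _] := bt.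
have hM : subspace M by rewrite -eM; apply: lspan_subspace.
have hN : subspace N by rewrite -eN; apply: lspan_subspace.
split.
  apply/seteqP; split.
    apply: lspan_min; first exact: subspace_sumset.
    move=> v /=; rewrite mem_cat => /orP[vs|vt].
      by apply: sumset_subl => //; rewrite -eM; apply: sub_lspan.
    by apply: sumset_subr => //; rewrite -eN; apply: sub_lspan.
  apply: sumset_min; first exact: lspan_subspace.
    rewrite -eM; apply: lspan_min; first exact: lspan_subspace.
    by move=> v /= vs; apply: sub_lspan; rewrite /= mem_cat vs.
  rewrite -eN; apply: lspan_min; first exact: lspan_subspace.
  by move=> v /= vs; apply: sub_lspan; rewrite /= mem_cat vs orbT.
(* The coefficients are extended by zero to all natural numbers so that the sum can be cut at
   [size s]. *)
move=> c0; pose c k := if insub k is Some i then c0 i else 0.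
have cE i : c0 i = c i by rewrite /c valK.
have sumE : \sum_i c0 i *: (s ++ t)`_i = \sum_(0 <= i < size s + size t) c i *: (s ++ t)`_i.
  by rewrite -size_cat big_mkord; apply: eq_bigr => i _; rewrite cE.
rewrite sumE (big_cat_nat (n := size s)) ?leq_addr //=.
rewrite -[X in _ + \sum_(X <= _ < _) _]add0n big_addn addKn.
set S := \sum_(0 <= i < size s) _; set T := \sum_(0 <= i < _) _ => ST.
have SE : S = \sum_(0 <= i < size s) c i *: s`_i.
  by apply: eq_big_nat => i /andP[_ lt]; rewrite nth_cat lt.
have TE : T = \sum_(0 <= i < size t) c (i + size s)%N *: t`_i.
  by apply: eq_big_nat => i /andP[_ lt]; rewrite nth_cat ltnNge leq_addl addnK.
have MS : M S.
  rewrite SE big_mkord; apply: subspace_sumI => // i; apply: (subspaceZ hM).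
  by rewrite -eM; apply: sub_lspan => /=; apply: mem_nth.
have NT : N T.
  rewrite TE big_mkord; apply: subspace_sumI => // i; apply: (subspaceZ hN).
  by rewrite -eN; apply: sub_lspan => /=; apply: mem_nth.
have S0 : S = 0.
  apply: MN0; split=> //; rewrite (_ : S = - T); first exact: subspaceN.
  by apply/eqP; rewrite -addr_eq0 ST.
have T0 : T = 0 by rewrite -ST S0 add0r.
move=> i; rewrite cE; have [lt|ge] := ltnP i (size s).
  by apply: (seq_basis_nat bs) lt; rewrite -SE.
rewrite -(subnK ge); apply: (seq_basis_nat (c := fun k => c (k + size s)%N) bt); first by rewrite -TE.
by rewrite ltn_subLR // -size_cat.
Qed.

Lemma pluckerE l s m : size s = m ->
  plucker l s = \det (\matrix_(i < m, j < m) l i s`_j).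
Proof. by move=> <-. Qed.

(** The factor is the determinant of the change of basis; a kernel vector would be a relation among
    the vectors of [t]. *)
Lemma plucker_change M s t : size s = size t -> seq_basis M s -> seq_basis M t ->
  exists2 la : K, la != 0 & forall l, plucker l t = la * plucker l s.
Proof.
move=> sz [eM inds] [eM' indt].
have : forall j : 'I_(size t), exists c : 'I_(size s) -> K, t`_j = \sum_i c i *: s`_i.
  by move=> j; apply/lspan_seqP; rewrite eM -eM'; apply: sub_lspan; apply: mem_nth.
move=> /choice[c hc].
pose C := \matrix_(j < size t, k < size t) c j (cast_ord (esym sz) k).
have tE (j : 'I_(size t)) : t`_j = \sum_k C j k *: s`_k.
  rewrite hc (reindex (cast_ord (esym sz))) /=; last first.
    by exists (cast_ord sz) => i _; rewrite ?cast_ordK ?cast_ordKV.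
  by apply: eq_bigr => k _; rewrite mxE.
exists (\det C).
  apply/negP => /det0P[v v0 vC]; case/negP: v0; apply/eqP/rowP => j.
  rewrite mxE; apply: (indt (fun j => v 0 j)).
  rewrite (eq_bigr (fun j => \sum_k (v 0 j * C j k) *: s`_k)); last first.
    by move=> i _; rewrite tE scaler_sumr; apply: eq_bigr => k _; rewrite scalerA.
  rewrite exchange_big big1 //= => k _; rewrite -scaler_suml.
  have := congr1 (fun x : 'rV_(size t) => x 0 k) vC; rewrite !mxE => ->.
  by rewrite scale0r.
move=> l; rewrite (pluckerE l sz) /plucker mulrC -(det_tr C) -det_mulmx; congr (\det _).
apply/matrixP => i j; rewrite !mxE tE linear_sum; apply: eq_bigr => k _.
by rewrite linearZ !mxE mulrC.
Qed.

(** Laplace expansion along the column of the first vector. It makes a coordinate of an enlarged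
    basis linear in those of the original one. *)
Lemma plucker_cons l f s : plucker l (f :: s) =
  \sum_(i < (size s).+1) l i f * ((-1) ^+ i * plucker (fun k => l (bump i k)) s).
Proof.
rewrite /plucker (expand_det_col _ ord0); apply: eq_bigr => i _.
rewrite mxE /cofactor addn0; congr (_ * (_ * \det _)).
by apply/matrixP => k j; rewrite !mxE.
Qed.

End Bases.

Section Pluecker.
Variables (K : fieldType) (V : lmodType K).
Implicit Types (M : set V) (c : seq V) (l : nat -> {scalar V}).

(** A kernel vector of the matrix is the vector of coefficients, in the basis [c], of a common zero
    of the functionals. *)
Lemma plucker_eq0 M c l : seq_basis M c -> plucker l c = 0 <->
  exists v, [/\ v != 0, M v & forall i, (i < size c)%N -> l i v = 0].
Proof.
move=> [eM ind]; have hM : subspace M by rewrite -eM; apply: lspan_subspace.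
rewrite /plucker; set L := \matrix_(i, j) _.
have Lx (x : 'cV_(size c)) (i : 'I_(size c)) :
    (L *m x) i 0 = l i (\sum_j x j 0 *: c`_j).
  rewrite mxE linear_sum; apply: eq_bigr => j _.
  by rewrite linearZ !mxE mulrC.
split=> [/eqP|[v [v0 Mv lv]]].
  rewrite -det_tr => /det0P[x x0 xL]; exists (\sum_j x 0 j *: c`_j); split.
  - apply: contra_neq x0 => /ind h; apply/rowP => j; rewrite mxE; exact: h.
  - apply: subspace_sumI => // j; apply: (subspaceZ hM); rewrite -eM.
    by apply: sub_lspan; apply: mem_nth.
  move=> i lt; have := Lx x^T (Ordinal lt).
  rewrite -[L *m _]trmxK trmx_mul trmxK xL trmx0 mxE => ->.
  by congr (l i _); apply: eq_bigr => j _; rewrite mxE.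
rewrite -det_tr; apply/eqP/det0P; move: Mv; rewrite -eM => /lspan_seqP[x eq].
exists (\row_j x j).
  apply: contra_neq v0 => x0; rewrite eq big1 // => j _.
  by have := congr1 (fun r : 'rV_(size c) => r 0 j) x0; rewrite !mxE => ->; rewrite scale0r.
apply: trmx_inj; rewrite trmx_mul trmxK trmx0; apply/colP => i.
rewrite Lx mxE -[RHS](lv i (ltn_ord i)) eq; congr (l i _).
by apply: eq_bigr => j _; rewrite !mxE.
Qed.

(* Cramer's rule. *)
Lemma plucker_ratio M c l l' h v k : seq_basis M c -> M v -> (k < size c)%N ->
  (forall i, (i < size c)%N -> l i v = (i == k)%:R) ->
  (forall i, i != k -> l' i = l i) -> l' k = h ->
  plucker l' c = h v * plucker l c.
Proof.
move=> [eM ind] Mv lt lv l'l l'k; pose k0 := Ordinal lt.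
rewrite /plucker; set L' := \matrix_(i, j) _; set L := \matrix_(i, j) _.
move: Mv; rewrite -eM => /lspan_seqP[x0 eq]; pose x := \col_j x0 j.
have Lx (m : nat -> {scalar V}) (i : 'I_(size c)) :
    ((\matrix_(i < size c, j < size c) m i c`_j) *m x) i 0 = m i v.
  rewrite mxE eq linear_sum; apply: eq_bigr => j _.
  by rewrite linearZ !mxE mulrC.
pose dk : 'cV[K]_(size c) := delta_mx k0 0.
have LxE : L *m x = dk.
  apply/colP => i; rewrite Lx lv // mxE eqxx andbT.
  by congr (nat_of_bool _)%:R; apply/eqP/eqP => [ik|->//]; apply: val_inj.
have L'xE : L' *m x = h v *: dk.
  apply/colP => i; rewrite Lx !mxE eqxx andbT.
  have [->|ne] := eqVneq i k0; first by rewrite /= l'k mulr1.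
  by rewrite mulr0 l'l // lv // (negbTE (ne : (i : nat) != k)).
(* Column [k0] of the adjugate consists of the cofactors along row [k0], the only row in which [L]
   and [L'] may differ. *)
have adjE : \adj L *m dk = \adj L' *m dk.
  apply/colP => j; rewrite -colE -[in RHS]colE !mxE /cofactor; congr (_ * \det _).
  apply/matrixP => i i'; rewrite !mxE l'l //.
  by have /= := neq_lift k0 i; rewrite eq_sym.
have e1 : \det L *: x = \adj L *m dk by rewrite -LxE mulmxA mul_adj_mx mul_scalar_mx.
have e2 : \det L' *: x = h v *: (\adj L' *m dk).
  by rewrite scalemxAr -L'xE mulmxA mul_adj_mx mul_scalar_mx.
have e3 : (\det L' - h v * \det L) *: x = 0.
  by rewrite scalerBl e2 -adjE -e1 scalerA subrr.
move: e3 => /eqP; rewrite scaler_eq0 subr_eq0 => /orP[/eqP //|/eqP x0'].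
have := congr1 (fun r : 'cV_(size c) => r k0 0) LxE.
by rewrite x0' mulmx0 !mxE !eqxx => /eqP; rewrite eq_sym oner_eq0.
Qed.

End Pluecker.

(** * Enumerations and finite counts *)

(** One indexing for finite and infinite [I]: [bd] singles out the meaningful indices, so that
    orbits of finite and of infinite dimension are parametrized by the same formulas. *)
Lemma enumeration (T : choiceType) (I : set T) (t0 : T) : countable I ->
  exists (en : nat -> T) (idx : T -> nat),
    let bd i := if `[<finite_set I>] then (i < #|` fset_set I|%fset)%N else true in
    (forall i, bd i -> I (en i) /\ idx (en i) = i) /\
    (forall t, I t -> bd (idx t) /\ en (idx t) = t).
Proof.
move=> cI; case: asboolP => [fI|nfI].
  exists (fun i => nth t0 (fset_set I) i), (fun t => index t (fset_set I)); split=> [i lt|t It].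
    split; last by rewrite index_uniq.
    have : nth t0 (fset_set I) i \in fset_set I by apply: mem_nth.
    by rewrite in_fset_set // inE.
  have tI : t \in fset_set I by rewrite in_fset_set // inE.
  by rewrite index_mem nth_index.
have : (I #= [set: nat])%card.
  by rewrite card_eq_le; apply/andP; split=> //; apply/infiniteP.
move=> /card_set_bijP[f [_ finj fsurj]].
have : forall i, exists t, I t /\ f t = i.
  by move=> i; have [t It eq] := fsurj i Logic.I; exists t.
move=> /choice[en hen]; exists en, f; split=> [i _|t It]; first exact: hen.
by split=> //; apply: finj; rewrite ?inE //; have [] := hen (f t).
Qed.

Lemma var_morphism_ext (K : fieldType) T T' (x : coordsys K T) (X : set T)
    (y : coordsys K T') Y (phi psi : T -> T') :
  (forall p, X p -> phi p = psi p) -> var_morphism x X y Y phi -> var_morphism x X y Y psi.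
Proof.
move=> eq [h1 h2]; split=> [p Xp|U f oU rf]; first by rewrite -eq //; apply: h1.
have [o1 r1] := h2 U f oU rf.
have eqU : X `&` phi @^-1` U = X `&` psi @^-1` U.
  by apply/seteqP; split=> p [Xp]; rewrite /preimage /= eq.
rewrite eqU in o1 r1; split=> // p pU; have [U' [oU' U'p sub [e [P [Q [hP hQ h]]]]]] := r1 p pU.
exists U'; split=> //; exists e, P, Q; split=> // q c U'q cq.
by have [Q0 <-] := h q c U'q cq; split=> //=; rewrite eq //; have [] := sub _ U'q.
Qed.

Section CountableBasis.
Variables (T : Type) (E : set T).
Hypothesis E_countable : (E #= [set: nat])%card.

Lemma ex_basis_vector : exists e : E, True.
Proof.
have /card_set_bijP[f [_ _ surj]] := E_countable.
by have [v Ev _] := surj 0%N Logic.I; exists (SigSub (mem_set Ev)).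
Qed.

Lemma countable_pairs (S : set (E * E)) : countable S.
Proof.
apply: (@sub_countable _ _ _ ([set: E] `*` [set: E])).
  by apply: subset_card_le => -[].
have c : countable [set: E].
  rewrite (eq_countable (card_setT E)) (eq_countable E_countable).
  exact: countableP.
exact: countableX.
Qed.

End CountableBasis.

Lemma ltn_sum_seq (T : eqType) (r : seq T) (F G : T -> nat) t :
  (forall x, F x <= G x)%N -> t \in r -> (F t < G t)%N ->
  (\sum_(x <- r) F x < \sum_(x <- r) G x)%N.
Proof.
move=> le; elim: r => // x r IH; rewrite inE !big_cons => /orP[/eqP <-|tr] lt.
  by rewrite -addSn; apply: leq_add => //; apply: leq_sum.
by rewrite -addnS; apply: leq_add => //; apply: IH.
Qed.

Lemma count_two (T : eqType) (I : seq T) i j (p : pred T) : uniq I ->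
  i \in I -> j \in I -> i != j ->
  count p I = (p i + p j + count p [seq f <- I | (f != i) && (f != j)])%N.
Proof.
move=> uI iI jI ij; rewrite -addnA.
suff /permP -> : perm_eq I (i :: j :: [seq f <- I | (f != i) && (f != j)]) by [].
apply: uniq_perm => // [|f].
  by rewrite /= inE (negbTE ij) !mem_filter !eqxx /= andbF filter_uniq.
rewrite !inE mem_filter; have [->|fi] := eqVneq f i; first by rewrite iI.
by have [->|] := eqVneq f j; rewrite ?jI.
Qed.

Lemma count_split (T : Type) (I : seq T) (p q r : pred T) :
  (forall x, p x = q x + r x :> nat)%N -> count p I = (count q I + count r I)%N.
Proof. by move=> h; elim: I => //= x I ->; rewrite h addnACA. Qed.

(** * The order on maps and its rank functions *)

Section BruhatOrder.
Variables (K : fieldType) (V : lmodType K) (E : set V).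
Variables (leB : rel E) (leB_refl : reflexive leB) (leB_anti : antisymmetric leB).
Hypotheses (leB_trans : transitive leB) (leB_total : total leB).
Variables (d : Order.disp_t) (A : orderType d).
Implicit Types (e f i j : E) (s t : E -> A) (a : A).

(** For [I] without repetitions, the dimension of the trace on the span of [I] of the intersection
    of F''_{s,a} with F''_{0,e}. *)
Definition brank (I : seq E) s e a : nat := count (fun f => (s f <= a)%O && leB f e) I.

Definition swap i j : E -> E := [eta idfun with i |-> j, j |-> i].

Lemma swapE i j f : swap i j f = if f == i then j else if f == j then i else f.
Proof. by []. Qed.

Lemma strict_le_trans i j k : strict leB i j -> leB j k -> strict leB i k.
Proof.
move=> /andP[ne ij] jk; apply/andP; split; last exact: leB_trans jk.
by apply: contra_neq ne => ik; apply: leB_anti; rewrite ij ik.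
Qed.

Lemma strictNle i j : strict leB i j = ~~ leB j i.
Proof.
apply/idP/idP => [/andP[ne ij]|nji].
  by apply: contra ne => ji; apply/eqP; apply: leB_anti; rewrite ij.
have [ij|ji] := orP (leB_total i j); last by rewrite ji in nji.
by apply/andP; split=> //; apply: contra nji => /eqP ->.
Qed.

Section Step.
Variables (I : seq E) (s t : E -> A).
Hypotheses (uI : uniq I) (off : forall f, f \notin I -> s f = t f).
Hypotheses (pst : perm_eq (map s I) (map t I)).
Hypothesis rle : forall e a, (brank I t e a <= brank I s e a)%N.

(** Only the terms of [i] and [j] change. When both or neither lie below [e] their joint
    contribution is the same; in between only [i] is counted, and its value rises from [s i] to
    [s j]. *)
Lemma brank_swap i j e a : i \in I -> j \in I -> strict leB i j -> (s i < s j)%O ->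
  (brank I (s \o swap i j) e a +
   ([&& leB i e, ~~ leB j e, (s i <= a)%O & (a < s j)%O] : nat))%N = brank I s e a.
Proof.
move=> iI jI ij sij; have [ne le] := andP ij.
rewrite /brank !(count_two _ uI iI jI ne) /= !swapE !eqxx eq_sym (negbTE ne).
have -> : count (fun f => (s (swap i j f) <= a)%O && leB f e) [seq f <- I | (f != i) && (f != j)]
  = count (fun f => (s f <= a)%O && leB f e) [seq f <- I | (f != i) && (f != j)].
  apply: eq_in_count => f; rewrite mem_filter => /andP[/andP[fi fj] _].
  by rewrite swapE (negbTE fi) (negbTE fj).
have h1 : leB j e -> leB i e by apply: leB_trans le.
have h2 : (s j <= a)%O -> (s i <= a)%O by move=> h; apply: le_trans h; apply: ltW.
rewrite addnAC; congr (_ + _)%N; rewrite ltNge.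
case: (leB j e) h1 => [->|_] //; last case: (leB i e);
  case: (s j <= a)%O h2 => [->|_] //; by case: (s i <= a)%O.
Qed.

(** [i] is the first place where [s] and [t] differ, [j] the first later place with
    [s i < s j <= t i]. Exchanging the two values lowers ranks inside one box only, and the choice
    of [j] leaves room there above the ranks of [t]. The last clause provides the measure for an
    induction. *)
Lemma bruhat_step : s <> t -> exists s', [/\ hat_lt leB s s',
  forall f, f \notin I -> s' f = t f, perm_eq (map s' I) (map t I),
  forall e a, (brank I t e a <= brank I s' e a)%N &
  exists i, [/\ i \in I, forall e a, (brank I s' e a <= brank I s e a)%N &
    (brank I s' i (s i) < brank I s i (s i))%N]].
Proof.
move=> ne.
have ge_refl : reflexive (fun x y => leB y x) by move=> x; apply: leB_refl.
have ge_trans : transitive (fun x y => leB y x) by move=> x y z h1 h2; apply: leB_trans h1.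
have ge_total : total (fun x y => leB y x) by move=> x y; apply: leB_total.
have [|i] := max_seq ge_refl ge_trans ge_total (s := [seq f <- I | s f != t f]).
  apply/eqP => D0; apply: ne; apply/funext => f; have [fI|/off //] := boolP (f \in I).
  apply/eqP/negPn/negP => ne; have : f \in [seq f <- I | s f != t f] by rewrite mem_filter ne.
  by rewrite D0.
rewrite mem_filter => /andP[nei iI] imin.
have below f : ~~ leB i f -> s f = t f.
  have [fI|/off //] := boolP (f \in I); move=> nif; apply/eqP; apply: contraNT nif => nef.
  by apply: imin; rewrite mem_filter nef.
have split_at (u : E -> A) e a : leB i e -> brank I u e a =
    (count (fun f => (u f <= a)%O && ~~ leB i f) I +
     count (fun f => (u f <= a)%O && (leB i f && leB f e)) I)%N.
  move=> ie; apply: count_split => f.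
  have : ~~ leB i f -> leB f e.
    by rewrite -strictNle => /strict_le_trans /(_ ie) /andP[].
  by case: (u f <= a)%O; case: (leB i f); case: (leB f e) => // /(_ isT).
have belowE a : count (fun f => (s f <= a)%O && ~~ leB i f) I =
    count (fun f => (t f <= a)%O && ~~ leB i f) I.
  apply: eq_count => f; have [_|/below ->//] := boolP (leB i f); by rewrite !andbF.
(* Before [i] the maps agree, so at [(i, t i)] the two ranks differ only in the term of [i]. *)
have sti : (s i < t i)%O.
  rewrite lt_neqAle nei leNgt; apply/negP => tis; have := rle i (t i).
  rewrite !split_at // belowE leq_add2l leqNgt => /negP; apply.
  have e1 (u : E -> A) : count (fun f => (u f <= t i)%O && (leB i f && leB f i)) I =
      count (fun f => (u i <= t i)%O && (f == i)) I.
    apply: eq_in_count => f fI; have [->|fi] := eqVneq f i; first by rewrite leB_refl.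
    rewrite [in RHS]andbF; apply/negP => /andP[_ /andP[h1 h2]]; case/eqP: fi.
    by apply: leB_anti; rewrite h1 h2.
  rewrite !e1 lexx; apply: (@leq_ltn_trans 0%N).
    by rewrite (eq_count (a2 := pred0)) ?count_pred0 // => f /=; rewrite leNgt tis.
  by rewrite -has_count; apply/hasP; exists i => //=; rewrite eqxx.
(* [s] and [t] take the value [t i] equally often on [I] and agree before [i]; at [i] only [t] takes
   it, so [s] takes it later. *)
have cand : exists2 j, j \in I & strict leB i j /\ s j = t i.
  apply: contrapT => nj.
  have := permP pst (pred1 (t i)); rewrite !count_map => eq.
  have : (count (preim s (pred1 (t i))) I < count (preim t (pred1 (t i))) I)%N.
    have c (u : E -> A) : count (preim u (pred1 (t i))) I =
        (count (fun f => (u f == t i) && ~~ leB i f) I +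
         count (fun f => (u f == t i) && leB i f) I)%N.
      by apply: count_split => f /=; case: (u f == t i); case: (leB i f).
    rewrite !c.
    have -> : count (fun f => (s f == t i) && ~~ leB i f) I =
        count (fun f => (t f == t i) && ~~ leB i f) I.
      by apply: eq_count => f; have [_|/below ->//] := boolP (leB i f); rewrite !andbF.
    rewrite ltn_add2l; have -> : count (fun f => (s f == t i) && leB i f) I = 0%N.
      apply/eqP; rewrite -leqn0 leqNgt -has_count; apply/hasP => -[f fI /andP[/eqP sf le]].
      apply: nj; exists f => //; split=> //; apply/andP; split=> //.
      by apply: contra_neq nei => eqi; rewrite {1}eqi.
    by rewrite -has_count; apply/hasP; exists i => //; rewrite eqxx leB_refl.
  by rewrite eq ltnn.
pose good j := [&& strict leB i j, (s i < s j)%O & (s j <= t i)%O].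
have [|j] := max_seq ge_refl ge_trans ge_total (s := [seq f <- I | good f]).
  have [j jI [ij sj]] := cand; apply/eqP => D0.
  have : j \in [seq f <- I | good f] by rewrite mem_filter /good ij sj sti lexx.
  by rewrite D0.
rewrite mem_filter => /andP[/and3P[ij sij sjt] jI] jmin.
have bs e a := brank_swap e a iI jI ij sij.
exists (s \o swap i j); split.
- by exists i, j.
- move=> f fI; rewrite /= swapE; case: eqP => [fi|_]; first by rewrite fi iI in fI.
  by case: eqP => [fj|_]; [rewrite fj jI in fI|apply: off].
- apply: perm_trans pst; apply/permP => p; rewrite !count_map.
  have [ne' _] := andP ij; rewrite !(count_two _ uI iI jI ne') /= !swapE !eqxx eq_sym (negbTE ne').
  congr (_ + _)%N; first by rewrite addnC.
  apply: eq_in_count => f; rewrite mem_filter => /andP[/andP[fi fj] _].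
  by rewrite /= swapE (negbTE fi) (negbTE fj).
- move=> e a; have := bs e a; case: (boolP [&& _, _, _ & _]) => [/and4P[ie nje sia asj]|_]; last first.
    by rewrite addn0 => ->.
  rewrite addn1 => eq; rewrite -ltnS eq.
  (* Inside the box the rank of [s] must strictly exceed that of [t]. Raising [a] to [t i] adds
     nothing for [s] between [i] and [e], by minimality of [j], while for [t] it adds at least
     [i]. *)
  have cs : count (fun f => (s f <= a)%O && (leB i f && leB f e)) I =
      count (fun f => (s f <= t i)%O && (leB i f && leB f e)) I.
    apply: eq_in_count => f fI; case: (boolP (leB i f && leB f e)) => [/andP[if_ fe]|]; last by rewrite !andbF.
    rewrite !andbT; apply/idP/idP => [sfa|sft].
      by apply: le_trans sfa _; apply: ltW; apply: lt_le_trans sjt.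
    have [->//|nef] := eqVneq f i; rewrite leNgt; apply/negP => asf.
    case/negP: nje; apply: leB_trans fe; apply: jmin; rewrite mem_filter fI andbT.
    by rewrite /good sft andbT (le_lt_trans sia asf) andbT; apply/andP; split; rewrite // eq_sym.
  have ct : (count (fun f => (t f <= a)%O && (leB i f && leB f e)) I <
      count (fun f => (t f <= t i)%O && (leB i f && leB f e)) I)%N.
    have at_ : (a < t i)%O by apply: lt_le_trans sjt.
    have -> : count (fun f => (t f <= t i)%O && (leB i f && leB f e)) I =
        (count (fun f => (t f <= a)%O && (leB i f && leB f e)) I +
         count (fun f => [&& (a < t f)%O, (t f <= t i)%O & (leB i f && leB f e)]) I)%N.
      apply: count_split => f; rewrite ltNge; have [fa|_] := boolP (t f <= a)%O => //=.
      by rewrite (le_trans fa (ltW at_)) addn0.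
    rewrite -[X in (X < _)%N]addn0 ltn_add2l -has_count; apply/hasP; exists i => //.
    by rewrite at_ lexx leB_refl ie.
  have := rle e (t i); rewrite !split_at // belowE leq_add2l => h.
  by rewrite belowE ltn_add2l cs; apply: leq_trans h.
exists i; split=> // [e a|]; first by rewrite -(bs e a) leq_addr.
rewrite -[X in (_ < X)%N](bs i (s i)) leB_refl lexx sij -strictNle ij /=.
by rewrite addn1.
Qed.

End Step.

(** Induction on the sum of the ranks over [I] and the values taken there. A step raises no rank and
    lowers the one at [(i, s i)], which is in the list because [s i] is also a value of [t]. *)
Lemma brank_bruhat (I : seq E) s t : uniq I -> (forall f, f \notin I -> s f = t f) ->
  perm_eq (map s I) (map t I) -> (forall e a, (brank I t e a <= brank I s e a)%N) ->
  bruhat_le leB s t.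
Proof.
move=> uI; pose L := [seq (e, a) | e <- I, a <- map t I].
have [N] := ubnP (\sum_(x <- L) brank I s x.1 x.2)%N.
elim: N s => // N IH s lt off pst rle.
have [->|ne] := pselect (s = t); first by right.
have [s' [hat off' pst' rle' [i [iI mono lt']]]] := bruhat_step uI off pst rle ne.
have [|h|<-] := IH s' _ off' pst' rle'.
- rewrite ltnS in lt; apply: leq_trans lt; apply: (ltn_sum_seq (t := (i, s i))) => //.
  by apply/allpairsP; exists (i, s i); rewrite /= iI -(perm_mem pst) map_f.
- by left; apply: t_trans h; apply: t_step.
by left; apply: t_step.
Qed.

End BruhatOrder.

Lemma closed_field_infinite (K : closedFieldType) (r : seq K) : exists y, y \notin r.
Proof.
(* At each listed [x] the value is 1, so a root is new; the factor ['X] keeps [q] non-constant when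
   [r] is empty. *)
pose q : {poly K} := 'X * \prod_(x <- r) ('X - x%:P) + 1.
have m : \prod_(x <- r) ('X - x%:P) \is monic by apply: monic_prod_XsubC.
have sz : (1 < size ('X * \prod_(x <- r) ('X - x%:P))%R)%N.
  rewrite mulrC size_mulX ?monic_neq0 // size_prod_XsubC //.
have [|y] := closed_rootP q _.
  rewrite /q size_polyDl ?size_poly1 //.
  by rewrite neq_ltn sz orbT.
rewrite /root /q hornerD hornerM hornerX hornerC => y0; exists y; apply/negP => yr.
have : root (\prod_(x <- r) ('X - x%:P)) y by rewrite root_prod_XsubC.
by move=> /eqP ry; move: y0; rewrite ry mulr0 add0r oner_eq0.
Qed.

(** * Scaling with infinitely many projective factors *)

Section Homogeneity.
Variable K : fieldType.

Lemma form_finsupp T (x : coordsys K T) : (forall j, finite_set [set i | cdeg x j i != 0%N]) ->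
  forall dd P, form x dd P -> finite_set [set i | dd i != 0%N].
Proof.
move=> hx dd P; elim=> {dd P} //.
  by move=> a; rewrite (_ : mkset _ = set0) //; apply/seteqP; split=> i //=; rewrite eqxx.
move=> d1 d2 P Q _ h1 _ h2; apply: (@sub_finite_set _ _ ([set i | d1 i != 0%N] `|` [set i | d2 i != 0%N])).
  move=> i /=; rewrite addn_eq0 negb_and => /orP[]; [by left|by right].
by rewrite finite_setU.
Qed.

(** There may be infinitely many projective factors, but a form has non-zero degree in finitely many
    of them, so its scaling factor is a finite product. *)
Lemma homog_scale (T : Type) (I : choiceType) (J : Type) (cn : Type) (ov : cn -> T -> Prop)
    (cc : J -> cn -> K) (idx : J -> I) (c c' : cn) (la : I -> K) :
  let x := CoordSys cn ov I J cc (fun j i => (i == idx j) : nat) in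
  (forall i, la i != 0) -> (forall j, cc j c' = la (idx j) * cc j c) ->
  @homog_at _ _ x c c'.
Proof.
move=> x la0 hcc.
pose mu (dd : I -> nat) := \prod_(i <- fset_set [set i | dd i != 0%N]) la i ^+ dd i.
have muE (r : seq I) dd : uniq r -> (forall i, dd i != 0%N -> i \in r) ->
    mu dd = \prod_(i <- r) la i ^+ dd i.
  move=> ur hr; rewrite [RHS](bigID (fun i => dd i != 0%N)) /= [X in _ * X]big1 ?mulr1; last first.
    by move=> i; rewrite negbK => /eqP ->; rewrite expr0.
  rewrite -big_filter; apply: perm_big; apply: uniq_perm; [exact: fset_uniq|exact: filter_uniq|].
  have fs : finite_set [set i | dd i != 0%N].
    by apply: (sub_finite_set (B := [set` r])); [move=> i /= /hr|exact: finite_seq].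
  move=> i; rewrite mem_filter in_fset_set //.
  have -> : (i \in [set i | dd i != 0%N]) = (dd i != 0%N) by apply/idP/idP; rewrite inE.
  by have [_ //|ne] := eqVneq (dd i) 0%N; rewrite (hr i ne).
exists mu => dd P hP; split.
  by rewrite /mu prodf_seq_neq0; apply/allP => i _ /=; apply: expf_neq0.
have hx j : finite_set [set i | cdeg x j i != 0%N].
  apply: (sub_finite_set (B := [set idx j])); last exact: finite_set1.
  by move=> i /=; have [|] := eqVneq i (idx j).
have mu0 : mu (fun=> 0%N) = 1 by rewrite (muE [::]) ?big_nil.
have muD d1 d2 : finite_set [set i | d1 i != 0%N] -> finite_set [set i | d2 i != 0%N] ->
    mu (fun i => (d1 i + d2 i)%N) = mu d1 * mu d2.
  move=> f1 f2; pose r : seq I := fset_set ([set i | d1 i != 0%N] `|` [set i | d2 i != 0%N]).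
  have mr i : (d1 i != 0%N) || (d2 i != 0%N) -> i \in r.
    by rewrite in_fset_set ?finite_setU // => /orP[] h; rewrite inE; [left|right].
  rewrite !(muE r) ?fset_uniq // => [|i i0|i i0|i i0].
  - by rewrite -big_split /=; apply: eq_bigr => i _; rewrite exprD.
  - by apply: mr; rewrite i0 orbT.
  - by apply: mr; rewrite i0.
  by apply: mr; rewrite -negb_and -addn_eq0.
elim: hP => {dd P} [a|j|dd P Q _ hP _ hQ|d1 d2 P Q fP hP fQ hQ].
- by rewrite mu0 mul1r.
- rewrite /= hcc (muE [:: idx j]) // => [|i]; first by rewrite big_seq1 /= eqxx expr1.
  by rewrite inE /=; have [|] := eqVneq i (idx j).
- by rewrite hP hQ mulrDr.
have f1 := form_finsupp hx fP; have f2 := form_finsupp hx fQ.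
by rewrite hP hQ (muD _ _ f1 f2) mulrACA.
Qed.

End Homogeneity.

(** * Leading terms with respect to [leB] *)

Section Flags.
Variables (K : fieldType) (V : lmodType K) (E : set V) (bE : is_basis E).
Variables (En : nat -> set V) (En_finite : forall n, finite_set (En n)).
Hypotheses (En_mono : forall n, En n `<=` En n.+1) (En_cover : E = \bigcup_n En n).
Variables (leB : rel E) (leB_refl : reflexive leB) (leB_anti : antisymmetric leB).
Hypotheses (leB_trans : transitive leB) (leB_total : total leB).
Variables (d : Order.disp_t) (A : orderType d) (sigma0 : E -> A).
Hypothesis sigma0_surj : forall a, exists e, sigma0 e = a.
Implicit Types (g h : V -> V) (v : V) (e f : E) (s t : E -> A).

Definition lead v e := crd bE e v != 0 /\ forall f, crd bE f v != 0 -> leB f e.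

Lemma lead_ex v : v != 0 -> exists e, lead v e.
Proof.
move=> v0; have [s [us hs eq]] := crd_supp bE v.
have [|e es he] := max_seq leB_refl leB_trans leB_total (s := s).
  by apply: contra_neq v0 => s0; rewrite eq s0 big_nil.
by exists e; split=> [|f f0]; [rewrite -hs|apply: he; rewrite hs].
Qed.

Lemma lead_neq0 v e : lead v e -> v != 0.
Proof. by case=> + _; apply: contra_neq => ->; rewrite crd0. Qed.

Lemma lead_uniq v e f : lead v e -> lead v f -> e = f.
Proof. by move=> [e0 he] [f0 hf]; apply: leB_anti; rewrite hf // he. Qed.

Lemma lead_val e : lead (\val e) e.
Proof.
split=> [|f]; rewrite crdE ?eqxx ?oner_eq0 //.
by have [-> //|_] := eqVneq e f; rewrite eqxx.
Qed.

Definition below (b : bool) e : set E :=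
  [set f | (if b then leB else strict leB) f e].

Lemma F0E e b : F0 leB e b = CS bE (below b e).
Proof. by rewrite /F0 /fpart lspan_CS. Qed.

Lemma leadP v e : lead v e <-> F0 leB e true v /\ ~ F0 leB e false v.
Proof.
rewrite !F0E; split=> [[e0 he]|[ht hf]].
  split=> [f nfe|h]; first by apply/eqP; apply: contra_notT nfe => /he.
  by rewrite h ?eqxx // in e0; rewrite /below /= /strict eqxx.
have hle f : crd bE f v != 0 -> leB f e.
  by apply: contra_neqT => nfe; apply: ht => /=; apply/negP.
split=> //; apply: contra_notN hf => /eqP e0 f nfe.
have [->//|ne] := eqVneq f e; apply: ht => fe; apply: nfe.
by rewrite /below /= /strict ne.
Qed.

(** The coefficient of [e] in [g v] comes from [e] alone, since the other basis vectors in the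
    support of [v] have images with smaller leading terms. *)
Lemma lead_image g : linear g -> (forall e, lead (g (\val e)) e) ->
  forall v e, lead v e -> lead (g v) e.
Proof.
move=> lg hg v e [e0 he]; have [s [us hs eq]] := crd_supp bE v.
have gv f : crd bE f (g v) = \sum_(h <- s) crd bE h v * crd bE f (g (\val h)).
  rewrite {1}eq lin_sum // crd_sum; apply: eq_bigr => h _.
  by rewrite linZ // crdZ.
split=> [|f].
  rewrite gv (bigD1_seq e) ?hs //= big_seq_cond big1 ?addr0.
    by rewrite mulf_neq0 //; case: (hg e).
  move=> h /andP[]; rewrite hs => /he hle ne.
  have [_ hh] := hg h; have [->|/hh eh] := eqVneq (crd bE e (g (\val h))) 0.
    by rewrite mulr0.
  by case/eqP: ne; apply: leB_anti; rewrite hle.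
apply: contra_neqT => nfe; rewrite gv big_seq big1 // => h.
rewrite hs => /he hle; have [_ hh] := hg h.
have [->|/hh fh] := eqVneq (crd bE f (g (\val h))) 0; first by rewrite mulr0.
by case/negP: nfe; apply: leB_trans hle.
Qed.

Lemma lead_inj g : linear g -> (forall e, lead (g (\val e)) e) -> injective g.
Proof.
move=> lg hg u v eq; apply/eqP; rewrite -subr_eq0; apply/negPn/negP => /lead_ex[e].
by move=> /(lead_image lg hg)/lead_neq0; rewrite linB // eq subrr eqxx.
Qed.

(** * Finite levels and commensurability *)

Definition In n : seq E := fset_set [set e : E | En n (\val e)].

Lemma In_uniq n : uniq (In n).
Proof. exact: fset_uniq. Qed.
#[local] Hint Resolve In_uniq : core.

Lemma In_fin n : finite_set [set e : E | En n (\val e)].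
Proof.
by apply: (finite_preimage (f := \val) (B := En n)) => // x y _ _; apply: val_inj.
Qed.

Lemma mem_In n e : e \in In n <-> En n (\val e).
Proof.
have := in_fset_set (In_fin n) e; rewrite /In => ->.
by split; rewrite in_setE.
Qed.

Lemma En_le n m : (n <= m)%N -> En n `<=` En m.
Proof.
elim: m => [|m IH]; first by rewrite leqn0 => /eqP ->.
by rewrite leq_eqVlt => /orP[/eqP -> //|/IH h] v /h; apply: En_mono.
Qed.

Lemma In_le n m : (n <= m)%N -> {subset In n <= In m}.
Proof. by move=> /En_le h e /mem_In he; apply/mem_In; apply: h. Qed.

Lemma In_cover (s : seq E) : exists n, {subset s <= In n}.
Proof.
elim: s => [|e s [n hn]]; first by exists 0%N.
have [m _ em] : (\bigcup_n En n) (\val e) by rewrite -En_cover; apply: set_valP.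
exists (maxn n m) => f; rewrite inE => /orP[/eqP ->|/hn fs].
  by apply: (In_le (leq_maxr n m)); apply/mem_In.
exact: (In_le (leq_maxl n m)).
Qed.

Definition W n : set V := CS bE (inI (In n)).

Lemma W_subspace n : subspace (W n). Proof. exact: CS_subspace. Qed.
#[local] Hint Resolve W_subspace : core.

Lemma lspan_En n : lspan (En n) = W n.
Proof.
rewrite (lspan_subset_CS bE); last by rewrite En_cover => v; exists n.
by congr (CS bE); apply/seteqP; split=> e /mem_In.
Qed.

Lemma W_le n m : (n <= m)%N -> W n `<=` W m.
Proof. by move=> nm; apply: CS_mono => e; apply: In_le. Qed.

Lemma W_val n (e : E) : e \in In n -> W n (\val e).
Proof. by move=> en; apply: CS_val. Qed.

Lemma W_cover (s : seq V) : exists n, forall v, v \in s -> W n v.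
Proof.
elim: s => [|v s [n hn]]; first by exists 0%N.
have [t [_ ht _]] := crd_supp bE v; have [m hm] := In_cover t.
exists (maxn n m) => u; rewrite inE => /orP[/eqP ->|/hn]; last first.
  by apply: W_le; exact: leq_maxl.
apply: (W_le (leq_maxr n m)) => e nI; apply/eqP; rewrite -[_ == _]negbK -ht.
by apply/negP => /hm.
Qed.

Lemma findim_W U (s : seq V) : seq_basis U s -> subspace U /\ exists n, U `<=` W n.
Proof.
move=> [<- _]; split; first exact: lspan_subspace.
by have [n hn] := W_cover s; exists n; apply: lspan_min; first exact: W_subspace.
Qed.

Lemma W_basis n : exists r, seq_basis (W n) r.
Proof.
have [s] := ex_basis bE (In_uniq n) (W_subspace n).
by rewrite setIid => hs; exists s.
Qed.

(* Commensurability of [X] and [Y] through the finite-dimensional subspace [W n]. *)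
Definition simn n X Y := sumset X (W n) = sumset Y (W n) /\
  rk (In n) X = rk (In n) Y.

Lemma simn_sym n X Y : simn n X Y -> simn n Y X.
Proof. by case. Qed.

Lemma simn_trans n X Y Z : simn n X Y -> simn n Y Z -> simn n X Z.
Proof. by move=> [a b] [a1 b1]; split; [rewrite a|rewrite b]. Qed.

(** For [U] inside [W n] the modular law makes the trace of [X + U] the sum of [U] and the trace of
    [X], to which the dimension formula applies. *)
Lemma rk_enlarge n X U : subspace X -> subspace U -> U `<=` W n ->
  (rk (In n) X + rk (In n) U =
   rk (In n) (sumset X U) + rk (In n) (X `&` U))%N.
Proof.
move=> hX hU UW; have uI := In_uniq n; have hW := W_subspace n.
have hXW := subspaceI hX hW.
have -> : rk (In n) X = rk (In n) (X `&` W n).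
  by apply: eq_rk => // v [] //; case.
rewrite -(rk_sumI (bE := bE) uI hXW hU) //.
have hs := subspace_sumset hX hU; have hs' := subspace_sumset hXW hU.
congr (_ + _)%N; apply: eq_rk => //; try exact: subspaceI.
- by move=> _ [[u [Xu _] [v Uv <-]] _]; exists u => //; exists v.
- move=> _ [[u Xu [v Uv <-]] Wuv]; exists u; last by exists v.
  by split=> //; rewrite -[u](addrK v); apply: (subspaceB hW) => //; apply: UW.
- by move=> v [[[]]].
by move=> v [[Xv Uv] Wv].
Qed.

(** Replaces the unspecified space [U] of a commensuration by any level containing it, so that all
    comparisons take place on the spaces [W n]. *)
Lemma sim_simn n X Y U : subspace X -> subspace Y -> subspace U -> U `<=` W n ->
  sumset X U = sumset Y U -> same_dim (X `&` U) (Y `&` U) -> simn n X Y.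
Proof.
move=> hX hY hU UW eqs eqd; have hW := W_subspace n.
have sumW Z : subspace Z -> sumset Z (W n) = sumset (sumset Z U) (W n).
  move=> hZ; apply/seteqP; split.
    apply: sumset_min; first by apply: subspace_sumset => //; apply: subspace_sumset.
      by move=> v /(sumset_subl hU); apply: sumset_subl.
    by apply: sumset_subr; apply: subspace_sumset.
  apply: sumset_min; [exact: subspace_sumset| |exact: sumset_subr].
  apply: sumset_min; [exact: subspace_sumset|exact: sumset_subl|].
  by move=> v /UW; apply: sumset_subr.
split; first by rewrite sumW // eqs -sumW.
have := rk_enlarge hX hU UW; rewrite eqs.
have -> : rk (In n) (X `&` U) = rk (In n) (Y `&` U).
  apply/(same_dim_rk bE (In_uniq n) (subspaceI hX hU) (subspaceI hY hU)).
  have e Z : Z `&` U `&` CS bE (inI (In n)) = Z `&` U.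
    by apply/seteqP; split=> [v []//|v [Zv Uv]]; split=> //; apply: UW.
  by rewrite !e.
by rewrite -rk_enlarge // => /addIn.
Qed.

(** A vector of [Y] differs from one of [X] by an element of [Y] in [W n], and equality of ranks
    puts that element in [X]. *)
Lemma simn_eq n X Y : subspace X -> subspace Y -> X `<=` Y -> simn n X Y -> X = Y.
Proof.
move=> hX hY XY [eqs eqr]; apply/seteqP; split=> // v Yv.
have hW := W_subspace n.
have : sumset X (W n) v by rewrite eqs; apply: sumset_subl.
move=> [u Xu [w Ww eq]]; rewrite -eq; apply: (subspaceD hX) => //.
have XW : X `&` CS bE (inI (In n)) `<=` Y by move=> z [/XY].
apply: (rk_eq_sub (In_uniq n) hX hY XW); first by rewrite eqr.
by split=> //; rewrite -[w](addKr u) addrC eq; apply: (subspaceB hY) => //; apply: XY.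
Qed.

(* [g] comes from [GL(<E_n>)]. *)
Definition fin n g := [/\ linear g, bijective g, forall v, W n (g v - v) &
  forall e : E, e \notin In n -> g (\val e) = \val e].

Lemma fin_intro n g : linear g -> injective g -> (forall e : E, e \in In n -> W n (g (\val e))) ->
  (forall e : E, e \notin In n -> g (\val e) = \val e) -> fin n g.
Proof.
move=> lg ig gW goff; have hW := W_subspace n.
have h v : W n (g v - v).
  have [s [_ _ ->]] := crd_supp bE v; rewrite lin_sum // -sumrB.
  apply: subspace_sum => // e _; rewrite linZ // -scalerBr; apply: (subspaceZ hW).
  have [en|/goff ->] := boolP (e \in In n); last by rewrite subrr; case: hW.
  by apply: (subspaceB hW); [apply: gW|apply: W_val].
split=> //; exact: (finitary_bij (In_uniq n) lg ig h).
Qed.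

Lemma fin_W n g v : fin n g -> W n v <-> W n (g v).
Proof.
move=> [lg _ h _]; have hW := W_subspace n; split=> Wv.
  by rewrite -[g v](subrK v); apply: (subspaceD hW).
by have := subspaceB hW Wv (h v); rewrite subKr.
Qed.

Lemma fin_le n m g : (n <= m)%N -> fin n g -> fin m g.
Proof.
move=> nm [lg bg h off]; split=> // [v|e em]; first exact: (W_le nm).
by apply: off; apply: contra em; apply: In_le.
Qed.

Lemma fin_id n : fin n id.
Proof.
split=> //; first by exists id.
by move=> v; rewrite subrr; case: (W_subspace n).
Qed.

Lemma fin_comp n g h : fin n g -> fin n h -> fin n (g \o h).
Proof.
move=> [lg bg hg og] [lh bh hh oh]; split; [exact: lin_comp|exact: bij_comp| |].
  move=> v; rewrite /= -(subrK (h v) (g (h v))) -addrA.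
  exact: (subspaceD (W_subspace n)).
by move=> e en /=; rewrite oh // og.
Qed.

Lemma fin_inv n g h : fin n g -> cancel g h -> cancel h g -> fin n h.
Proof.
move=> [lg bg hg og] gh hg'; split; [exact: lin_cancel lg gh hg'|by exists g| |].
  move=> v; rewrite -opprB; apply: (subspaceN (W_subspace n)).
  by rewrite -{1}(hg' v).
by move=> e en; rewrite -{1}(og e en).
Qed.

Lemma fin_GE n g : fin n g -> GE E g.
Proof.
move=> [lg bg _ off]; split=> //.
apply: (sub_finite_set _ (En_finite n)) => v [Ev ne].
apply: contrapT => nv; apply: ne; apply: (off (SigSub (mem_set Ev))).
by apply/negP => /mem_In.
Qed.

Lemma GE_fin g : GE E g -> exists n, fin n g.
Proof.
move=> [lg bg /finite_seqP[s hs]].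
pose t := pmap (fun v => insub v : option E) s.
have [n1 h1] := In_cover t; have [n2 h2] := W_cover (map g s).
pose n := maxn n1 n2; exists n.
have ht (e : E) : e \notin In n -> g (\val e) = \val e.
  move=> en; apply: contrapT => ne; case/negP: en.
  apply: (In_le (leq_maxl n1 n2)); apply: h1; rewrite mem_pmap.
  apply/mapP; exists (\val e); last by rewrite valK.
  have : [set` s] (\val e) by rewrite -hs; split=> //; apply: set_valP.
  by [].
apply: fin_intro => //; first exact: bij_inj.
move=> e en; have [ge|ne] := eqVneq (g (\val e)) (\val e); first by rewrite ge; apply: W_val.
apply: (W_le (leq_maxr n1 n2)); apply: h2; apply: map_f.
have : [set` s] (\val e) by rewrite -hs; split; [apply: set_valP|apply/eqP].
by [].
Qed.

Lemma fin_rk n g X : fin n g -> subspace X -> rk (In n) (g @` X) = rk (In n) X.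
Proof.
move=> fg hX; have [lg bg _ _] := fg.
by apply: rk_image => //; [exact: bij_inj|move=> v; apply: fin_W].
Qed.

Lemma fin_sum n g X : fin n g -> subspace X -> sumset (g @` X) (W n) = sumset X (W n).
Proof.
move=> [lg bg h _] hX; have hW := W_subspace n; apply/seteqP; split.
  apply: sumset_min; [exact: subspace_sumset| |exact: sumset_subr].
  by move=> _ [v Xv <-]; exists v => //; exists (g v - v) => //; rewrite addrC subrK.
apply: sumset_min; [apply: subspace_sumset => //; exact: image_subspace| |].
  move=> v Xv; exists (g v); first by exists v.
  by exists (- (g v - v)); [apply: (subspaceN hW)|rewrite opprB addrC subrK].
by apply: sumset_subr; apply: image_subspace.
Qed.

Lemma fin_simn n g X : fin n g -> subspace X -> simn n (g @` X) X.
Proof. by move=> fg hX; split; [exact: fin_sum|exact: fin_rk]. Qed.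

Lemma simn_same_dim n X Y : subspace X -> subspace Y -> simn n X Y ->
  same_dim (X `&` W n) (Y `&` W n).
Proof. by move=> hX hY [_]; rewrite -(same_dim_rk bE (In_uniq n) hX hY). Qed.

(** * Rigidity of chains and uniqueness of labellings *)

Definition chain (F : set (set V)) :=
  (forall X, F X -> subspace X) /\ forall X Y, F X -> F Y -> X `<=` Y \/ Y `<=` X.

Lemma chain_eq F n X Y : chain F -> F X -> F Y -> simn n X Y -> X = Y.
Proof.
move=> [Fs Ft] FX FY h; have [XY|YX] := Ft _ _ FX FY.
  by apply: (simn_eq (n := n)) => //; apply: Fs.
by apply/esym; apply: (simn_eq (n := n)) => //; [apply: Fs|apply: Fs|apply: simn_sym].
Qed.

(** [g X] is a member commensurable with [X], and a chain holds only one such; thus [g] cannot shift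
    the members of [F]. *)
Lemma stab_chain F g X : chain F -> stab E F g -> F X -> g @` X = X.
Proof.
move=> cF [Gg gF] FX; have [n fg] := GE_fin Gg.
apply: (chain_eq (n := n) cF) => //; first by rewrite -gF; exists X.
by apply: fin_simn => //; apply: (proj1 cF).
Qed.

Lemma commensuration_simn F G phi : chain F -> chain G -> commensuration F G phi ->
  exists n0, forall n, (n0 <= n)%N -> forall X, F X -> simn n (phi X) X.
Proof.
move=> cF cG [[fphi _ _] _ [U [[s hs] hU]]].
have [sU [n0 Un]] := findim_W hs; exists n0 => n le X FX.
have [eqs eqd] := hU _ FX.
apply: (sim_simn (U := U)) => //; [|exact: (proj1 cF)|].
  by apply: (proj1 cG); apply: fphi.
by move=> v /Un; apply: W_le.
Qed.

(** If [psi Y = phi X], then [X] and [Y] are commensurable members of the chain [F], hence equal. *)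
Lemma commensuration_uniq F G phi psi X : chain F -> chain G ->
  commensuration F G phi -> commensuration F G psi -> F X -> phi X = psi X.
Proof.
move=> cF cG c1 c2 FX.
have [n1 h1] := commensuration_simn cF cG c1.
have [n2 h2] := commensuration_simn cF cG c2.
have [[f1 _ _] _ _] := c1; have [[_ _ s2] _ _] := c2.
have [Y FY eq] := s2 _ (f1 _ FX).
have s1 := h1 _ (leq_maxl n1 n2) _ FX; have := h2 _ (leq_maxr n1 n2) _ FY.
rewrite eq => s3; rewrite -eq; congr (psi _).
exact: (chain_eq cF FY FX (simn_trans (simn_sym s3) s1)).
Qed.

Lemma chain_flag_of (T : eqType) (le : rel T) (s : E -> T) : reflexive le ->
  transitive le -> total le -> antisymmetric le -> chain (flag_of le s).
Proof.
move=> le_refl le_trans le_total le_anti; split=> [X [a [b ->]]|X Y].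
  by rewrite /fpart lspan_CS; exact: CS_subspace.
move=> [a [b ->]] [a' [b' ->]]; rewrite /fpart !(lspan_CS bE).
pose p a b := fun x => (if b then le else strict le) x a.
have p_le a1 b1 x : p a1 b1 x -> le x a1 by case: b1 => //= /andP[].
have le_p a1 a2 b1 b2 : strict le a1 a2 -> p a1 b1 `<=` p a2 b2.
  move=> /andP[ne le12] x /p_le le1; have le2 := le_trans _ _ _ le1 le12.
  case: b2; rewrite /p //= /strict le2 andbT.
  by apply: contra_neq ne => xa; apply: le_anti; rewrite le12 -xa le1.
suff [h|h] : p a b `<=` p a' b' \/ p a' b' `<=` p a b.
- by left; apply: CS_mono => e; apply: h.
- by right; apply: CS_mono => e; apply: h.
have [->|ne] := eqVneq a a'.
  case: b; case: b'; [by left| right|left|by left];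
    by move=> x /andP[].
have [le1|le2] := orP (le_total a a'); [left|right]; apply: le_p; rewrite /strict.
  by rewrite ne.
by rewrite eq_sym ne.
Qed.

Lemma chain_F0 : chain (flag_of leB (@id E)).
Proof. exact: chain_flag_of. Qed.

(** * Coordinate flags, relative position and the group [B] *)

Definition dn s a b : set E := [set e | dnb s a b e].

Lemma FsigE s a b : Fsig s a b = CS bE (dn s a b).
Proof.
rewrite /Fsig /fpart lspan_CS; congr CS; apply/seteqP; split=> e; case: b => //=.
  by rewrite /strict /dn /= /dnb lt_neqAle.
by rewrite /strict /dn /= /dnb lt_neqAle.
Qed.

Lemma chain_Fl s : chain (Fl_sig s).
Proof. by apply: chain_flag_of; [exact: lexx|exact: le_trans|exact: le_total|exact: le_anti]. Qed.

Lemma lead_CS v f (P : set E) : lead v f -> CS bE P v -> P f.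
Proof. by move=> [f0 _] h; apply: contrapT => /h e0; rewrite e0 eqxx in f0. Qed.

Lemma lead_F0 v f e b : lead v f -> CS bE (below b e) v <-> below b e f.
Proof.
move=> lvf; split; first exact: lead_CS.
move=> bf k nk; apply/eqP; apply: contra_notT nk => /(proj2 lvf) kf.
case: b bf => [fe|/andP[ne fe]]; first exact: leB_trans fe.
apply/andP; split; last exact: leB_trans fe.
by apply: contra_neq ne => ke; apply: leB_anti; rewrite fe -ke.
Qed.

Definition leadp g := forall e, lead (g (\val e)) e.

Lemma leadpP g : linear g -> leadp g -> forall v e, lead v e -> lead (g v) e.
Proof. by move=> lg; apply: lead_image. Qed.

Lemma leadp_refl g : linear g -> leadp g -> forall v e, lead (g v) e -> lead v e.
Proof.
move=> lg hg v e lgv; have [v0|v0] := eqVneq v 0.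
  by have := lead_neq0 lgv; rewrite v0 lin0 // eqxx.
have [f lvf] := lead_ex v0.
by rewrite (lead_uniq lgv (leadpP lg hg lvf)).
Qed.

(** A vector lying in the first intersection but not in the second is one of the member with leading
    term [e]. *)
Lemma relD (M : A -> bool -> set V) a e :
  (M a true `&` F0 leB e true <> M a true `&` F0 leB e false) <->
  exists2 v, M a true v & lead v e.
Proof.
have mono : F0 leB e false `<=` F0 leB e true.
  by rewrite !F0E; apply: CS_mono => f /andP[].
split=> [ne|[v Mv /(leadP _ _) [ht hf]] eq].
  apply: contrapT => nex; apply: ne; apply/seteqP; split=> v [Mv hv]; split=> //; last exact: mono.
  by apply: contrapT => hf; apply: nex; exists v => //; apply/(leadP _ _).
have : (M a true `&` F0 leB e true) v by [].
by rewrite eq => -[].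
Qed.

Lemma relpos_orbit g s : linear g -> leadp g ->
  relative_position leB (fun a b => g @` Fsig s a b) s.
Proof.
move=> lg hg e /=; split.
  apply/(relD (fun a b => g @` Fsig s a b)); exists (g (\val e)); last exact: hg.
  by exists (\val e) => //; rewrite FsigE; apply: CS_val; rewrite /dn /= lexx.
move=> a /(relD (fun a b => g @` Fsig s a b)) [_ [v + <-]]; rewrite FsigE => hv /(leadp_refl lg hg) lv.
exact: (lead_CS lv hv).
Qed.

Lemma relpos_uniq M s s' : relative_position leB M s -> relative_position leB M s' ->
  s = s'.
Proof.
move=> h h'; apply/funext => e; have [hs ms] := h e; have [hs' ms'] := h' e.
by apply: le_anti; rewrite ms //= ms'.
Qed.

(* If [u] in [N a true] had a component outside [dn s a true], its part there
   would have a leading term [e] with [a < s e], against the minimality of [s e]. *)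
Lemma relpos_image (N : A -> bool -> set V) g s : (forall a, subspace (N a true)) ->
  (forall a a', (a <= a')%O -> N a true `<=` N a' true) ->
  relative_position leB N s -> linear g -> bijective g -> leadp g ->
  (forall e, N (s e) true (g (\val e))) ->
  forall a, N a true = g @` Fsig s a true.
Proof.
move=> hN mono rp lg [h gh hg] lpg gN a; rewrite FsigE; apply/seteqP; split; last first.
  move=> _ [v + <-].
  apply: (CS_min (preimage_subspace lg (hN a))) => e sea /=.
  exact: (mono _ _ sea).
move=> u Nu; exists (h u); last exact: hg.
have [v [Pv nPv]] := CS_split bE (dn s a true) (h u).
have [eq|ne] := eqVneq (h u) v; first by rewrite eq.
have : h u - v != 0 by rewrite subr_eq0.
move=> /lead_ex[e lw].
case: (lead_CS lw nPv); apply: (proj2 (rp e)); apply/relD.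
exists (g (h u - v)); last exact: leadpP.
rewrite linB // hg; apply: (subspaceB (hN a)) => //.
apply: (CS_min (preimage_subspace lg (hN a))) Pv => f sfa /=.
exact: (mono _ _ sfa).
Qed.

Let B := stab E (flag_of leB (@id E)).

(** By rigidity of chains [g] fixes each F'_{0,e} and F''_{0,e}, and membership in these determines
    the leading term. *)
Lemma B_leadp g : B g -> leadp g.
Proof.
move=> Bg e; have cF := chain_F0.
have F0F b : flag_of leB (@id E) (F0 leB e b) by exists e, b.
have [[lg bg _] _] := Bg.
have eqT b := stab_chain cF Bg (F0F b).
apply/(leadP _ _); have /(leadP _ _) [ht hf] := lead_val e.
split; first by rewrite -eqT; exists (\val e).
by rewrite -eqT => -[v hv /(bij_inj bg) eq]; apply: hf; rewrite -eq.
Qed.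

Lemma leadp_B n g : fin n g -> leadp g -> B g.
Proof.
move=> fg lpg; have [lg bg _ _] := fg; have [h gh hg] := bg.
split; first exact: (fin_GE fg).
have eqF e b : g @` fpart leB (@id E) e b = fpart leB (@id E) e b.
  rewrite /fpart (lspan_CS bE) -/(below b e); apply/seteqP; split.
    move=> _ [v hv <-]; have [->|v0] := eqVneq v 0.
      by rewrite lin0 //; apply: subspace0; apply: CS_subspace.
    have [f lf] := lead_ex v0.
    apply/(lead_F0 _ _ (leadpP lg lpg lf)).
    exact/(lead_F0 _ _ lf).
  move=> u hu; exists (h u); last exact: hg.
  have [->|v0] := eqVneq (h u) 0; first by apply: subspace0; apply: CS_subspace.
  have [f lf] := lead_ex v0.
  apply/(lead_F0 _ _ lf).
  apply/(lead_F0 _ _ (leadpP lg lpg lf)).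
  by rewrite hg.
apply/seteqP; split=> [_ [_ [e [b ->]] <-]|_ [e [b ->]]].
  by exists e, b; rewrite eqF.
by exists (fpart leB (@id E) e b); [exists e, b|rewrite eqF].
Qed.

(** * Flags in the span of [E_n] and their embedding *)

(** [s] is a rearrangement of [sigma0] inside [E_n]. This is expressed by counts because they are
    the ranks of the members of the flag. *)
Definition okn n s := (forall e, e \notin In n -> s e = sigma0 e) /\
  forall a b, count (dnb s a b) (In n) = count (dnb sigma0 a b) (In n).

Lemma rk_dn n s a b : rk (In n) (CS bE (dn s a b)) = count (dnb s a b) (In n).
Proof. by rewrite rk_CS //; apply: eq_count => e; rewrite asboolb. Qed.

(* The part of the embedded flag which does not depend on the point. *)
Definition rest n a b : set E := [set e | e \notin In n /\ dnb sigma0 a b e].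

Lemma embed_restE n a b :
  lspan [set \val e | e in [set e : E | ~ En n (\val e) /\
        (if b then (sigma0 e <= a)%O else (sigma0 e < a)%O)]] = CS bE (rest n a b).
Proof.
rewrite lspan_CS; congr CS; apply/seteqP; split=> e [h1 h2]; split=> //.
  by apply/negP => /mem_In.
by move/mem_In; apply/negP.
Qed.

Lemma embedE n M : embed sigma0 (En n) M =
  [set X | exists a b, X = sumset (M a b) (CS bE (rest n a b))].
Proof.
by apply/seteqP; split=> X [a [b ->]]; exists a, b; rewrite embed_restE.
Qed.

Lemma act_FlE g s : act g (Fl_sig s) = [set X | exists a b, X = g @` Fsig s a b].
Proof.
apply/seteqP; split=> [_ [_ [a [b ->]] <-]|_ [a [b ->]]]; first by exists a, b.
by exists (Fsig s a b) => //; exists a, b.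
Qed.

(** [g] moves no basis vector outside [E_n], so a member is recovered from its trace on [W n] by
    adding the fixed part. *)
Lemma fin_flag_sum n g s a b : fin n g -> okn n s ->
  sumset (g @` Fsig s a b `&` W n) (CS bE (rest n a b)) = g @` Fsig s a b.
Proof.
move=> fg [off _]; have [lg _ _ goff] := fg; rewrite FsigE.
have hg : subspace (g @` CS bE (dn s a b)) by apply: image_subspace => //; apply: CS_subspace.
have hW := W_subspace n.
apply/seteqP; split.
  apply: sumset_min => //.
  apply: CS_min => // e [en de]; exists (\val e); last exact: goff.
  by apply: CS_val; rewrite /dn /= /dnb off.
move=> _ [v + <-]; have hs := subspace_sumset (subspaceI hg hW) (CS_subspace bE (rest n a b)).
apply: (CS_min (preimage_subspace lg hs)) => e de /=.
have [en|en] := boolP (e \in In n); last first.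
  rewrite goff //; apply: sumset_subr; first exact: subspaceI.
  by apply: CS_val; split=> //; move: de; rewrite /dn /= /dnb off.
apply: sumset_subl; first exact: CS_subspace.
split; first by exists (\val e) => //; apply: CS_val.
by apply: (proj1 (fin_W (\val e) fg)); exact: (W_val en).
Qed.

Lemma fin_flag_intro n g s : fin n g -> okn n s ->
  fin_flag sigma0 (En n) (fun a b => g @` Fsig s a b `&` W n) /\
  embed sigma0 (En n) (fun a b => g @` Fsig s a b `&` W n) = act g (Fl_sig s).
Proof.
move=> fg ok; have [off cnt] := ok; have [lg _ _ goff] := fg.
have hW := W_subspace n.
have hg a b : subspace (g @` Fsig s a b).
  by rewrite FsigE; apply: image_subspace => //; apply: CS_subspace.
split; last first.
  rewrite embedE act_FlE; apply/seteqP.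
  by split=> X [a [b ->]]; exists a, b; rewrite fin_flag_sum.
rewrite /fin_flag lspan_En; split=> [a b|a v [[u + <-] Wv]|a a' aa' v [[u + <-] Wv]].
- split; [exact: subspaceI|by move=> v []|].
  apply/same_dim_rk => //; first by rewrite FsigE; apply: CS_subspace.
  rewrite fin_rk //; last by rewrite FsigE; apply: CS_subspace.
  by rewrite !FsigE !rk_dn.
- rewrite !FsigE => hu; split=> //; exists u => //.
  by apply: CS_mono hu => e /ltW.
rewrite !FsigE => hu; split=> //; exists u => //.
by apply: CS_mono hu => e /le_lt_trans; apply.
Qed.

(** * The cell containing a given finite flag *)

Section FromFinFlag.
Variables (n : nat) (M : A -> bool -> set V) (hM : fin_flag sigma0 (En n) M).

Let N a b := sumset (M a b) (CS bE (rest n a b)).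

Let Msub a b : subspace (M a b). Proof. by case: hM => /(_ a b)[]. Qed.
Let MW a b : M a b `<=` W n.
Proof. by case: hM => /(_ a b)[_ + _] _ _; rewrite lspan_En. Qed.
Let rsub a b : subspace (CS bE (rest n a b)) := CS_subspace _ _.
Let Nsub a b : subspace (N a b) := subspace_sumset (@Msub a b) (@rsub a b).

Let Mrk a b : rk (In n) (M a b) = count (dnb sigma0 a b) (In n).
Proof.
case: hM => /(_ a b)[_ _ +] _ _; rewrite lspan_En.
rewrite FsigE => h.
have : same_dim (M a b `&` CS bE (inI (In n)))
    (CS bE (dn sigma0 a b) `&` CS bE (inI (In n))).
  rewrite (_ : M a b `&` _ = M a b) //.
  by apply/seteqP; split=> [v []//|v Mv]; split=> //; apply: (MW Mv).
move=> /(proj1 (same_dim_rk bE (In_uniq n) (@Msub a b) (CS_subspace _ _))) ->.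
exact: rk_dn.
Qed.

Let Mft a : M a false `<=` M a true. Proof. by case: hM. Qed.
Let Mtf a a' : (a < a')%O -> M a true `<=` M a' false. Proof. by case: hM => _ _; apply. Qed.

Let Mmono a a' : (a <= a')%O -> M a true `<=` M a' true.
Proof.
by rewrite le_eqVlt => /orP[/eqP -> //|/Mtf h] v /h; apply: Mft.
Qed.

Let Nmono a a' : (a <= a')%O -> N a true `<=` N a' true.
Proof.
move=> le; apply: sumset_min => //.
  by move=> v /(Mmono le); apply: sumset_subl.
move=> v hv; apply: sumset_subr => //; apply: CS_mono hv => e [en /= ea].
by split=> //=; apply: le_trans le.
Qed.

Let Ntf a a' : (a < a')%O -> N a true `<=` N a' false.
Proof.
move=> lt; apply: sumset_min => //.
  by move=> v /(Mtf lt); apply: sumset_subl.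
move=> v hv; apply: sumset_subr => //; apply: CS_mono hv => e [en /= ea].
by split=> //=; apply: le_lt_trans lt.
Qed.

Let NM a b : N a b `&` W n `<=` M a b.
Proof.
move=> _ [[m Mm [r hr <-]] Wmr]; suff -> : r = 0 by rewrite addr0.
apply: (crd_eq0 (bE := bE)) => e; have [en|en] := boolP (e \in In n).
  by apply: hr => -[]; rewrite -/In en.
have := Wmr e; rewrite crdD (MW Mm) ?add0r; [by apply; apply/negP|by apply/negP].
Qed.

Let Nlead_in a v e : e \in In n -> N a true v -> lead v e -> exists2 m, M a true m & lead m e.
Proof.
move=> en [m Mm [r hr <-]] [e0 he]; exists m => //.
have r0 f : f \in In n -> crd bE f r = 0.
  by move=> fn; apply: hr => -[]; rewrite -/In fn.
split=> [|f f0]; first by move: e0; rewrite crdD r0 // addr0.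
apply: he; rewrite crdD r0 ?addr0 //.
by apply: contraNT f0 => nf; apply/eqP; apply: (MW Mm); apply/negP.
Qed.

(* [M a true] only depends on the set of [f] in [E_n] with [sigma0 f <= a]. *)
Let Mjump a v e : M a true v -> lead v e -> exists f,
  [/\ f \in In n, (sigma0 f <= a)%O & M (sigma0 f) true v].
Proof.
move=> Mv lv; pose r := [seq f <- In n | dnb sigma0 a true f].
have rk_sub a' : (a' <= a)%O -> (forall f, f \in In n -> (sigma0 f <= a)%O ->
    (sigma0 f <= a')%O) -> M a true `<=` M a' true.
  move=> le h u Mu; have sub : M a' true `&` CS bE (inI (In n)) `<=` M a true.
    by move=> w [/(Mmono le)].
  apply: (rk_eq_sub (In_uniq n) _ _ sub) => //; last by split=> //; apply: MW Mu.
  rewrite !Mrk -!size_filter; apply: uniq_leq_size; first exact: filter_uniq.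
  by move=> f; rewrite !mem_filter => /andP[/= fa fn]; rewrite fn andbT h.
have [r0|] := eqVneq r [::].
  have : rk (In n) (M a true) = 0%N by rewrite Mrk -size_filter -/r r0.
  move=> rk0; have : M a true `&` CS bE (inI (In n)) `<=` CS bE set0.
    apply: (rk_eq_sub (In_uniq n)) => //; first exact: CS_subspace.
      move=> u [u0 _]; rewrite (crd_eq0 (bE := bE) (u := u)); first exact: subspace0.
      by move=> f; apply: u0.
    by rewrite rk0.
  move=> sub; have v0 : CS bE set0 v by apply: sub; split=> //; apply: MW Mv.
  by case: (lead_CS lv v0).
move=> /(argmax_seq sigma0)[f]; rewrite mem_filter => /andP[/= fa fn] fmax.
exists f; split=> //; apply: (rk_sub _ fa) Mv => k kn ka.
by apply: fmax; rewrite mem_filter kn andbT.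
Qed.

(** The smallest member having a vector with leading term [e]. For [e] in [E_n] the minimum is over
    the finitely many values of [sigma0] on [E_n]: the member at the largest value is all of [W n],
    so candidates exist, and [Mjump] extends minimality to all of [A]. *)
Let pick_lead e : exists p : A * V, [/\ lead p.2 e,
  forall a, (exists2 v, N a true v & lead v e) -> (p.1 <= a)%O,
  e \in In n -> M p.1 true p.2 & e \notin In n -> p.1 = sigma0 e /\ p.2 = \val e].
Proof.
have [en|en] := boolP (e \in In n); last first.
  exists (sigma0 e, \val e); split=> // [|a [v [m Mm [r hr <-]] lv]]; first exact: lead_val.
  apply: contrapT => nea; case: lv => /eqP + _; apply.
  rewrite crdD (MW Mm) ?add0r; last by apply/negP.
  by apply: hr => -[_].
pose good f := `[<exists2 v, M (sigma0 f) true v & lead v e>].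
have ne : [seq f <- In n | good f] != [::].
  have [|f fn fmax] := argmax_seq sigma0 (r := In n).
    by apply: contraTneq en => ->.
  suff gf : good f by rewrite -has_filter; apply/hasP; exists f.
  apply/asboolP; exists (\val e); last exact: lead_val.
  have sub : M (sigma0 f) true `&` CS bE (inI (In n)) `<=` W n by move=> v [].
  apply: (rk_eq_sub (In_uniq n) _ _ sub) => //.
    have eqW : W n = CS bE (inI (In n)) by [].
    rewrite Mrk eqW rk_CS //; apply: eq_leq; apply: eq_in_count => k kn.
    by rewrite /= fmax //; apply/asboolP.
  by split; exact: (W_val en).
have [|||f fn fmin] := max_seq (le := fun f e => (sigma0 e <= sigma0 f)%O) _ _ _ ne.
- by move=> f; apply: lexx.
- by move=> x y z h1 h2; apply: le_trans h1.
- by move=> x y; apply: le_total.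
move: fn; rewrite mem_filter => /andP[/asboolP[v Mv lv] fn].
exists (sigma0 f, v); split=> //= a [u Nu lu].
have [m Mm lm] := Nlead_in en Nu lu; have [k [kn ka Mk]] := Mjump Mm lm.
apply: le_trans ka; apply: fmin; rewrite mem_filter kn andbT.
by apply/asboolP; exists m.
Qed.

(** [g] sends each [e] to the vector picked for it, which has leading term [e], so [g] lies in [B].
    Minimality makes [s] the relative position, whence the members F'' are images of coordinate
    spaces; ranks then settle the members F'. *)
Lemma fin_flag_cell : exists g s, [/\ fin n g, B g, leadp g, okn n s &
  embed sigma0 (En n) M = act g (Fl_sig s) /\
  forall a b, M a b = g @` Fsig s a b `&` W n].
Proof.
have [p hp] := choice pick_lead.
pose s e := (p e).1; pose vv e := (p e).2; pose g := extend bE (In n) vv.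
have lg : linear g := extend_linear _ _ _.
have gE e : g (\val e) = vv e.
  rewrite /g extendE //; case: ifPn => // en.
  by rewrite /vv; have [_ _ _ /(_ en)[_ ->]] := hp e.
have lpg : leadp g by move=> e; rewrite gE; have [] := hp e.
have ig : injective g := lead_inj lg lpg.
have fg : fin n g.
  apply: (fin_intro lg ig) => e en; rewrite gE.
    by apply: MW; have [_ _ /(_ en) h _] := hp e; apply: h.
  by rewrite /vv; have [_ _ _ /(_ en)[_ ->]] := hp e.
have gN e : N (s e) true (g (\val e)).
  rewrite gE; have [en|en] := boolP (e \in In n).
    by apply: sumset_subl => //; have [_ _ /(_ en) h _] := hp e.
  have [_ _ _ /(_ en)[eqs eqv]] := hp e; apply: sumset_subr => //.
  rewrite /vv eqv; apply: CS_val; split=> //=; by rewrite /s eqs.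
have rp : relative_position leB N s.
  move=> e; split.
    by apply/relD; exists (vv e); [rewrite -gE; apply: gN|have [] := hp e].
  by move=> a /relD h; have [_ + _ _] := hp e; apply.
have [_ bg _ goff] := fg.
have NT a : N a true = g @` Fsig s a true.
  exact: (relpos_image (fun a => @Nsub a true) Nmono rp lg bg lpg gN).
have off e : e \notin In n -> s e = sigma0 e.
  by move=> en; have [_ _ _ /(_ en)[]] := hp e.
have rkN a b : rk (In n) (N a b) = count (dnb sigma0 a b) (In n).
  rewrite -Mrk; apply: (eq_rk (In_uniq n) (@Nsub a b) (@Msub a b) (@NM a b)).
  by move=> v [Mv _]; apply: sumset_subl.
have rkg a b : rk (In n) (g @` Fsig s a b) = count (dnb s a b) (In n).
  rewrite FsigE (fin_rk fg); last exact: CS_subspace.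
  by rewrite rk_dn.
have cntT a : count (dnb s a true) (In n) = count (dnb sigma0 a true) (In n).
  by rewrite -rkg -NT rkN.
have gsub a b : subspace (g @` Fsig s a b).
  by rewrite FsigE; apply: image_subspace => //; apply: CS_subspace.
have subF a : g @` Fsig s a false `<=` N a false.
  rewrite FsigE => _ [v + <-].
  by apply: (CS_min (preimage_subspace lg (@Nsub a false))) => e /Ntf; apply.
(* One inequality comes from [subF]. For the other, [{sigma0 < a}] has the same trace on [E_n] as
   [{sigma0 <= c}], with [c] the largest value of [sigma0] on [E_n] below [a]. *)
have cntF a : count (dnb s a false) (In n) = count (dnb sigma0 a false) (In n).
  apply/eqP; rewrite eqn_leq -{1}rkg -{1}rkN rk_le //=; last by move=> v [/subF].
  pose r := [seq f <- In n | dnb sigma0 a false f].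
  have [r0|] := eqVneq r [::]; first by rewrite -size_filter -/r r0.
  move=> /(argmax_seq sigma0)[f]; rewrite mem_filter => /andP[/= fa fn] fmax.
  have -> : count (dnb sigma0 a false) (In n) = count (dnb sigma0 (sigma0 f) true) (In n).
    apply: eq_in_count => k kn /=; apply/idP/idP => [ka|kf]; last exact: le_lt_trans fa.
    by apply: fmax; rewrite mem_filter kn andbT.
  by rewrite -cntT; apply: sub_count => k /= /le_lt_trans; apply.
have NF a : N a false = g @` Fsig s a false.
  apply/seteqP; split; last exact: subF.
  apply: sumset_min => // [v Mv|].
    apply: (rk_eq_sub (In_uniq n) (gsub a false) (@Nsub a false)).
    - by move=> u [/subF].
    - by rewrite rkN rkg cntF.
    by split; [apply: sumset_subl|apply: MW Mv].
  apply: CS_min => // e [en /= ea]; exists (\val e); last exact: goff.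
  by rewrite FsigE; apply: CS_val; rewrite /dn /= off.
exists g, s; split=> //.
- exact: (leadp_B fg).
- by split=> // a [].
have NE a b : N a b = g @` Fsig s a b by case: b; rewrite ?NT ?NF.
split.
  by rewrite embedE act_FlE; apply/seteqP; split=> X [a [b ->]];
    exists a, b; rewrite -?NE.
move=> a b; rewrite -NE; apply/seteqP; split; last exact: NM.
by move=> v Mv; split; [apply: sumset_subl|apply: MW Mv].
Qed.

End FromFinFlag.

(** * The Weyl orbit and the points of Fl(F, E) *)

Let F := Fl_sig sigma0.

Lemma okn_weyl n s : okn n s ->
  exists2 w : weyl E, s = sigma0 \o winv w & forall e, e \notin In n -> winv w e = e.
Proof.
move=> [off cnt]; have [f [f1 f2 f3 f4]] := perm_rearrange (In_uniq n) (count_perm cnt).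
have [w wf] := weyl_of_inj (In_uniq n) f1 f2 f4.
exists w => [|e en]; last by rewrite wf f4.
apply/funext => e /=; rewrite wf; have [en|en] := boolP (e \in In n); first exact: f3.
by rewrite f4 // off.
Qed.

Lemma weyl_off (w : weyl E) n : (forall e, e \notin In n -> winv w e = e) ->
  forall e, e \notin In n -> w e = e.
Proof. by move=> off e en; rewrite -{1}(off e en) winvK. Qed.

Lemma weyl_stable (w : weyl E) n : (forall e, e \notin In n -> winv w e = e) ->
  forall e, e \in In n -> winv w e \in In n.
Proof.
move=> off e en; apply/negPn/negP => wn; have := off _ wn.
by move=> /(can_inj (@winvK _ w)) eq; rewrite eq en in wn.
Qed.

Lemma okn_of_weyl n (w : weyl E) : (forall e, e \notin In n -> winv w e = e) ->
  okn n (sigma0 \o winv w).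
Proof.
move=> off; split=> [e en /=|a b]; first by rewrite off.
rewrite -(count_map (winv w) (dnb sigma0 a b)); apply/permP.
apply: uniq_perm => //; first by rewrite map_inj_uniq //; apply: can_inj (@winvK _ w).
have u : uniq (map (winv w) (In n)) by rewrite map_inj_uniq //; apply: can_inj (@winvK _ w).
have sub : {subset map (winv w) (In n) <= In n}.
  by move=> _ /mapP[e en ->]; apply: weyl_stable.
by have [|_ eq] := uniq_min_size u sub; [rewrite size_map|exact: eq].
Qed.

Lemma WorbitP s : Worbit sigma0 s <-> exists n, okn n s.
Proof.
split=> [[w ->]|[n /okn_weyl[w -> _]]]; last by exists w.
have [t ht] := (finite_seqP _).1 (w_finite w).
have [n hn] := In_cover t; exists n; apply: okn_of_weyl => e en.
apply: (can_inj (@wfunK _ w)); rewrite winvK; apply/esym; apply: contrapT => ne.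
by case/negP: en; apply: hn; have : [set` t] e by rewrite -ht.
Qed.

Lemma okn_le n m s : (n <= m)%N -> okn n s -> okn m s.
Proof.
move=> nm /okn_weyl[w -> off]; apply: okn_of_weyl => e em; apply: off.
by apply: contra em; apply: In_le.
Qed.

Lemma okn_lin n s : okn n s ->
  exists2 h, fin n h & forall a b, h @` Fsig sigma0 a b = Fsig s a b.
Proof.
move=> /okn_weyl[w -> off]; have woff := weyl_off off.
pose h := extend bE (In n) (\val \o w); pose h' := extend bE (In n) (\val \o winv w).
have lh : linear h := extend_linear _ _ _.
have lh' : linear h' := extend_linear _ _ _.
have hE e : h (\val e) = \val (w e).
  by rewrite /h extendE //; case: ifPn => // /woff ->.
have hE' e : h' (\val e) = \val (winv w e).
  by rewrite /h' extendE //; case: ifPn => // /off ->.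
have hK : cancel h h'.
  apply: (lin_ext bE (lin_comp lh' lh) (h := id)) => // e /=.
  by rewrite hE hE' wfunK.
have hK' : cancel h' h.
  apply: (lin_ext bE (lin_comp lh lh') (h := id)) => // e /=.
  by rewrite hE' hE winvK.
have stab e : e \in In n -> w e \in In n.
  move=> en; apply/negPn/negP => wn; have := off _ wn.
  by rewrite wfunK => eq; rewrite -eq en in wn.
exists h.
  apply: (fin_intro lh (can_inj hK)) => e en; rewrite hE; last by rewrite woff.
  exact: (W_val (stab _ en)).
move=> a b; rewrite !FsigE; apply/seteqP; split.
  move=> _ [v + <-]; apply: (CS_min (preimage_subspace lh (CS_subspace _ _))) => e de /=.
  by rewrite hE; apply: CS_val; rewrite /dn /= /dnb /= wfunK.
apply: CS_min => [|e de]; first by apply: image_subspace => //; apply: CS_subspace.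
by exists (\val (winv w e)); [apply: CS_val|rewrite hE winvK].
Qed.

Lemma act_comp g h (G : set (set V)) : act (g \o h) G = act g (act h G).
Proof.
apply/seteqP; split=> [_ [X GX <-]|_ [_ [X GX <-] <-]].
  by exists (h @` X); [exists X|rewrite -image_comp].
by exists X => //; rewrite -image_comp.
Qed.

Lemma act_id (G : set (set V)) : act id G = G.
Proof.
apply/seteqP; split=> [_ [X GX <-]|X GX]; first by rewrite image_id.
by exists X => //; rewrite image_id.
Qed.

Lemma okn_act n s : okn n s -> exists2 h, fin n h & Fl_sig s = act h F /\
  forall a b, h @` Fsig sigma0 a b = Fsig s a b.
Proof.
move=> /okn_lin[h fh hE]; exists h => //; split=> //; rewrite act_FlE.
by apply/seteqP; split=> X [a [b ->]]; exists a, b; rewrite hE.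
Qed.

Lemma chain_act g (G : set (set V)) : linear g -> chain G -> chain (act g G).
Proof.
move=> lg [Gs Gt]; split=> [_ [X GX <-]|_ _ [X GX <-] [Y GY <-]].
  by apply: image_subspace => //; apply: Gs.
by case: (Gt _ _ GX GY) => h; [left|right]; apply: image_subset.
Qed.

Lemma injective_image_sub g (X Y : set V) : injective g ->
  (g @` X `<=` g @` Y) <-> X `<=` Y.
Proof.
move=> ig; split=> [h v Xv|]; last exact: image_subset.
by have [u Yu /ig <-] := h _ (imageP g Xv).
Qed.

Lemma commensuration_act n h : fin n h ->
  commensuration F (act h F) (fun X => h @` X).
Proof.
move=> fh; have [lh bh _ _] := fh; have ih := bij_inj bh.
have [Fs _] := chain_Fl sigma0.
split.
- split; first by move=> X FX; exists X.
    move=> X Y _ _ eq; apply/seteqP; split; apply/(injective_image_sub _ _ ih);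
    by rewrite eq.
  by move=> _ [X FX <-]; exists X.
- by move=> X Y _ _; apply: injective_image_sub.
exists (W n); split; first exact: W_basis.
move=> X FX; have hX := Fs _ FX; have := fin_simn fh hX => sn; split; first by case: sn.
by apply: simn_same_dim => //; apply: image_subspace.
Qed.

Lemma labelling_act n g s : fin n g -> okn n s ->
  labelling sigma0 (act g (Fl_sig s)) (fun a b => g @` Fsig s a b).
Proof.
move=> fg /okn_act[h fh [-> hE]]; exists (fun X => (g \o h) @` X); split.
  by rewrite -act_comp; apply: commensuration_act (fin_comp fg fh).
by move=> a b; rewrite -hE image_comp.
Qed.

Lemma labelling_uniq G M M' : chain G -> labelling sigma0 G M -> labelling sigma0 G M' ->
  forall a b, M a b = M' a b.
Proof.
move=> cG [phi [c eq]] [phi' [c' eq']] a b; rewrite eq eq'.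
apply: (commensuration_uniq (chain_Fl sigma0) cG c c').
by exists a, b.
Qed.

(** Surjectivity supplies a basis vector of value [a]: a member containing it contains F''_a, any
    other lies in F'_a. *)
Lemma consecutive_Fl a : consecutive F (Fsig sigma0 a false) (Fsig sigma0 a true).
Proof.
have [e0 e0a] := sigma0_surj a; rewrite !FsigE.
have sub : CS bE (dn sigma0 a false) `<=` CS bE (dn sigma0 a true).
  by apply: CS_mono => e /ltW.
split.
- by exists a, false; rewrite -(FsigE).
- by exists a, true; rewrite -(FsigE).
- split=> // h; have /h /(CS_val_iff bE) : CS bE (dn sigma0 a true) (\val e0).
    by apply: CS_val; rewrite /dn /= e0a lexx.
  by rewrite /dn /= e0a ltxx.
move=> _ [c [b ->]]; rewrite -/(Fsig sigma0 c b) FsigE => h1 h2.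
have [de|nde] := pselect (dn sigma0 c b e0); [right|left]; apply/seteqP; split=> //.
  move: de; rewrite /dn /= /dnb e0a; case: b {h1 h2} => ca; apply: CS_mono => e.
    by move=> /le_trans; apply.
  by move=> /le_lt_trans; apply.
move: nde; rewrite /dn /= /dnb e0a; case: b {h1 h2} => /negP; rewrite -?ltNge -?leNgt => ca;
  apply: CS_mono => e.
  by move=> /le_lt_trans; apply.
by move=> /lt_le_trans; apply.
Qed.

Lemma gen_flag_Fl : gen_flag F.
Proof.
have [Fs Ft] := chain_Fl sigma0; split=> //.
  move=> _ [a [[|] ->]].
    by exists (Fsig sigma0 a false); left; apply: consecutive_Fl.
  by exists (Fsig sigma0 a true); right; apply: consecutive_Fl.
move=> v v0; have [t [ut ht eq]] := crd_supp bE v.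
have [|e et emax] := argmax_seq sigma0 (r := t).
  by apply: contra_neq v0 => t0; rewrite eq t0 big_nil.
exists (Fsig sigma0 (sigma0 e) false), (Fsig sigma0 (sigma0 e) true).
split; first exact: consecutive_Fl.
  rewrite FsigE => f nf; apply/eqP; rewrite -[_ == _]negbK -ht.
  by apply/negP => ft; apply: nf; apply: emax.
rewrite FsigE => /(_ e); rewrite /dn /= ltxx => h.
by move: et; rewrite ht h ?eqxx.
Qed.

Lemma gen_flag_act g G : linear g -> bijective g -> gen_flag G -> gen_flag (act g G).
Proof.
move=> lg bg [G1 G2 G3 G4]; have [h gh hg] := bg; have ig := bij_inj bg.
have cons X Y : consecutive G X Y -> consecutive (act g G) (g @` X) (g @` Y).
  move=> [GX GY [XY nYX] hZ]; split; [by exists X|by exists Y| |].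
    by split; [apply: image_subset|move/(injective_image_sub _ _ ig)].
  move=> _ [Z GZ <-] /(injective_image_sub _ _ ig) h1 /(injective_image_sub _ _ ig) h2.
  by case: (hZ Z GZ h1 h2) => ->; [left|right].
have [c1 c2] := chain_act lg (conj G1 G2).
split=> //.
  move=> _ [X GX <-]; have [Y [c|c]] := G3 X GX; exists (g @` Y); [left|right]; exact: cons.
move=> v v0; have [|X [Y [c Yv nXv]]] := G4 (h v).
  by apply: contra_neq v0 => hv0; rewrite -(hg v) hv0 lin0.
exists (g @` X), (g @` Y); split; [exact: cons|by exists (h v)|].
by move=> [u Xu eq]; apply: nXv; rewrite -eq gh.
Qed.

Lemma image_lspan g (S : set V) : linear g -> g @` lspan S = lspan (g @` S).
Proof.
move=> lg; apply/seteqP; split; last first.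
  apply: lspan_min; first by apply: image_subspace => //; apply: lspan_subspace.
  by move=> _ [v Sv <-]; exists v => //; apply: sub_lspan.
move=> _ [v + <-]; apply: (lspan_min (preimage_subspace lg (lspan_subspace _))).
by move=> u Su; apply: sub_lspan; exists u.
Qed.

Lemma weakly_compatible_act n g : fin n g -> weakly_compatible E A (act g F).
Proof.
move=> fg; have [lg bg _ goff] := fg; have [h gh hg] := bg; have ig := bij_inj bg.
have [_ _ fin_supp] := fin_GE fg.
have [spE indE] := bE.
exists (g @` E); split.
- split.
    rewrite -image_lspan // spE; apply/seteqP; split=> // v _.
    by exists (h v).
  move=> _ [v Ev <-] hv; apply: (indE v Ev).
  have : (g @` lspan (E `\ v)) (g v).
    rewrite image_lspan //; apply: lspan_min hv; first exact: lspan_subspace.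
    move=> _ [[u Eu <-] ne]; apply: sub_lspan; exists u => //; split=> //.
    by move=> /= uv; apply: ne; rewrite uv.
  by move=> [u hu /ig uv]; rewrite uv in hu.
- apply: sub_finite_set fin_supp => v [Ev nv]; split=> // gv; apply: nv.
  by split=> //; exists v.
have pre (l : g @` E) : exists e : E, g (\val e) = \val l.
  have [v Ev eq] := set_valP l; exists (SigSub (mem_set Ev)); exact: eq.
have [p hp] := choice pre.
have pg (e : E) : exists l : g @` E, p l = e.
  have ge : (g @` E) (g (\val e)) by exists (\val e) => //; apply: set_valP.
  exists (SigSub (mem_set ge)); apply: val_inj; apply: ig; exact: hp.
exists (sigma0 \o p); split=> [a|].
  by have [e <-] := sigma0_surj a; have [l <-] := pg e; exists l.
rewrite act_FlE.
have eqf a b : fpart (<=%O : rel A) (sigma0 \o p) a b = g @` Fsig sigma0 a b.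
  rewrite /Fsig /fpart image_lspan //; congr lspan; apply/seteqP; split.
    move=> _ [l hl <-]; exists (\val (p l)); last exact: hp.
    by exists (p l).
  move=> _ [_ [e he <-] <-]; have [l pl] := pg e; exists l; last by rewrite -hp pl.
  by move: he; rewrite -pl.
by apply/seteqP; split=> X [a [b ->]]; exists a, b; rewrite eqf.
Qed.

Lemma FlE_act n g s : fin n g -> okn n s -> FlE sigma0 (act g (Fl_sig s)).
Proof.
move=> fg /okn_act[h fh [-> _]]; rewrite -act_comp; have fgh := fin_comp fg fh.
have [l b _ _] := fgh; split.
- exact: gen_flag_act gen_flag_Fl.
- by rewrite -/F -[F]act_id; apply: weakly_compatible_act (fin_id 0%N).
- exact: weakly_compatible_act fgh.
by exists (fun X => (g \o h) @` X); apply: commensuration_act fgh.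
Qed.

(* A basis [L] containing all but finitely many elements of [E] differs from
   [E] by finitely many elements, so that for [n] large [<E_n>] is also spanned
   by elements of [L]. *)
Lemma cofinite_basis L (bL : is_basis L) : finite_set (E `\` (E `&` L)) ->
  exists n0, forall n, (n0 <= n)%N ->
    (forall e, e \notin In n -> L (\val e)) /\
    forall l, L l -> W n l \/ exists2 e : E, e \notin In n & \val e = l.
Proof.
move=> /finite_seqP[t ht].
have tE v : v \in t -> E v by move=> vt; have : [set` t] v by []; rewrite -ht => -[].
have [n1 h1] := W_cover t.
have : forall v, exists r : seq L, forall l, l \notin r -> crd bL l v = 0.
  move=> v; have [r [_ hr _]] := crd_supp bL v; exists r => l.
  by rewrite hr negbK => /eqP.
move=> /choice[supp hsupp].
pose S := flatten [seq supp v | v <- t].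
have [n2 h2] := W_cover (map val S).
exists (maxn n1 n2) => n; rewrite geq_max => /andP[le1 le2]; split.
  move=> e en; apply: contrapT => nL; case/negP: en.
  have et : \val e \in t.
    have : (E `\` (E `&` L)) (\val e) by split; [exact: set_valP|case].
    by rewrite ht.
  have := W_le le1 (h1 _ et).
  by move/(CS_val_iff bE).
move=> l Ll; have [El|nEl] := pselect (E l); last first.
  left; pose l' : L := SigSub (mem_set Ll).
  have [lS|lS] := boolP (l' \in S).
    apply: (W_le le2); apply: h2.
    by apply/mapP; exists l'.
  (* If [l] is neither in [E] nor in the support of a missing vector of [E], then all of [E] is
     spanned by [L] without [l]. *)
  have [_ indL] := bL; case: (indL l Ll).
  have hLl := lspan_subspace (L `\ l).
  have : lspan E `<=` lspan (L `\ l).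
    apply: lspan_min => // v Ev; have [Lv|nLv] := pselect (L v).
      by apply: sub_lspan; split=> // /= vl; rewrite -vl in nEl.
    have vt : v \in t.
      have : (E `\` (E `&` L)) v by split=> // -[].
      by rewrite ht.
    have [r [_ hr ->]] := crd_supp bL v.
    apply: subspace_sum => // k kr; apply: (subspaceZ hLl); apply: sub_lspan.
    split; first exact: set_valP.
    move=> /= kl; have kl' : k = l' by apply: val_inj.
    have : l' \notin supp v.
      apply: contra lS => lv; apply/flattenP; exists (supp v) => //.
      exact: map_f.
    by move/hsupp => c0; move: kr; rewrite hr kl' c0 eqxx.
  by apply; have [-> _] := bE.
pose e : E := SigSub (mem_set El).
have [en|en] := boolP (e \in In n); first by left; exact: (W_val en).
by right; exists e.
Qed.

(** For [n] large the commensuration changes only the traces on [W n]. Compatibility of [G] with [L]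
    is what puts the basis vectors outside [E_n] into the right members. *)
Lemma FlE_fin_flag G : FlE sigma0 G ->
  exists n M, fin_flag sigma0 (En n) M /\ G = embed sigma0 (En n) M.
Proof.
move=> [[Gs Gt _ _] _ [L [bL fL [s [_ Geq]]]] [phi cphi]].
have cF := chain_Fl sigma0; have cG : chain G by [].
have [n1 h1] := commensuration_simn cF cG cphi.
have [n2 h2] := cofinite_basis bL fL.
pose n := maxn n1 n2.
have sn X : F X -> simn n (phi X) X by apply: h1; exact: leq_maxl.
have [EL LW] := h2 n (leq_maxr n1 n2).
have [[Fphi _ phiG] mono _] := cphi.
(* In the basis [L] a vector of [W n] has no coefficient at the elements of [E] outside [E_n]. *)
have WL e : e \notin In n -> forall w, W n w -> forall l : L, \val l = \val e -> crd bL l w = 0.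
  move=> en w Ww l le; have [w1 [c1 c2]] := CS_split bL [set l | W n (\val l)] w.
  have Ww1 : W n w1 by apply: CS_min c1.
  have c3 : CS bE (~` inI (In n)) (w - w1).
    apply: CS_min c2 => [|k /= nk]; first exact: CS_subspace.
    have [//|[f fn <-]] := LW _ (set_valP k).
    by apply: CS_val => /=; apply/negP.
  have : w - w1 = 0.
    apply: (crd_eq0 (bE := bE)) => f; have [fn|/negP fn] := boolP (f \in In n).
      by apply: c3 => /=; apply.
    exact: (subspaceB (W_subspace n) Ww Ww1).
  move=> /eqP; rewrite subr_eq0 => /eqP ->; apply: c1 => /=; rewrite le.
  by move/(CS_val_iff bE); apply/negP.
(* Write [e = y + w] with [y] in the image and [w] in [W n]. In the basis [L] the coefficient of [y]
   at [e] is 1, and the image is spanned by elements of [L], so it contains [e]. *)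
have mem a b e : e \notin In n -> dnb sigma0 a b e -> phi (Fsig sigma0 a b) (\val e).
  move=> en de; have FX : F (Fsig sigma0 a b) by exists a, b.
  have [eqs _] := sn _ FX; set Y := phi _ in eqs *.
  have : sumset (Fsig sigma0 a b) (W n) (\val e).
    by apply: sumset_subl => //; rewrite FsigE; apply: CS_val.
  rewrite -eqs => -[y Yy [w Ww eq]].
  pose l : L := SigSub (mem_set (EL e en)).
  have : G Y by apply: Fphi.
  rewrite Geq => -[a' [b' YE]]; move: Yy; rewrite YE /fpart (lspan_CS bL) => Yy.
  apply: (CS_val bL (e := l)); apply: contrapT => /Yy.
  have -> : y = \val l - w by rewrite -[\val l]/(\val e) -eq addrK.
  by rewrite crdB crdE eqxx (WL e en w Ww l) // subr0 => /eqP; rewrite oner_eq0.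
have phis a b : subspace (phi (Fsig sigma0 a b)) by apply: Gs; apply: Fphi; exists a, b.
exists n, (fun a b => phi (Fsig sigma0 a b) `&` W n); split.
  rewrite /fin_flag lspan_En; split.
  - move=> a b; split; [exact: subspaceI|by move=> v []|].
    apply: simn_same_dim => //; last by apply: sn; exists a, b.
    by apply: (proj1 cF); exists a, b.
  - move=> a v [hv Wv]; split=> //; apply: (proj2 (mono (Fsig sigma0 a false) _ _ _)) hv.
    + by exists a, false.
    + by exists a, true.
    by have [_ _ []] := consecutive_Fl a.
  move=> a a' aa' v [hv Wv]; split=> //.
  apply: (proj2 (mono (Fsig sigma0 a true) _ _ _)) hv.
  + by exists a, true.
  + by exists a', false.
  by rewrite !FsigE; apply: CS_mono => e /le_lt_trans; apply.
have eqY a b : phi (Fsig sigma0 a b) =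
    sumset (phi (Fsig sigma0 a b) `&` W n) (CS bE (rest n a b)).
  apply/seteqP; split; last first.
    apply: sumset_min => //.
    by apply: CS_min => // e [en de]; apply: mem.
  move=> y Yy; have [eqs _] := sn (Fsig sigma0 a b) (ltac:(by exists a, b)).
  have : sumset (phi (Fsig sigma0 a b)) (W n) y by apply: sumset_subl.
  rewrite eqs => -[x hx [w Ww eq]]; rewrite FsigE in hx.
  have [x1 [c1 c2]] := CS_split bE (inI (In n)) x.
  have c3 : CS bE (rest n a b) (x - x1).
    move=> e nr; have [en|/negP en] := pselect (e \in In n); first by apply: c2 => /=; apply.
    rewrite crdB (c1 e) ?subr0; last exact/negP.
    by apply: hx => de; apply: nr.
  exists (x1 + w); last by exists (x - x1) => //; rewrite -eq addrC addrA subrK.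
  split; last exact: (subspaceD (W_subspace n)).
  have -> : x1 + w = y - (x - x1) by rewrite -eq opprB [RHS]addrC addrA subrK.
  by apply: (subspaceB (phis a b)) => //; apply: CS_min c3 => // e [en de]; apply: mem.
rewrite embedE; apply/seteqP; split.
  move=> Y GY; have [X FX eq] := phiG _ GY; case: FX eq => a [b ->] <-.
  by exists a, b; rewrite -eqY.
by move=> _ [a [b ->]]; rewrite -eqY; apply: Fphi; exists a, b.
Qed.

(** * Orbit decomposition and cosets *)

Let PF := stab E F.

Lemma FlE_cell G : FlE sigma0 G -> exists n g s,
  [/\ fin n g, B g, leadp g, okn n s & G = act g (Fl_sig s)].
Proof.
move=> /FlE_fin_flag[n [M [hM ->]]].
have [g [s [fg Bg lpg ok [eq _]]]] :=
  fin_flag_cell hM.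
by exists n, g, s; rewrite eq.
Qed.

Lemma GE_okn g s : GE E g -> Worbit sigma0 s -> exists n, fin n g /\ okn n s.
Proof.
move=> /GE_fin[n fg].
move=> /(WorbitP _)[m ok].
exists (maxn n m); split; first exact: (fin_le (leq_maxl n m)).
exact: (okn_le (leq_maxr n m)).
Qed.

Lemma FlE_GE g s : GE E g -> Worbit sigma0 s -> FlE sigma0 (act g (Fl_sig s)).
Proof.
by move=> Gg Ws; have [n [fg ok]] := GE_okn Gg Ws; apply: (FlE_act fg ok).
Qed.

Lemma chain_GE g s : GE E g -> chain (act g (Fl_sig s)).
Proof. by move=> [lg _ _]; apply: chain_act => //; apply: chain_Fl. Qed.

Lemma labelling_GE g s M : GE E g -> Worbit sigma0 s ->
  labelling sigma0 (act g (Fl_sig s)) M <-> M = fun a b => g @` Fsig s a b.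
Proof.
move=> Gg Ws; have [n [fg ok]] := GE_okn Gg Ws.
have lab := labelling_act fg ok; split=> [lM|-> //].
apply/funext => a; apply/funext => b.
exact: (labelling_uniq (chain_GE s Gg) lM lab).
Qed.

Lemma orbit_relpos g s M : B g -> Worbit sigma0 s ->
  labelling sigma0 (act g (Fl_sig s)) M -> relative_position leB M s.
Proof.
move=> Bg Ws; have [Gg _] := Bg; have [lg _ _] := Gg.
move=> /(labelling_GE _ Gg Ws) ->.
have lpg : leadp g := B_leadp Bg.
exact: (relpos_orbit s lg lpg).
Qed.

Lemma Worbit_sigma0 : Worbit sigma0 sigma0.
Proof. by apply/(WorbitP _); exists 0%N. Qed.

Lemma FlE_orbit G : FlE sigma0 G ->
  exists s g, [/\ Worbit sigma0 s, B g & G = act g (Fl_sig s)].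
Proof.
move=> /FlE_cell[n [g [s [_ Bg _ ok ->]]]]; exists s, g; split=> //.
by apply/(WorbitP _); exists n.
Qed.

Lemma relpos_orbitP G M s : FlE sigma0 G -> labelling sigma0 G M ->
  Worbit sigma0 s -> (Borbit B s G <-> relative_position leB M s).
Proof.
move=> /FlE_orbit[t [g [Wt Bg ->]]] lab Ws.
have rt := orbit_relpos Bg Wt lab; split=> [[h Bh eq]|rs].
  by rewrite -eq in lab; apply: orbit_relpos lab.
by exists g => //; rewrite (relpos_uniq rt rs).
Qed.

Lemma trivIset_orbits : trivIset (Worbit sigma0) (Borbit B).
Proof.
move=> s t Ws Wt [G [[g Bg eq] [h Bh eq']]]; have [Gg _] := Bg.
have lab : labelling sigma0 (act g (Fl_sig s)) (fun a b => g @` Fsig s a b).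
  exact/labelling_GE.
apply: (relpos_uniq (orbit_relpos Bg Ws lab)).
by rewrite eq -eq' in lab; apply: (orbit_relpos Bh Wt lab).
Qed.

Lemma FlE_bigcup : FlE sigma0 = \bigcup_(s in Worbit sigma0) Borbit B s.
Proof.
apply/seteqP; split=> G.
  by move=> /FlE_orbit[s [g [Ws Bg ->]]]; exists s => //; exists g.
by move=> [s Ws [g [Gg _] <-]]; apply: FlE_GE.
Qed.

Lemma FlE_bigcup_weyl :
  FlE sigma0 = \bigcup_(w in [set: weyl E]) Borbit B (sigma0 \o winv w).
Proof.
rewrite FlE_bigcup; apply/seteqP; split=> G.
  by move=> [s [w ->] h]; exists w.
by move=> [w _ h]; exists (sigma0 \o winv w) => //; exists w.
Qed.

Lemma same_cosetP (w w' : weyl E) :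
  same_coset sigma0 w w' <-> sigma0 \o winv w = sigma0 \o winv w'.
Proof.
split=> [[u [Wu eq]]|eq].
  apply/funext => e /=; have h : w (u (winv w' e)) = e.
    by rewrite -[RHS](@winvK _ w') eq.
  have Wu' x : sigma0 (winv u x) = sigma0 x := congr1 (fun t : E -> A => t x) Wu.
  by rewrite -{1}h wfunK -Wu' wfunK.
pose uf e := winv w (w' e); pose ui e := winv w' (w e).
have ufK : cancel uf ui by move=> e; rewrite /uf /ui winvK wfunK.
have uiK : cancel ui uf by move=> e; rewrite /uf /ui winvK wfunK.
have fin_u : finite_set [set e | uf e <> e].
  apply: (@sub_finite_set _ _ ([set e | w e <> e] `|` [set e | w' e <> e])).
    move=> e ne; apply: contrapT => /not_orP[/contrapT h1 /contrapT h2].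
    by apply: ne; rewrite /uf h2 -{1}h1 wfunK.
  by rewrite finite_setU; split; apply: w_finite.
exists (Weyl ufK uiK fin_u); split=> [|e]; last by rewrite /= /uf winvK.
apply/funext => e /=; have := congr1 (fun t : E -> A => t (w e)) eq.
by rewrite /= wfunK.
Qed.

Lemma orbits_coset (w w' : weyl E) :
  (same_coset sigma0 w w' ->
     Borbit B (sigma0 \o winv w) = Borbit B (sigma0 \o winv w')) /\
  (~ same_coset sigma0 w w' ->
     Borbit B (sigma0 \o winv w) `&` Borbit B (sigma0 \o winv w') = set0).
Proof.
split=> [/same_cosetP -> //|ns]; apply/eqP/negPn/negP => /set0P ne; apply: ns.
by apply/same_cosetP; apply: trivIset_orbits => //; [exists w|exists w'].
Qed.

Lemma GE_comp g h : GE E g -> GE E h -> GE E (g \o h).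
Proof.
move=> /GE_fin[n fg].
move=> /GE_fin[m fh].
apply: (fin_GE (n := maxn n m)); apply: fin_comp.
  exact: (fin_le (leq_maxl n m)).
exact: (fin_le (leq_maxr n m)).
Qed.

Lemma GE_inv g h : GE E g -> cancel g h -> cancel h g -> GE E h.
Proof.
move=> /GE_fin[n fg] gh hg.
exact: (fin_GE (fin_inv fg gh hg)).
Qed.

Lemma lcoset_sub g h : GE E g -> GE E h -> act g F = act h F ->
  lcoset g PF `<=` lcoset h PF.
Proof.
move=> Gg Gh eq _ [p [Gp pF] <-]; have [_ [h' hh' h'h] _] := Gh.
have Gh' := GE_inv Gh hh' h'h.
exists (h' \o (g \o p)); last by apply/funext => v /=; rewrite h'h.
split; first by apply: GE_comp => //; apply: GE_comp.
rewrite (act_comp h') (act_comp g) pF eq -act_comp.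
by rewrite (_ : h' \o h = id) ?act_id //; apply/funext.
Qed.

Lemma coset_bijection : exists Phi : set (V -> V) -> set (set V),
  set_bij [set lcoset g PF | g in GE E] (FlE sigma0) Phi /\
  (forall g, GE E g -> Phi (lcoset g PF) = act g F).
Proof.
(* The value at a coset is chosen once; two representatives differ by an element of the stabilizer
   of [F]. *)
have : forall C : set (V -> V), exists G : set (set V),
    forall g, GE E g -> C = lcoset g PF -> G = act g F.
  move=> C; have [[g [Gg eq]]|h] := pselect (exists g, GE E g /\ C = lcoset g PF); last first.
    by exists set0 => g Gg eq; case: h; exists g.
  exists (act g F) => g' Gg' eq'.
  have : lcoset g PF g by exists id => //; split; [apply: (fin_GE (fin_id 0%N))|apply: act_id].
  by rewrite -eq eq' => -[p [_ pF] <-]; rewrite act_comp pF.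
move=> /choice[Phi hPhi]; have PhiE g : GE E g -> Phi (lcoset g PF) = act g F.
  by move=> Gg; apply: hPhi.
exists Phi; split=> //; split.
- by move=> _ [g Gg <-]; rewrite PhiE //; apply: FlE_GE Worbit_sigma0.
- move=> _ _ /set_mem[g Gg <-] /set_mem[h Gh <-]; rewrite !PhiE // => eq.
  by apply/seteqP; split; apply: lcoset_sub.
move=> G /FlE_cell[n [g [s [fg _ _ ok ->]]]].
have [h fh [eq _]] := okn_act ok.
have Ggh : GE E (g \o h) by apply: (fin_GE (fin_comp fg fh)).
by exists (lcoset (g \o h) PF); [exists (g \o h)|rewrite PhiE // act_comp -eq].
Qed.

(** * Pluecker coordinates on the levels and their compatibility *)

Let xc n := Fl_coord sigma0 (En n).

Definition lev n : set (set (set V)) := ilev (Fl_ind En sigma0) n.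

Lemma lev_intro n g s : fin n g -> okn n s -> lev n (act g (Fl_sig s)).
Proof.
move=> fg ok; have [ff eq] := fin_flag_intro fg ok.
by exists (fun a b => g @` Fsig s a b `&` W n).
Qed.

Lemma lev_cell n G : lev n G -> exists g s,
  [/\ fin n g, B g, leadp g, okn n s & G = act g (Fl_sig s)].
Proof.
move=> [M ff ->].
have [g [s [fg Bg lpg ok [eq _]]]] :=
  fin_flag_cell ff.
by exists g, s; rewrite eq.
Qed.

Lemma lev_le n m : (n <= m)%N -> lev n `<=` lev m.
Proof.
move=> nm G /lev_cell[g [s [fg _ _ ok ->]]]; apply: lev_intro.
  exact: (fin_le nm).
exact: (okn_le nm).
Qed.

(** The embedded flag determines its traces because its labelling by [A] is unique. *)
Lemma fin_flag_uniq n g s M : fin n g -> okn n s -> fin_flag sigma0 (En n) M ->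
  embed sigma0 (En n) M = act g (Fl_sig s) -> forall a b, M a b = g @` Fsig s a b `&` W n.
Proof.
move=> fg ok ff; have [h [t [fh _ _ okt [eqM ME]]]] :=
  fin_flag_cell ff.
rewrite eqM => eq a b; rewrite ME; congr (_ `&` _).
have l1 := labelling_act fh okt; have l2 := labelling_act fg ok; rewrite -eq in l2.
have cG : chain (act h (Fl_sig t)).
  by have [lh _ _ _] := fh; apply: chain_act => //; apply: chain_Fl.
exact: (labelling_uniq cG l1 l2).
Qed.

Lemma overP n g s c : fin n g -> okn n s ->
  @over _ _ (xc n) c (act g (Fl_sig s)) <->
  forall a b, seq_basis (g @` Fsig s a b `&` W n) (c a b).
Proof.
move=> fg ok; split=> [[M [ff eq bas]] a b|bas].
  by rewrite -(fin_flag_uniq fg ok ff (esym eq)).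
have [ff eq] := fin_flag_intro fg ok.
by exists (fun a b => g @` Fsig s a b `&` W n).
Qed.

Lemma Fsig_subspace g s a b : linear g -> subspace (g @` Fsig s a b).
Proof. by move=> lg; rewrite FsigE; apply: image_subspace => //; apply: CS_subspace. Qed.

Lemma over_lev n c G : @over _ _ (xc n) c G -> lev n G.
Proof. by move=> [M [ff -> _]]; exists M. Qed.

Lemma over_ex n G : lev n G -> exists c, @over _ _ (xc n) c G.
Proof.
move=> /lev_cell[g [s [fg _ _ ok ->]]]; have [lg _ _ _] := fg.
have : forall p : A * bool, exists r, seq_basis (g @` Fsig s p.1 p.2 `&` W n) r.
  by move=> p; apply: ex_basis => //; apply: Fsig_subspace.
move=> /choice[c hc]; exists (fun a b => c (a, b)); apply/overP => // a b.
exact: (hc (a, b)).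
Qed.

Lemma over_size n c G : @over _ _ (xc n) c G ->
  forall a b, size (c a b) = count (dnb sigma0 a b) (In n).
Proof.
move=> ov a b; have [g [s [fg _ _ ok eq]]] := lev_cell (over_lev ov).
have [lg _ _ _] := fg; rewrite eq in ov; have /(overP _ fg ok) h := ov.
rewrite (rk_basis (In_uniq n) (Fsig_subspace s a b lg) (h a b)).
rewrite FsigE (fin_rk fg); last exact: CS_subspace.
by rewrite rk_dn; apply: (proj2 ok).
Qed.

(** A change of basis scales the coordinates of each member by a determinant. *)
Lemma homog_Fl n c c' G : @over _ _ (xc n) c G -> @over _ _ (xc n) c' G ->
  homog_at (y := xc n) c c'.
Proof.
move=> ov ov'; have [g [s [fg _ _ ok eq]]] := lev_cell (over_lev ov).
have sz := over_size ov; have sz' := over_size ov'; rewrite eq in ov ov'.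
have /(overP _ fg ok) h := ov; have /(overP _ fg ok) h' := ov'.
have : forall p : A * bool, exists la : K, la != 0 /\
    forall l, plucker l (c' p.1 p.2) = la * plucker l (c p.1 p.2).
  move=> p; have [|la la0 hla] := plucker_change _ (h p.1 p.2) (h' p.1 p.2).
    by rewrite sz sz'.
  by exists la.
move=> /choice[la hla].
by apply: (@homog_scale _ _ _ _ _ _ _ _ _ _ la) => [p|j]; [have [] := hla p|have [_ ->] := hla j.1].
Qed.

(** The basis vectors that the passage from level [n] to level [m] adds to a member. *)
Definition newIn n m a b := [seq e <- In m | (e \notin In n) && dnb sigma0 a b e].

Lemma basis_extend n m g s a b c : (n <= m)%N -> fin n g -> okn n s ->
  seq_basis (g @` Fsig s a b `&` W n) c ->
  seq_basis (g @` Fsig s a b `&` W m) (map val (newIn n m a b) ++ c).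
Proof.
move=> nm fg ok bc; have [lg _ _ _] := fg.
have hg := Fsig_subspace s a b lg.
have -> : g @` Fsig s a b `&` W m =
    sumset (CS bE (inI (newIn n m a b))) (g @` Fsig s a b `&` W n).
  have eqs := fin_flag_sum a b fg ok.
  apply/seteqP; split.
    move=> v []; rewrite -{1}eqs => -[u [gu Wu] [w hw eq]] Wv.
    exists w; last by exists u => //; rewrite addrC.
    have Ww : W m w.
      have -> : w = v - u by rewrite -eq addrC addKr.
      by apply: (subspaceB (W_subspace m)) => //; apply: (W_le nm).
    have : (CS bE (rest n a b) `&` CS bE (inI (In m))) w by [].
    rewrite CS_I; apply: CS_mono => e [[en de] em].
    by rewrite /inI /newIn /= mem_filter en em andbT.
  apply: sumset_min; first exact: subspaceI.
    apply: CS_min; first exact: subspaceI.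
    move=> e; rewrite /inI /newIn /= mem_filter => /andP[/andP[en de] em].
    have ge : (g @` Fsig s a b) (\val e).
      by rewrite -eqs; apply: sumset_subr; [exact: subspaceI|apply: CS_val].
    by split=> //; exact: (W_val em).
  by move=> v [gv Wv]; split=> //; apply: (W_le nm).
apply: seq_basis_cat => //; last by apply: basis_CS; apply: filter_uniq.
move=> v [h1 [_ h2]]; apply: (crd_eq0 (bE := bE)) => e.
have [en|/negP en] := boolP (e \in In n); last exact: h2.
by apply: h1; rewrite /inI /= mem_filter en.
Qed.

(** Repeated Laplace expansion along the constant vectors [r]. The size [k] is fixed so that the
    number of terms is the same for all [c]. *)
Lemma plucker_cat_form n (r : seq V) a b k l : exists2 P,
  form (xc n) (fun i => (i == (a, b)) : nat) P &
  forall c, size (c a b) = k -> P c = plucker l (r ++ c a b).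
Proof.
elim: r l => [|f r IH] l.
  by exists (ccoord (xc n) ((a, b), l)) => //; apply: (form_coord (xc n) ((a, b), l)).
have : forall i : nat, exists P, form (xc n) (fun i => (i == (a, b)) : nat) P /\
    forall c, size (c a b) = k -> P c = plucker (fun k => l (bump i k)) (r ++ c a b).
  by move=> i; have [P] := IH (fun k => l (bump i k)); exists P.
move=> /choice[Q hQ].
exists (fun c => \sum_(i < (size r + k).+1) (l i f * (-1) ^+ i) * Q i c).
  apply: (@form_sum K _ (xc n) _ _ _ (fun (i : 'I_(size r + k).+1) c => (l i f * (-1) ^+ i) * Q i c) (Q 0%N)) => [|i]; first by case: (hQ 0%N).
  by apply: form_scale; case: (hQ i).
move=> c sz; rewrite cat_cons plucker_cons size_cat sz; apply: eq_bigr => i _.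
by rewrite mulrA; have [_ ->] := hQ i.
Qed.

(** The lift prepends the added basis vectors. [Z] is arbitrary so that the inclusion is available
    on orbits as well as on whole levels. *)
Lemma inclusion_liftmap n m Z : (n <= m)%N ->
  liftmap (xc n) (lev n `&` Z) (xc m) (lev m `&` Z) id.
Proof.
move=> nm.
apply: (@LiftMap _ _ _ (xc n) (lev n `&` Z) (xc m) (lev m `&` Z) id
  (fun _ c a b => map val (newIn n m a b) ++ c a b) id).
- by move=> G [lG ZG]; split=> //; apply: lev_le lG.
- by move=> G [/over_ex].
- move=> G c [lG _] ov; have [g [s [fg _ _ ok eq]]] := lev_cell lG.
  rewrite eq in ov *; have /(overP _ fg ok) h := ov.
  apply/overP; [exact: (fin_le nm)|exact: (okn_le nm)|].
  by move=> a b; apply: basis_extend.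
- by move=> G c c' [lG _]; apply: homog_Fl.
- by [].
- by [].
move=> [[a b] l].
have [P hP eqP] := plucker_cat_form n (map val (newIn n m a b)) a b
  (count (dnb sigma0 a b) (In n)) l.
exists (fun=> 0%N), P, (fun=> 1); split=> //; first exact: form_const.
move=> G c [lG _] ov; rewrite oner_neq0 mulr1 eqP //.
exact: (over_size ov).
Qed.

Lemma zclosed_restrict n m Z : (n <= m)%N -> zclosed (xc m) (lev m) (Z `&` lev m) ->
  zclosed (xc n) (lev n) (Z `&` lev n).
Proof.
move=> nm hc; have := inclusion_liftmap setT nm; rewrite !setIT => lm.
have := zclosed_pull lm hc; congr (zclosed _ _ _).
apply/seteqP; split=> G; first by move=> [lG [ZG _]].
by move=> [ZG lG]; split=> //; split=> //; apply: lev_le lG.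
Qed.

Lemma iclosed_eventually Z n0 : Z `<=` icarrier (Fl_ind En sigma0) ->
  (forall n, (n0 <= n)%N -> zclosed (xc n) (lev n) (Z `&` lev n)) ->
  iclosed (Fl_ind En sigma0) Z.
Proof.
move=> sub h; split=> // n; apply: (zclosed_restrict (leq_maxr n0 n)).
by apply: h; apply: leq_maxl.
Qed.

(** Applying [g p] to the coordinate basis of each member gives a lift whose Pluecker coordinates
    are determinants of polynomials in [p]. *)
Lemma family_liftmap m s (X : set (nat -> K)) (g : (nat -> K) -> V -> V) Z :
  okn m s -> (forall p, X p -> fin m (g p)) ->
  (forall (l : {scalar V}) e, exists2 P, polyfun P & forall p, X p -> P p = l (g p (\val e))) ->
  (forall p, X p -> Z (act (g p) (Fl_sig s))) ->
  liftmap (affine_coord K) X (xc m) (lev m `&` Z) (fun p => act (g p) (Fl_sig s)).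
Proof.
move=> ok fg pg hZ.
pose r a b := [seq e <- In m | dnb s a b e].
apply: (@LiftMap _ _ _ (affine_coord K) X (xc m) (lev m `&` Z) _
  (fun p _ a b => map (g p \o val) (r a b)) (fun _ _ => 0%N)).
- by move=> p Xp; split; [apply: lev_intro => //; apply: fg|apply: hZ].
- by move=> p _; exists p.
- move=> p c Xp _; apply/(overP _ (fg p Xp) ok) => a b.
  have [lg bg _ _] := fg p Xp; rewrite map_comp.
  have -> : g p @` Fsig s a b `&` W m = g p @` CS bE (inI (r a b)).
    have -> : inI (r a b) = dn s a b `&` inI (In m).
      apply/seteqP; split=> e; rewrite /inI /= mem_filter; first by move=> /andP[].
      by move=> [de ->]; rewrite andbT.
    rewrite -CS_I FsigE; apply/seteqP; split.
      move=> _ [[v hv <-] Wv]; exists v => //; split=> //.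
      exact: (proj2 (fin_W v (fg p Xp))).
    move=> _ [v [h1 h2] <-]; split; first by exists v.
    exact: (proj1 (fin_W v (fg p Xp))).
  apply: seq_basis_image => //; first exact: bij_inj.
  by apply: basis_CS; apply: filter_uniq.
- by move=> G c c' [lG _]; apply: homog_Fl.
- by [].
- by [].
move=> [[a b] l]; set q := r a b.
have : forall (ij : nat * nat), exists P, polyfun P /\
    forall p, X p -> P p = l ij.1 (map (g p \o val) q)`_ij.2.
  move=> [i j] /=; have [lt|ge] := ltnP j (size q); last first.
    exists (fun=> 0); split; first exact: polyfun_const.
    by move=> p _; rewrite nth_default ?linear0 // size_map.
  have [e0 _] : exists e0 : E, True by case: (q) lt => // e0; exists e0.
  have [P pP hP] := pg (l i) (nth e0 q j); exists P; split=> // p Xp.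
  by rewrite hP // (nth_map e0).
move=> /choice[Q hQ].
exists (fun=> 0%N), (fun p => \det (\matrix_(i < size q, j < size q) Q (i : nat, j : nat) p)), (fun=> 1).
split; [|exact: form_const|].
  apply: (polyfun_det (F := fun p => \matrix_(i < size q, j < size q) Q (i : nat, j : nat) p)) => i j.
  rewrite (_ : (fun p => _) = Q (i : nat, j : nat)); first by case: (hQ (i : nat, j : nat)).
  by apply/funext => p; rewrite mxE.
move=> p c Xp /= ->; rewrite oner_neq0 mulr1 (pluckerE _ (m := size q)) ?size_map //.
split=> //; congr (\det _); apply/matrixP => i j; rewrite !mxE.
by have [_ ->] := hQ (i : nat, j : nat).
Qed.

(** * Transversality to coordinate subspaces *)

Variable e0 : E.
Let X := Fl_ind En sigma0.

Lemma icarrier_FlE : icarrier X = FlE sigma0.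
Proof.
apply/seteqP; split=> G.
  move=> [n _ lG]; have [g [s [fg _ _ ok ->]]] :=
    lev_cell lG.
  exact: (FlE_act fg ok).
move=> /FlE_cell.
move=> [n [g [s [fg _ _ ok ->]]]]; exists n => //.
exact: (lev_intro fg ok).
Qed.

Lemma lev_FlE n G : lev n G -> FlE sigma0 G.
Proof. by move=> lG; rewrite -icarrier_FlE; exists n. Qed.

Lemma labelling_fin n g s M : fin n g -> okn n s ->
  labelling sigma0 (act g (Fl_sig s)) M <-> M = fun a b => g @` Fsig s a b.
Proof.
move=> fg ok; apply: labelling_GE.
  exact: (fin_GE fg).
by apply/WorbitP; exists n.
Qed.

(* [transv a J G]: the member [G''_a] of [G] is a complement of the span of the
   basis vectors outside [J]; at a given level this is the non-vanishing of one
   Pluecker coordinate. *)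
Definition transv a (J : pred E) (G : set (set V)) : Prop :=
  exists2 M, labelling sigma0 G M & M a true `&` CS bE [set e | ~~ J e] `<=` [set 0].

Lemma transvE n g s a J : fin n g -> okn n s ->
  transv a J (act g (Fl_sig s)) <->
  g @` Fsig s a true `&` CS bE [set e | ~~ J e] `<=` [set 0].
Proof.
move=> fg ok; split=> [[M /(labelling_fin M fg ok) -> //]|h].
by exists (fun a b => g @` Fsig s a b) => //; apply/(labelling_fin _ fg ok).
Qed.

(** Index sets of Pluecker coordinates: [J] modifies [{sigma0 <= a}] inside [E_n] only and keeps the
    number of elements. *)
Definition okJ n a (J : pred E) := (forall e, e \notin In n -> J e = (sigma0 e <= a)%O) /\
  count J (In n) = count (dnb sigma0 a true) (In n).

Lemma count_In n m (J : pred E) : (n <= m)%N ->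
  count J (In m) = (count J (In n) + count J [seq e <- In m | e \notin In n])%N.
Proof.
move=> nm; rewrite -count_cat; apply/permP.
apply: uniq_perm => [||e]; first exact: In_uniq.
  rewrite cat_uniq In_uniq filter_uniq ?In_uniq // andbT.
  by apply/hasPn => e; rewrite mem_filter => /andP[].
rewrite mem_cat mem_filter; have [en|//] := boolP (e \in In n).
exact: (In_le nm).
Qed.

Lemma okJ_le n m a J : (n <= m)%N -> okJ n a J -> okJ m a J.
Proof.
move=> nm [off cnt]; split=> [e em|].
  by apply: off; apply: contra em; apply: In_le.
rewrite !(count_In _ nm) cnt; congr (_ + _)%N; apply: eq_in_count => e.
by rewrite mem_filter => /andP[en _]; apply: off.
Qed.

(** The coordinate functionals of the elements of [J] in [E_n]. For an admissible [J] the default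
    [e0] occurs only beyond the size of the minor. *)
Definition lJ n (J : pred E) (i : nat) : {scalar V} :=
  crd bE (nth e0 [seq e <- In n | J e] i).

(** Outside [E_n] the set [J] is [{sigma0 <= a}], which supports the fixed part of the member, so
    vanishing on [J] forces the vector into [W n]. *)
Lemma transv_W n g s a J v : okJ n a J -> fin n g -> okn n s ->
  (g @` Fsig s a true `&` CS bE [set e | ~~ J e]) v <->
  (g @` Fsig s a true `&` W n) v /\ forall e, e \in In n -> J e -> crd bE e v = 0.
Proof.
move=> [off cnt] fg ok; split=> [[gv Jv]|[[gv Wv] h]]; last first.
  split=> // e /negP/negPn Je; have [en|/negP en] := boolP (e \in In n); first exact: h.
  exact: Wv.
have eqs := fin_flag_sum a true fg ok.
have crd0J e : J e -> crd bE e v = 0 by move=> Je; apply: Jv; rewrite /= Je.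
split=> [|e _]; last exact: crd0J.
split=> //; move: gv; rewrite -eqs => -[u [gu Wu] [r hr eq]].
suff r0 : r = 0 by rewrite -eq r0 addr0.
apply: (crd_eq0 (bE := bE)) => e.
have [re|] := pselect (rest n a true e); last exact: hr.
have [en /= ea] := re; have := crd0J e; rewrite off // => /(_ ea).
by rewrite -eq crdD (Wu e) ?add0r //; apply/negP.
Qed.

Lemma transv_plucker n a J G c : okJ n a J -> @over _ _ (xc n) c G ->
  transv a J G <-> plucker (lJ n J) (c a true) != 0.
Proof.
move=> okj ov; have lG := over_lev ov.
have [g [s [fg _ _ ok eq]]] :=
  lev_cell lG.
have sz := over_size ov a true.
rewrite eq in ov *; have /(overP _ fg ok) bas := ov.
have [_ cnt] := okj.
have szJ : size [seq e <- In n | J e] = size (c a true) by rewrite size_filter cnt sz.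
have iff := plucker_eq0 (lJ n J) (bas a true).
rewrite (transvE _ _ fg ok); split=> [h|/eqP ne v hv].
  apply/eqP => /iff[v [v0 Mv lv]]; case/eqP: v0; apply: h.
  apply/(transv_W _ okj fg ok); split=> // e en Je.
  have eJ : e \in [seq e <- In n | J e] by rewrite mem_filter Je.
  by have := lv (index e [seq e <- In n | J e]); rewrite -szJ index_mem eJ /lJ nth_index // => ->.
apply: contrapT => v0; apply: ne; apply/iff; exists v.
have [Mv h] := (transv_W _ okj fg ok).1 hv; split=> //; first exact/eqP.
move=> i lt; have : nth e0 [seq e <- In n | J e] i \in [seq e <- In n | J e].
  by apply: mem_nth; rewrite szJ.
by rewrite mem_filter => /andP[Je en]; apply: h.
Qed.

Lemma iclosed_ntransv a J n0 : okJ n0 a J ->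
  iclosed X [set G | FlE sigma0 G /\ ~ transv a J G].
Proof.
move=> okj; apply: (iclosed_eventually (n0 := n0)).
  by move=> G [FG _]; rewrite icarrier_FlE.
move=> n le; have okn' := okJ_le le okj.
exists [set P | P = ccoord (xc n) ((a, true), lJ n J)]; split.
  by move=> P ->; exists (cdeg (xc n) ((a, true), lJ n J)); apply: form_coord.
apply/seteqP; split=> G.
  move=> [[_ nt] lG]; split=> // P c -> ov; apply/eqP/negPn/negP => ne; apply: nt.
  exact/(transv_plucker okn' ov).
move=> [lG h]; split=> //; split; first exact: lev_FlE lG.
have [c ov] := over_ex lG.
by move=> /(transv_plucker okn' ov) /eqP; apply; apply: (h (ccoord (xc n) ((a, true), lJ n J)) c erefl ov).
Qed.

(** At each level the equations are collected over all [i]; the conjunct [FlE] covers an empty index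
    type. *)
Lemma iclosed_bigcap (I : Type) (Z : I -> set (set (set V))) :
  (forall i, iclosed X (Z i)) -> iclosed X [set G | FlE sigma0 G /\ forall i, Z i G].
Proof.
move=> h; split=> [G [FG _]|n]; first by rewrite icarrier_FlE.
have /choice[S hS] : forall i, exists S : set (cone (xc n) -> K),
    (forall P, S P -> exists d, form (xc n) d P) /\
    Z i `&` lev n = [set G | lev n G /\ forall P c, S P -> over c G -> P c = 0].
  by move=> i; have [_ /(_ n)] := h i.
exists (\bigcup_i S i); split; first by move=> P [i _]; case: (hS i) => + _; apply.
apply/seteqP; split=> G.
  move=> [[FG ZG] lG]; split=> // P c [i _ SP] ov; have [_ eq] := hS i.
  have : (Z i `&` lev n) G by split=> //; apply: ZG.
  by rewrite eq => -[_]; apply.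
move=> [lG hG]; split=> //; split; first exact: lev_FlE lG.
move=> i; have [_ eq] := hS i; suff : (Z i `&` lev n) G by case.
by rewrite eq; split=> // P c SP ov; apply: hG ov; exists i.
Qed.

(** * An orbit as a locally closed subset *)

Section Orbit.
Variables (sigma : E -> A) (n0 : nat) (ok0 : okn n0 sigma).

Let Js a : pred E := dnb sigma a true.

Lemma okn_sigma n : (n0 <= n)%N -> okn n sigma.
Proof. by move=> le; apply: (okn_le le). Qed.

Lemma okJ_sigma n a : (n0 <= n)%N -> okJ n a (Js a).
Proof.
move=> /okn_sigma[off cnt]; split=> [e en|]; last exact: cnt.
by rewrite /Js /dnb off.
Qed.

Lemma sigma_val n f : okn n sigma -> forall s, okn n s -> f \in In n ->
  exists2 k, k \in In n & sigma0 k = s f.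
Proof.
move=> _ s [_ cnt] fn; have := count_perm cnt => /perm_mem eq.
have : s f \in map sigma0 (In n) by rewrite -eq map_f.
by move=> /mapP[k kn ->]; exists k.
Qed.

Definition Uset : set (set (set V)) := [set G | FlE sigma0 G /\ forall a, transv a (Js a) G].

(* At level [n] only the conditions indexed by the values of [sigma0] on [E_n]
   matter, which makes the intersection finite. *)
Lemma Uset_finite n G : (n0 <= n)%N -> lev n G ->
  (forall a, a \in map sigma0 (In n) -> transv a (Js a) G) -> Uset G.
Proof.
move=> le lG h; split; first exact: lev_FlE lG.
have [g [s [fg _ _ ok eq]]] :=
  lev_cell lG.
move=> a; rewrite eq in h *; apply/(transvE _ _ fg ok) => v.
have [lg bg _ _] := fg.
move=> hv; have [[gv Wv] _] := (transv_W _ (okJ_sigma a le) fg ok).1 hv.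
move: gv => [u]; rewrite FsigE => hu eqv; rewrite -eqv in hv Wv *.
have Wu : W n u := proj2 (fin_W u fg) Wv.
(* Inside [W n] the member at [a] is the one at the largest value of [s] on [E_n] not above [a], and
   this is a value of [sigma0] there. *)
pose r := [seq f <- In n | (s f <= a)%O].
have [r0|/(argmax_seq s)[f]] := eqVneq r [::].
  rewrite (crd_eq0 (bE := bE) (u := u)); first by rewrite lin0.
  move=> f; have [fn|/negP fn] := boolP (f \in In n); last exact: Wu.
  apply: hu => fa; have : f \in r by rewrite mem_filter fn andbT.
  by rewrite r0.
rewrite mem_filter => /andP[/= fa fn] fmax.
have [k kn sk] := sigma_val (okn_sigma le) ok fn.
have := h (s f); rewrite -sk map_f // => /(_ isT) /(transvE _ _ fg ok); apply; split.
  rewrite FsigE; exists u => // j nj.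
  have [jn|/negP jn] := boolP (j \in In n); last exact: Wu.
  apply: hu => ja; apply: nj; rewrite /dn /= sk; apply: fmax.
  by rewrite mem_filter jn andbT.
have [_ hc] := hv; apply: CS_mono hc => j /=; rewrite /Js /dnb -!ltNge sk.
exact: le_lt_trans.
Qed.

(** At each large level a single product of Pluecker coordinates defines the complement. *)
Lemma iclosed_UsetC : iclosed X [set G | FlE sigma0 G /\ ~ Uset G].
Proof.
apply: (iclosed_eventually (n0 := n0)).
  by move=> G [FG _]; rewrite icarrier_FlE.
move=> n le; pose P c := \prod_(a <- map sigma0 (In n))
  ccoord (xc n) ((a, true), lJ n (Js a)) c.
exists [set Q | Q = P]; split.
  move=> _ ->; apply: form_prod => a; exists (cdeg (xc n) ((a, true), lJ n (Js a))).
  exact: form_coord.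
apply/seteqP; split=> G.
  move=> [[_ nU] lG]; split=> // _ c -> ov; apply: contrapT => /eqP.
  rewrite prodf_seq_neq0 => /allP h; apply: nU; apply: (Uset_finite le lG) => a an.
  by apply/(transv_plucker (okJ_sigma a le) ov); apply: h.
move=> [lG h]; split=> //; split; first exact: lev_FlE lG.
have [c ov] := over_ex lG.
move=> [_ hU]; have := h P c erefl ov; apply/eqP; rewrite prodf_seq_neq0.
apply/allP => a _; exact: (transv_plucker (okJ_sigma a le) ov).1.
Qed.

Lemma iopen_Uset : iopen X Uset.
Proof.
have [_ hc] := iclosed_UsetC; split=> [G [FG _]|n]; first by rewrite icarrier_FlE.
split; first by move=> G [].
have := hc n; congr (zclosed _ _ _); apply/seteqP; split=> G.
  by move=> [[FG nU] lG]; split=> // -[/nU].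
move=> [lG nU]; split=> //; split; first exact: lev_FlE lG.
by move=> UG; apply: nU.
Qed.

Let inv := inversions leB sigma.

Definition Jex a e e' : pred E := fun f => (Js a f && (f != e)) || (f == e').

Lemma okJ_ex n a e e' : okn n sigma -> e \in In n -> e' \in In n ->
  (sigma e <= a)%O -> (a < sigma e')%O -> okJ n a (Jex a e e').
Proof.
move=> [off cnt] en e'n ea ae'; split=> [f fn|].
  have [fe|fe] := eqVneq f e; first by rewrite fe en in fn.
  have [fe'|fe'] := eqVneq f e'; first by rewrite fe' e'n in fn.
  by rewrite /Jex (negbTE fe') fe andbT orbF /Js /dnb off.
rewrite -cnt; pose p : pred E := fun f => Js a f && (f != e).
have c1 (k : E) : k \in In n -> count (pred1 k) (In n) = 1%N.
  by move=> kn; rewrite count_uniq_mem ?In_uniq // kn.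
have h (k : E) : k \in In n -> ~~ p k -> count (predU p (pred1 k)) (In n) = (count p (In n)).+1.
  move=> kn pk; have := count_predUI p (pred1 k) (In n); rewrite (c1 k kn) addn1 => <-.
  rewrite (eq_count (a1 := predI p (pred1 k)) (a2 := pred0)) ?count_pred0 ?addn0 // => f /=.
  by case: eqP => [->|]; rewrite ?andbF // andbT (negbTE pk).
transitivity (count p (In n)).+1.
  by rewrite -(h e' e'n) ?/p ?/Js ?/dnb // negb_and -ltNge ae'.
rewrite -(h e en); last by rewrite /p eqxx andbF.
apply: eq_count => f /=; rewrite /p /Js /dnb.
by have [->|] := eqVneq f e; rewrite ?ea ?orbT // andbT orbF.
Qed.

(** Exchanges [{sigma <= a} - e + e'] at pairs that are not inversions and whose values are
    separated by [a]. *)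
Definition Ccond (q : A * (E * E)) :=
  [/\ strict leB q.2.1 q.2.2, (sigma q.2.1 <= q.1)%O & (q.1 < sigma q.2.2)%O].

Definition Cset : set (set (set V)) := [set G | FlE sigma0 G /\
  forall q : {q | Ccond q}, (FlE sigma0 G /\
    ~ transv (sval q).1 (Jex (sval q).1 (sval q).2.1 (sval q).2.2) G)].

Lemma iclosed_Cset : iclosed X Cset.
Proof.
apply: (iclosed_bigcap (Z := fun q : {q | Ccond q} => [set G | FlE sigma0 G /\
    ~ transv (sval q).1 (Jex (sval q).1 (sval q).2.1 (sval q).2.2) G])).
move=> [[a [e e']] [/= _ ea ae']].
have [n1 h] := In_cover [:: e; e'].
have sub := In_le (leq_maxr n0 n1).
apply: (iclosed_ntransv (n0 := maxn n0 n1)).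
apply: okJ_ex => //; first exact: okn_sigma (leq_maxl _ _).
  by apply: sub; apply: h; rewrite inE eqxx.
by apply: sub; apply: h; rewrite !inE eqxx orbT.
Qed.

(** In the member, leading terms have [sigma]-value at most [a]; in the coordinate complement, above
    [a]. *)
Lemma orbit_transv n g a : fin n g -> leadp g -> okn n sigma ->
  transv a (Js a) (act g (Fl_sig sigma)).
Proof.
move=> fg lpg ok; have [lg _ _ _] := fg; apply/(transvE _ _ fg ok).
move=> v [[u hu eq] hv]; apply: contrapT => /eqP v0.
have [f lv] := lead_ex v0.
have /negP := lead_CS lv hv; apply.
rewrite -eq in lv; have lu := leadp_refl lg lpg lv.
by rewrite FsigE in hu; exact: (lead_CS lu hu).
Qed.

(** Transversality and a dimension count decompose [W n] into the trace of the member and a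
    coordinate complement. The component of [e] in the member is, for [e] in [Js a], its reduced
    echelon vector. *)
Lemma transv_vec n g s a e : fin n g -> okn n s -> okn n sigma ->
  transv a (Js a) (act g (Fl_sig s)) -> e \in In n ->
  exists v, [/\ (g @` Fsig s a true) v, W n v &
    forall f, Js a f -> crd bE f v = (f == e)%:R].
Proof.
move=> fg ok oks /(transvE _ _ fg ok) tr en; have [lg _ _ _] := fg.
set M := g @` Fsig s a true in tr *.
have hM : subspace M := Fsig_subspace s a true lg.
pose N := CS bE ([set f | ~~ Js a f] `&` inI (In n)).
have hN : subspace N := CS_subspace _ _.
have hMW := subspaceI hM (W_subspace n).
have sumE := rk_sumI (In_uniq n) hMW hN (fun v hv => proj2 hv)
  (fun v hv => CS_mono (fun f => @proj2 _ _) hv).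
have hS := subspace_sumset hMW hN.
have rkM : rk (In n) (M `&` W n) = count (Js a) (In n).
  transitivity (rk (In n) M); first by apply: (eq_rk (bE := bE) (In_uniq n) hMW hM) => v; [case=> -[]|case=> ? ?; split].
  rewrite /M FsigE (fin_rk fg); last exact: CS_subspace.
  by rewrite rk_dn (proj2 ok) -(proj2 oks).
have rkN : rk (In n) N = count (predC (Js a)) (In n).
  rewrite rk_CS //; apply: eq_in_count => f fn /=.
  by apply/asboolP/idP => [[]|].
have rk0 : rk (In n) (M `&` W n `&` N) = 0%N.
  apply/eqP; rewrite -leqn0.
  have <- : rk (In n) (CS bE set0) = 0%N.
    rewrite rk_CS // (eq_count (a2 := pred0)) ?count_pred0 // => f; by apply/asboolP.
  apply: (rk_le (bE := bE)) => //; [exact: subspaceI|exact: CS_subspace|].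
  move=> v [[[Mv _] Nv] _]; rewrite (tr v); first by apply: subspace0; apply: CS_subspace.
  by split=> //; apply: CS_mono Nv => f [].
have sub : sumset (M `&` W n) N `&` CS bE (inI (In n)) `<=` W n by move=> v [].
have := rk_eq_sub (In_uniq n) hS (W_subspace n) sub.
have -> : (rk (In n) (W n) <= rk (In n) (sumset (M `&` W n) N))%N.
  move: sumE; rewrite rk0 addn0 rkM rkN count_predC => ->.
  rewrite /W rk_CS // (leq_trans (count_size _ _)) //.
move=> /(_ isT (\val e))[].
  by split; exact: (W_val en).
move=> m [Mm Wm] [y Ny eq]; exists m; split=> // f Jf.
have -> : m = \val e - y by rewrite -eq addrK.
rewrite crdB crdE (Ny f) ?subr0 1?eq_sym // => -[/negP]; exact.
Qed.

Lemma orbit_sub : Borbit B sigma `<=` Uset `&` Cset.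
Proof.
move=> _ [g Bg <-]; have [Gg _] := Bg.
have [m fg0] := GE_fin Gg.
have lpg : leadp g := B_leadp Bg.
have FG : FlE sigma0 (act g (Fl_sig sigma)).
  apply: (FlE_GE Gg).
  by apply/WorbitP; exists n0.
have tr a : transv a (Js a) (act g (Fl_sig sigma)).
  apply: (orbit_transv (n := maxn m n0)) => //; last exact: okn_sigma (leq_maxr _ _).
  exact: (fin_le (leq_maxl _ _) fg0).
split=> //; split=> // -[[a [e e']] [/= lt ea ae']]; split=> //.
have [n1 h] := In_cover [:: e].
pose n := maxn n1 (maxn m n0).
have fg : fin n g.
  by apply: (fin_le _ fg0); rewrite !leq_max leqnn orbT.
have ok : okn n sigma by apply: okn_sigma; rewrite !leq_max leqnn !orbT.
have en : e \in In n.
  by apply: (In_le (leq_maxl _ _)); apply: h; rewrite inE.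
have [v [Mv _ hv]] := transv_vec fg ok ok (tr a) en.
have ev : crd bE e v = 1 by rewrite hv ?eqxx.
have v0 : v != 0 by apply/eqP => v0; move: ev; rewrite v0 crd0 => /eqP; rewrite eq_sym oner_eq0.
(* The leading term lies in [Js a], where [v] has no coefficient other than that of [e]. *)
have lv : lead v e.
  have [f lf] := lead_ex v0.
  have [u hu eq] := Mv; have [lg _ _ _] := fg.
  have lf' := lf; rewrite -eq in lf'.
  have lu := leadp_refl lg lpg lf'.
  rewrite FsigE in hu; have Jf : Js a f := lead_CS lu hu.
  have [f0 _] := lf; move: f0; rewrite hv //; have [fe _|_] := eqVneq f e; last by rewrite eqxx.
  by rewrite -fe.
(* With leading term [e], the vector has no coefficient at the later [e'], so it violates
   transversality for the exchanged set. *)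
move=> /(transvE _ _ fg ok) /(_ v) h0; case/eqP: v0; apply: h0; split=> // f /negP/negPn.
move=> /orP[/andP[Jf fe]|/eqP ->]; first by rewrite hv // (negbTE fe).
apply/eqP/negPn/negP => /(proj2 lv) le; move: lt => /andP[/eqP ne le']; apply: ne.
by apply: leB_anti; rewrite le le'.
Qed.

(** Reduces comparisons of flags to the members F''. Zero is listed apart for the case of a least
    [a]. *)
Lemma Fsig_falseP g s a : g @` Fsig s a false =
  [set v | g 0 = v \/ exists2 b, (b < a)%O & (g @` Fsig s b true) v].
Proof.
rewrite !FsigE; apply/seteqP; split=> v.
  move=> [u hu <-]; have [t [ut ht eq]] := crd_supp bE u.
  have [t0|/(argmax_seq s)[f ft fmax]] := eqVneq t [::].
    by left; congr g; rewrite eq t0 big_nil.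
  right; exists (s f).
    apply: contrapT => nf; have := hu f nf; move/eqP; apply/negP.
    by rewrite -ht.
  exists u => //; rewrite FsigE => k nk; apply/eqP; rewrite -[_ == _]negbK -ht.
  by apply/negP => kt; apply: nk; apply: fmax.
case=> [<-|[b ba [u + <-]]].
  by exists 0 => //; apply: subspace0; apply: CS_subspace.
rewrite FsigE => hu; exists u => //; apply: CS_mono hu => e /le_lt_trans; exact.
Qed.

(** The reduced echelon vectors at the [e] of [E_n] assemble to [g]. The exchange conditions kill
    its entries at non-inversions, so it preserves leading terms, and a rank count shows that it
    carries [F_sigma] to [G]. *)
Lemma UC_normal n G : okn n sigma -> lev n G -> Uset G -> Cset G ->
  exists g, [/\ fin n g, leadp g, G = act g (Fl_sig sigma),
    forall e, crd bE e (g (\val e)) = 1 &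
    forall e f, f != e -> crd bE f (g (\val e)) != 0 ->
      [/\ inv (f, e), f \in In n & e \in In n]].
Proof.
move=> oks lG [_ tr] [FG hC]; have [g [s [fg _ _ ok eq]]] := lev_cell lG.
have [lg bg _ goff] := fg.
rewrite eq in tr hC.
have : forall e, exists v, e \in In n -> [/\ (g @` Fsig s (sigma e) true) v, W n v &
    forall f, Js (sigma e) f -> crd bE f v = (f == e)%:R].
  move=> e; have [en|nen] := boolP (e \in In n); last by exists 0.
  by have [v hv] := transv_vec fg ok oks (tr (sigma e)) en; exists v.
move=> /choice[vv hvv]; pose g' := extend bE (In n) vv.
have lg' : linear g' := extend_linear _ _ _.
have g'E e : g' (\val e) = if e \in In n then vv e else \val e by apply: extendE.
have diag e : crd bE e (g' (\val e)) = 1.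
  rewrite g'E; case: ifP => [en|_]; last by rewrite crdE eqxx.
  by have [_ _ ->] := hvv e en; rewrite ?eqxx /Js /dnb.
have offd e f : f != e -> crd bE f (g' (\val e)) != 0 ->
    [/\ inv (f, e), f \in In n & e \in In n].
  rewrite g'E => fe; case: ifP => [en|_]; last by rewrite crdE (eq_sym e f) (negbTE fe) eqxx.
  move=> f0; have [Mv Wv hv] := hvv e en.
  have fn : f \in In n by apply: contraNT f0 => /negP fn; apply/eqP; apply: Wv.
  have sef : (sigma e < sigma f)%O.
    rewrite ltNge; apply/negP => Jf; by move: f0; rewrite (hv f Jf) (negbTE fe) eqxx.
  split=> //; split=> //=; rewrite /strict fe /=.
  (* If [e] preceded [f], then [Cset] would forbid transversality for the exchange of [e] by [f];
     but the non-zero entry at [f] makes that exchange transversal. *)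
  have [//|ef] := orP (leB_total f e).
  have cq : Ccond (sigma e, (e, f)) by split=> //=; rewrite /strict eq_sym fe.
  have [_] := hC (exist _ _ cq); rewrite /= => nt; exfalso; apply: nt.
  apply/(transvE _ _ fg ok) => u [Mu hu].
  have hM : subspace (g @` Fsig s (sigma e) true) := Fsig_subspace s _ true lg.
  have eqv : u = crd bE e u *: vv e.
    apply/eqP; rewrite -subr_eq0; apply/eqP; apply: (proj1 (transvE _ _ fg ok) (tr (sigma e))).
    split; first by apply: (subspaceB hM) => //; apply: (subspaceZ hM).
    move=> k /negP/negPn Jk; rewrite crdB crdZ hv //.
    have [->|ke] := eqVneq k e; first by rewrite mulr1 subrr.
    by rewrite mulr0 subr0; apply: hu => /negP; apply; rewrite /Jex ke andbT; apply/orP; left.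
  have : crd bE f u = 0 by apply: hu => /negP; apply; rewrite /Jex eqxx orbT.
  rewrite eqv crdZ => /eqP; rewrite mulf_eq0 (negbTE f0) orbF => /eqP ->.
  by rewrite scale0r.
have lpg' : leadp g'.
  move=> e; split; first by rewrite diag oner_neq0.
  move=> f; have [->|fe] := eqVneq f e; first by move=> _; apply: leB_refl.
  by move=> /(offd _ _ fe)[[/andP[]]].
have ig' := lead_inj lg' lpg'.
have fg' : fin n g'.
  apply: (fin_intro lg' ig') => e en; rewrite g'E.
    by rewrite (en : e \in In n); have [] := hvv e en.
  by rewrite (negbTE (en : e \notin In n)).
exists g'; split=> //; rewrite eq.
have MT a : g @` Fsig s a true = g' @` Fsig sigma a true.
  rewrite -(fin_flag_sum a true fg ok) -(fin_flag_sum a true fg' oks); congr sumset.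
  have hM : subspace (g @` Fsig s a true) := Fsig_subspace s _ true lg.
  have hM' : subspace (g' @` Fsig sigma a true) := Fsig_subspace sigma _ true lg'.
  have sub : g' @` Fsig sigma a true `<=` g @` Fsig s a true.
    rewrite FsigE => _ [v + <-].
    apply: (CS_min (preimage_subspace lg' hM)) => e /= ea; rewrite g'E.
    case: ifPn => en.
      have [[u hu <-] _ _] := hvv e en; exists u => //; move: hu.
      by rewrite !FsigE; apply: CS_mono => k /le_trans; apply.
    exists (\val e); last exact: goff.
    by rewrite FsigE; apply: CS_val; rewrite /dn /= (proj1 ok) // -(proj1 oks).
  have sub' : g' @` Fsig sigma a true `&` CS bE (inI (In n)) `<=` g @` Fsig s a true.
    by move=> v [/sub].
  apply/seteqP; split=> v [hv Wv]; split=> //; last exact: sub.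
  apply: (rk_eq_sub (In_uniq n) hM' hM sub') => //.
  rewrite !FsigE (fin_rk fg) ?(fin_rk fg') ?rk_dn; try exact: CS_subspace.
  by rewrite (proj2 ok) (proj2 oks).
have MF a : g @` Fsig s a false = g' @` Fsig sigma a false.
  rewrite !Fsig_falseP !lin0 //; apply/seteqP; split=> v [h|[b ba h]]; try by left.
    by right; exists b => //; rewrite -MT.
  by right; exists b => //; rewrite MT.
rewrite !act_FlE; apply/seteqP; split=> Y [a [b ->]]; exists a, b; case: b;
  by rewrite ?MT ?MF.
Qed.

Lemma orbitE : Borbit B sigma = Uset `&` Cset.
Proof.
apply/seteqP; split; first exact: orbit_sub.
move=> G [UG CG]; have [FG _] := UG.
have [n [g [s [fg _ _ ok eq]]]] := FlE_cell FG.
have lG : lev (maxn n n0) G.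
  rewrite eq; apply: lev_intro.
    exact: (fin_le (leq_maxl _ _) fg).
  exact: (okn_le (leq_maxl _ _) ok).
have [h [fh lph -> _ _]] := UC_normal (okn_sigma (leq_maxr n n0)) lG UG CG.
by exists h => //; exact: (leadp_B fh).
Qed.

Lemma orbit_locally_closed : ilocally_closed X (Borbit B sigma).
Proof.
by exists Uset, Cset; split; [exact: iopen_Uset|exact: iclosed_Cset|exact: orbitE].
Qed.

(** * Affine coordinates on an orbit *)

Section Parametrization.
Variables (en : nat -> E * E) (idx : E * E -> nat) (bd : nat -> bool).
Hypothesis enP : forall i, bd i -> inv (en i) /\ idx (en i) = i.
Hypothesis idxP : forall z, inv z -> bd (idx z) /\ en (idx z) = z.
Implicit Types (p q : nat -> K).

(** The normal form: [p i] is the matrix entry at the inversion [en i = (f, e)], that is, the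
    coefficient of [f] in the image of [e]; [k] truncates the sum. *)
Definition gx (k : nat) p (v : V) : V :=
  v + \sum_(i < k) (p i * crd bE (en i).2 v) *: \val (en i).1.

Definition affok k p := (forall i, (k <= i)%N -> p i = 0) /\ (forall i, p i != 0 -> bd i).

Lemma gx_linear k p : linear (gx k p).
Proof.
move=> a u v; rewrite /gx scalerDr addrACA scaler_sumr -big_split /=.
congr (_ + _); apply: eq_bigr => i _.
by rewrite crdL mulrDr scalerDl scalerA mulrCA.
Qed.

Lemma crd_gx k p e f : affok k p ->
  crd bE f (gx k p (\val e)) = (e == f)%:R + (if `[<inv (f, e)>] then p (idx (f, e)) else 0).
Proof.
move=> [pk pbd]; rewrite crdD crdE crd_sum; congr (_ + _).
have term i : crd bE f ((p i * crd bE (en i).2 (\val e)) *: \val (en i).1) =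
    if en i == (f, e) then p i else 0.
  rewrite crdZ !crdE -mulrA; case: (en i) => x y /=; rewrite xpair_eqE (eq_sym e y).
  by case: (x == f); case: (y == e); rewrite /= ?mulr0 ?mul0r ?mulr0 ?mulr1.
rewrite (eq_bigr (fun i : 'I_k => if en i == (f, e) then p i else 0)); last first.
  by move=> i _; exact: term.
case: asboolP => [/idxP[bi ei]|ni]; last first.
  apply: big1 => i _; case: eqP => // ei; apply/eqP/negPn/negP => /pbd /enP[].
  by rewrite ei.
have [lt|ge] := ltnP (idx (f, e)) k.
  rewrite (bigD1 (Ordinal lt)) //= ei eqxx big1 ?addr0 // => i ne.
  case: eqP => // eqi; apply/eqP/negPn/negP => /pbd /enP[_]; rewrite eqi => eqx.
  by case/eqP: ne; apply: val_inj; rewrite /= eqx.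
rewrite pk // big1 // => i _; case: eqP => // eqi; apply/eqP/negPn/negP => /pbd /enP[_].
by rewrite eqi => eqx; have := ltn_ord i; rewrite -eqx ltnNge ge.
Qed.

Lemma inv_irrefl e : ~ inv (e, e).
Proof. by move=> [/andP[/eqP]]. Qed.

Lemma crd_gx_diag k p e : affok k p -> crd bE e (gx k p (\val e)) = 1.
Proof.
move=> ap; rewrite crd_gx // eqxx; case: asboolP => [/inv_irrefl //|_].
by rewrite addr0.
Qed.

Lemma gx_leadp k p : affok k p -> leadp (gx k p).
Proof.
move=> ap e; split; first by rewrite crd_gx_diag // oner_neq0.
move=> f; rewrite crd_gx //; have [->|ne] := eqVneq e f; first by move=> _; apply: leB_refl.
by rewrite add0r; case: asboolP => [[/andP[]] //|_]; rewrite eqxx.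
Qed.

Definition supported n p := forall i, p i != 0 -> (en i).1 \in In n /\ (en i).2 \in In n.

Lemma gx_fin n k p : affok k p -> supported n p -> fin n (gx k p).
Proof.
move=> ap sp; have lg := gx_linear k p; have lpg := gx_leadp ap.
have ig := lead_inj lg lpg.
apply: (fin_intro lg ig) => e em; rewrite /gx.
  apply: (subspaceD (W_subspace n)); first exact: (W_val em).
  apply: subspace_sumI => // i.
  have [->|/sp[h1 _]] := eqVneq (p i) 0; first by rewrite mul0r scale0r; case: (W_subspace n).
  by apply: (subspaceZ (W_subspace n)); exact: (W_val h1).
rewrite big1 ?addr0 // => i _.
have [->|/sp[_ h2]] := eqVneq (p i) 0; first by rewrite mul0r scale0r.
rewrite crdE; have [ee|_] := eqVneq e (en i).2; last by rewrite mulr0 scale0r.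
by move: em; rewrite ee; have -> : (en i).2 \in In n by [].
Qed.

Lemma affok_supported n1 k : exists2 n, (n1 <= n)%N & forall p, affok k p -> supported n p.
Proof.
pose t := [seq (en i).1 | i <- iota 0 k] ++ [seq (en i).2 | i <- iota 0 k].
have [m hm] := In_cover t.
exists (maxn n1 m); first exact: leq_maxl.
move=> p [pk _] i pi; have ik : i \in iota 0 k.
  by rewrite mem_iota add0n /= ltnNge; apply: contra pi => /pk ->.
have sub := In_le (leq_maxr n1 m).
split; apply: sub; apply: hm; rewrite mem_cat; apply/orP; [left|right];
  by apply/mapP; exists i.
Qed.

Lemma gx_eq k k' p : affok k p -> affok k' p -> gx k p = gx k' p.
Proof.
move=> ap ap'; apply/funext; apply: (lin_ext bE (gx_linear k p) (gx_linear k' p)) => e.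
by apply: (crd_inj (bE := bE)) => f; rewrite !crd_gx.
Qed.

(** A morphism of ind-varieties is one map for all levels, so it must not depend on the truncation
    [k]. *)
Lemma psi_ex : exists psi : (nat -> K) -> set (set V),
  forall p k, affok k p -> psi p = act (gx k p) (Fl_sig sigma).
Proof.
have : forall p, exists G : set (set V), forall k, affok k p -> G = act (gx k p) (Fl_sig sigma).
  move=> p; have [[k ap]|nk] := pselect (exists k, affok k p); last first.
    by exists set0 => k ap; case: nk; exists k.
  by exists (act (gx k p) (Fl_sig sigma)) => k' ap'; rewrite (gx_eq ap ap').
by move=> /choice[psi h]; exists psi => p k; apply: h.
Qed.

Lemma gx_transv n k p a : affok k p -> supported n p -> okn n sigma ->
  gx k p @` Fsig sigma a true `&` CS bE [set e | ~~ Js a e] `<=` [set 0].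
Proof.
move=> ap sp ok; apply/(transvE _ _ (gx_fin ap sp) ok).
apply: (orbit_transv
  a (gx_fin ap sp) (gx_leadp ap) ok).
Qed.

(** Both maps send [e] into the same member with the same coefficients on [{sigma <= sigma e}];
    transversality then forces the images to be equal. *)
Lemma gx_inj k k' p q : affok k p -> affok k' q ->
  act (gx k p) (Fl_sig sigma) = act (gx k' q) (Fl_sig sigma) -> p = q.
Proof.
move=> ap aq eq.
have [m1 le1 hm1] := affok_supported n0 k; have [m le hm] := affok_supported m1 k'.
have sq := hm q aq.
have sp : supported m p by move=> i /(hm1 p ap)[h1 h2]; split; apply: (In_le le).
have ok : okn m sigma by apply: okn_sigma; apply: leq_trans le.
have fp := gx_fin ap sp; have fq := gx_fin aq sq.
have lab : labelling sigma0 (act (gx k p) (Fl_sig sigma)) (fun a b => gx k' q @` Fsig sigma a b).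
  by rewrite eq; apply: (labelling_act fq ok).
have := (labelling_fin _ fp ok).1 lab => labE.
have Meq a : gx k' q @` Fsig sigma a true = gx k p @` Fsig sigma a true.
  by have := congr1 (fun M : A -> bool -> set V => M a true) labE.
apply/funext => i; have [bi|nbi] := boolP (bd i); last first.
  have z r k1 : affok k1 r -> r i = 0.
    by move=> [_ h]; apply/eqP; apply: contraNT nbi => /h.
  by rewrite (z p k ap) (z q k' aq).
have [iv idxi] := enP bi; case eni : (en i) => [f e]; rewrite eni in iv idxi.
have ef : (e == f) = false.
  by apply/negP => /eqP fe; rewrite fe in iv; apply: inv_irrefl iv.
suff veq : gx k p (\val e) = gx k' q (\val e).
  have := congr1 (crd bE f) veq; rewrite !crd_gx // ef !add0r.
  by case: asboolP => // _; rewrite idxi.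
have hM := Fsig_subspace sigma (sigma e) true (gx_linear k p).
have mem : Fsig sigma (sigma e) true (\val e).
  by rewrite FsigE; apply: CS_val; rewrite /dn /=.
apply/eqP; rewrite -subr_eq0; apply/eqP; apply: (gx_transv (a := sigma e) ap sp ok); split.
  apply: (subspaceB hM); first by exists (\val e).
  by rewrite -Meq; exists (\val e).
move=> j /negP/negPn Jj; rewrite crdB !crd_gx //.
case: asboolP => [[_ /= lt]|_]; last by rewrite subrr.
by move: Jj; rewrite /Js /dnb leNgt lt.
Qed.

(** The parameters are the entries of the normal form, which are supported on [E_n] and hence finite
    in number. *)
Lemma gx_surj n G : okn n sigma -> lev n G -> Borbit B sigma G ->
  exists p k, [/\ affok k p, G = act (gx k p) (Fl_sig sigma) & supported n p].
Proof.
move=> ok lG oG.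
have [UG CG] : Uset G /\ Cset G.
  by have := oG; rewrite orbitE.
have [g [fg lpg -> diag offd]] := UC_normal ok lG UG CG.
pose p i := if bd i then crd bE (en i).1 (g (\val (en i).2)) else 0.
have ne i : bd i -> (en i).1 != (en i).2.
  move=> /enP[iv _]; apply/eqP => eq; apply: (@inv_irrefl (en i).1).
  by rewrite {2}eq; case: (en i) iv.
have sp : supported n p.
  move=> i; rewrite /p; case: ifP => [bi|]; last by rewrite eqxx.
  by move=> /(offd _ _ (ne i bi))[].
pose k := (\max_(t <- [seq (f, e) | f <- In n, e <- In n]) idx t).+1.
have ap : affok k p.
  split=> i; last by rewrite /p; case: ifP => //; rewrite eqxx.
  move=> ki; apply/eqP/negPn/negP => pi; have [h1 h2] := sp i pi.
  have bi : bd i by move: pi; rewrite /p; case: ifP => //; rewrite eqxx.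
  have [_ ie] := enP bi.
  have : (idx (en i) <= \max_(t <- [seq (f, e) | f <- In n, e <- In n]) idx t)%N.
    apply: leq_bigmax_seq => //; apply/allpairsP; exists (en i); split=> //.
    by case: (en i).
  by rewrite ie; move: ki; rewrite /k => ki le; have := leq_trans ki le; rewrite ltnn.
exists p, k; split=> //; congr (act _ _); apply/funext.
have [lg _ _ _] := fg.
apply: (lin_ext bE lg (gx_linear k p)) => e; apply: (crd_inj (bE := bE)) => f.
rewrite crd_gx //; have [<-|fe] := eqVneq e f.
  by rewrite diag; case: asboolP => [/inv_irrefl //|_]; rewrite addr0.
rewrite add0r; case: asboolP => [iv|niv]; last first.
  by apply/eqP/negPn/negP => /(offd _ _ _)[]; rewrite 1?eq_sym.
by have [bi ei] := idxP iv; rewrite /p bi ei.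
Qed.

Lemma gx_orbit k p : affok k p -> Borbit B sigma (act (gx k p) (Fl_sig sigma)).
Proof.
move=> ap; have [m _ sp] := affok_supported n0 k; exists (gx k p) => //.
exact: (leadp_B (gx_fin ap (sp p ap)) (gx_leadp ap)).
Qed.

Lemma psi_morphism k (Y : set (nat -> K)) (psi : (nat -> K) -> set (set V)) :
  (forall p, Y p -> affok k p) ->
  (forall p, Y p -> psi p = act (gx k p) (Fl_sig sigma)) ->
  exists m, var_morphism (affine_coord K) Y (xc m) (lev m `&` Borbit B sigma) psi.
Proof.
move=> Yok psiE; have [m le sp] := affok_supported n0 k; exists m.
apply: (var_morphism_ext (phi := fun p => act (gx k p) (Fl_sig sigma))).
  by move=> p Yp; rewrite psiE.
apply: liftmap_morphism.
apply: (family_liftmap (okn_sigma le)).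
- by move=> p /Yok ap; apply: (gx_fin ap (sp p ap)).
- move=> l e; exists (fun p => l (\val e) +
    \sum_(i < k) p i * (crd bE (en i).2 (\val e) * l (\val (en i).1))).
    apply: polyfun_add; first exact: polyfun_const.
    apply: polyfun_sum => i; apply: polyfun_mul; first exact: polyfun_coord.
    exact: polyfun_const.
  move=> p _; rewrite /gx linearD linear_sum; congr (_ + _); apply: eq_bigr => i _.
  by rewrite linearZ mulrA.
by move=> p Yp; apply: gx_orbit; apply: Yok.
Qed.

(* The coordinates on the orbit are quotients of Pluecker coordinates: [lrep]
   replaces the functional indexed by [e] with the one indexed by [f]. *)
Definition lrep n a e f (i : nat) : {scalar V} :=
  if i == index e [seq k <- In n | Js a k] then (crd bE f : {scalar V}) else lJ n (Js a) i.

(** Cramer's rule for the image of [e]: its coefficients on [{sigma <= sigma e}] are 1 at [e] and 0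
    elsewhere, and its coefficient at [f] is [p i]. *)
Lemma gx_coordinate n k p i c : okn n sigma -> affok k p -> supported n p -> bd i ->
  (en i).1 \in In n -> (en i).2 \in In n ->
  let f := (en i).1 in let e := (en i).2 in let a := sigma e in
  @over _ _ (xc n) c (act (gx k p) (Fl_sig sigma)) ->
  plucker (lJ n (Js a)) (c a true) != 0 /\
  p i * plucker (lJ n (Js a)) (c a true) = plucker (lrep n a e f) (c a true).
Proof.
move=> ok ap sp bi fn en' f e a ov; have fg := gx_fin ap sp.
have okj : okJ n a (Js a).
  by split=> [h hn|]; [rewrite /Js /dnb (proj1 ok)|exact: (proj2 ok)].
have tr := orbit_transv a
  fg (gx_leadp ap) ok.
split.
  exact: (proj1 (transv_plucker okj ov) tr).
have := ov; move/(overP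
  _ fg ok) => bas.
have sz := over_size ov a true.
pose r := [seq k <- In n | Js a k].
have ur : uniq r by apply: filter_uniq.
have szr : size r = size (c a true) by rewrite size_filter sz (proj2 okj).
have er : e \in r by rewrite mem_filter /Js /dnb lexx en'.
have [iv ii] := enP bi.
have Mv : (gx k p @` Fsig sigma a true `&` W n) (gx k p (\val e)).
  split; first by exists (\val e) => //; rewrite FsigE; apply: CS_val; rewrite /dn /=.
  apply: (proj1 (fin_W _ fg)); exact: (W_val en').
rewrite (plucker_ratio (l := lJ n (Js a)) (l' := lrep n a e f) (h := crd bE f) (k := index e r) (bas a true) Mv).
- congr (_ * _); rewrite /= crd_gx //.
  have fe : (e == f) = false.
    apply/negP => /eqP ef; apply: (@inv_irrefl e); move: iv.
    by rewrite (surjective_pairing (en i)) -/f -/e -ef.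
  have eqen : en i = (f, e) by rewrite /f /e; case: (en i).
  by rewrite fe add0r -eqen; case: asboolP => // _; rewrite ii.
- by rewrite -szr index_mem.
- move=> j lt; rewrite /lJ /= crd_gx //.
  have jr : nth e0 r j \in r by apply: mem_nth; rewrite szr.
  have -> : (e == nth e0 r j) = (j == index e r).
    apply/eqP/eqP => [->|->]; last by rewrite nth_index.
    by rewrite index_uniq // szr.
  case: asboolP => [[_ /= h]|_]; last by rewrite addr0.
  by move: jr; rewrite mem_filter /Js /dnb leNgt h.
- by move=> j ne; rewrite /lrep (negbTE ne).
by rewrite /lrep eqxx.
Qed.

Lemma phi_morphism n (phi : set (set V) -> (nat -> K)) (aff : nat -> set (nat -> K)) :
  (forall m p, affok m p -> aff m p) ->
  (forall k p, affok k p -> phi (act (gx k p) (Fl_sig sigma)) = p) ->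
  exists m, var_morphism (xc n) (lev n `&` Borbit B sigma) (affine_coord K) (aff m) phi.
Proof.
move=> affP phiK; pose n1 := maxn n n0.
have ok : okn n1 sigma := okn_sigma (leq_maxr n n0).
pose m := (\max_(t <- [seq (f, e) | f <- In n1, e <- In n1]) idx t).+1; exists m.
suff h : var_morphism (xc n1) (lev n1 `&` Borbit B sigma) (affine_coord K) (aff m) phi.
  have := liftmap_morphism (inclusion_liftmap (Borbit B sigma) (leq_maxl n n0)).
  by move=> /var_morphism_comp /(_ h).
have nf G : (lev n1 `&` Borbit B sigma) G ->
    exists p k, [/\ affok k p, G = act (gx k p) (Fl_sig sigma) & supported n1 p].
  by move=> [lG oG]; apply: gx_surj.
apply: liftmap_morphism.
apply: (@LiftMap _ _ _ (xc n1) (lev n1 `&` Borbit B sigma) (affine_coord K) (aff m) phi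
  (fun G _ => phi G) (fun _ _ => 0%N)) => //.
- move=> G /nf[p [k [ap -> sp]]]; rewrite phiK //; apply: affP; split=> [i h|]; last exact: (proj2 ap).
  apply/eqP/negPn/negP => pi; have bi := proj2 ap i pi.
  have [h1 h2] := sp i pi; have [_ ie] := enP bi.
  have : (idx (en i) <= \max_(t <- [seq (f, e) | f <- In n1, e <- In n1]) idx t)%N.
    apply: leq_bigmax_seq => //; apply/allpairsP; exists (en i); split=> //.
    by case: (en i).
  by rewrite ie; move: h; rewrite /m => h le; have := leq_trans h le; rewrite ltnn.
- move=> G [lG _].
  exact: (over_ex lG).
- by move=> q c c' _; apply: homog_affine.
move=> i; have [/andP[bi /andP[fn en']]|nb] := boolP [&& bd i, (en i).1 \in In n1 & (en i).2 \in In n1].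
  pose a := sigma (en i).2.
  exists (cdeg (xc n1) ((a, true), lJ n1 (Js a))),
    (ccoord (xc n1) ((a, true), lrep n1 a (en i).2 (en i).1)),
    (ccoord (xc n1) ((a, true), lJ n1 (Js a))).
  split; [|exact: form_coord|].
    apply: form_eq (form_coord (xc n1) ((a, true), lrep n1 a (en i).2 (en i).1)) _ => j.
    by rewrite /= addn0.
  move=> G c /nf[p [k [ap -> sp]]] ov; rewrite phiK //=.
  exact: (gx_coordinate ok ap sp bi fn en' ov).
(* An index whose inversion is not inside the level gives a coordinate that vanishes there. *)
exists (fun=> 0%N), (fun=> 0), (fun=> 1); split; [exact: form_const|exact: form_const|].
move=> G c /nf[p [k [ap -> sp]]] ov; rewrite phiK //= oner_neq0 mulr1; split=> //.
apply/eqP/negPn/negP => pi; case/negP: nb; rewrite (proj2 ap i pi) /=.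
by have [-> ->] := sp i pi.
Qed.

End Parametrization.

End Orbit.

Hypothesis E_countable : (E #= [set: nat])%card.

Lemma orbit_affine sigma : Worbit sigma0 sigma ->
  ilocally_closed X (Borbit B sigma) /\
  ind_isomorphic (subind X (Borbit B sigma)) (affine_space K (n_inv leB sigma)).
Proof.
move=> /WorbitP[n0 ok0].
split; first exact: (orbit_locally_closed ok0).
have [en [idx]] := enumeration (e0, e0) (countable_pairs E_countable (inversions leB sigma)).
set bd := (fun i : nat => _) => -[enP idxP].
(* Level [m] of a finite-dimensional affine space is truncated at its dimension, that of the
   infinite-dimensional one at [m]. *)
pose bound m := odflt m (n_inv leB sigma).
have affok_lev m p : ilev (affine_space K (n_inv leB sigma)) m p -> affok bd (bound m) p.
  move=> h; split=> // i pi; rewrite /bd; move: (h i); rewrite /= /n_inv.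
  case: asboolP => //= _ hi; rewrite ltnNge; apply: contra pi => le.
  by rewrite hi.
have lev_affok k p : affok bd k p -> ilev (affine_space K (n_inv leB sigma)) k p.
  move=> [pk pbd] i /=; rewrite /n_inv; move: (pbd i); rewrite /bd.
  case: asboolP => /= _ hi le; last exact: pk.
  by apply/eqP/negPn/negP => /hi; rewrite ltnNge le.
have [psi psiE] := psi_ex (sigma := sigma) enP idxP.
(* Off the orbit the value is arbitrary; on it, injectivity of the parametrization makes it well
   defined. *)
have : forall G : set (set V), exists p, forall k q, affok bd k q ->
    act (gx en k q) (Fl_sig sigma) = G -> p = q.
  move=> G; have [[k [q [aq eq]]]|n] := pselect (exists k q, affok bd k q /\
    act (gx en k q) (Fl_sig sigma) = G); last first.
    by exists (fun=> 0) => k q aq eq; case: n; exists k, q.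
  exists q => k' q' aq' eq'.
  have eqq := etrans eq (esym eq').
  exact: (gx_inj ok0 enP idxP aq aq' eqq).
move=> /choice[phi hphi].
have phiK k q : affok bd k q -> phi (act (gx en k q) (Fl_sig sigma)) = q.
  by move=> aq; apply: hphi aq erefl.
exists phi, psi; split.
- move=> n.
  have [m h] := phi_morphism ok0 enP idxP n
    (aff := ilev (affine_space K (n_inv leB sigma))) lev_affok phiK.
  by exists m.
- move=> k.
  have [m h] := psi_morphism ok0 enP idxP (Y := ilev (affine_space K (n_inv leB sigma)) k) (psi := psi)
    (affok_lev k) (fun p hp => psiE p (bound k) (affok_lev k p hp)).
  by exists m.
- move=> G [n _ [lG oG]].
  have lG' : lev (maxn n n0) G.
    exact: (lev_le (leq_maxl n n0)).
  have ok := okn_sigma ok0 (leq_maxr n n0).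
  have [p [k [ap -> _]]] := gx_surj ok0 enP idxP ok lG' oG.
  by rewrite (phiK k) // (psiE p k).
move=> p [n _ lp]; have ap := affok_lev n p lp.
by rewrite (psiE p _ ap) (phiK _ _ ap).
Qed.

(** * Closures of orbits *)

Hypothesis K_infinite : forall r : seq K, exists y, y \notin r.

Lemma okn_swap n s i j : okn n s -> i \in In n -> j \in In n -> i != j ->
  okn n (s \o swap i j).
Proof.
move=> [off cnt] iI jI ne; split=> [f fn|a b].
  rewrite /= swapE; case: eqP => [fi|_]; first by rewrite fi iI in fn.
  by case: eqP => [fj|_]; [rewrite fj jI in fn|apply: off].
rewrite -cnt !(count_two _ (In_uniq n) iI jI ne); congr (_ + _)%N.
  by rewrite /dnb /= !swapE !eqxx eq_sym (negbTE ne) addnC.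
apply: eq_in_count => f; rewrite mem_filter => /andP[/andP[fi fj] _].
by rewrite /dnb /= swapE (negbTE fi) (negbTE fj).
Qed.

Lemma level_of s (r : seq E) m : Worbit sigma0 s ->
  exists n, [/\ (m <= n)%N, okn n s & {subset r <= In n}].
Proof.
move=> /WorbitP[n1 ok].
have [n2 h] := In_cover r.
exists (maxn m (maxn n1 n2)); split; first exact: leq_maxl.
  by apply: (okn_le _ ok); rewrite !leq_max leqnn orbT.
by move=> e /h; apply: In_le; rewrite !leq_max leqnn !orbT.
Qed.

Lemma hat_lt_Worbit s t : Worbit sigma0 s -> hat_lt leB s t -> Worbit sigma0 t.
Proof.
move=> Ws [i [j [/andP[ne _] _ ->]]].
have [n [_ ok sub]] := level_of [:: i; j] 0 Ws.
apply/WorbitP; exists n; apply: okn_swap => //; apply: sub.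
  by rewrite inE eqxx.
by rewrite !inE eqxx orbT.
Qed.

Definition shear (i j : E) (y : K) (v : V) : V := v + (y * crd bE i v) *: \val j.

Lemma shear_linear (i j : E) y : linear (shear i j y).
Proof.
move=> a u v; rewrite /shear crdL scalerDr addrACA scalerA; congr (_ + _).
by rewrite mulrDr scalerDl mulrCA.
Qed.

Lemma shearE (i j : E) y f : shear i j y (\val f) =
  if f == i then \val i + y *: \val j else \val f.
Proof.
rewrite /shear crdE; case: eqP => [->|_]; first by rewrite mulr1.
by rewrite mulr0 scale0r addr0.
Qed.

Lemma shearK (i j : E) y : i != j -> cancel (shear i j y) (shear i j (- y)).
Proof.
move=> ne; apply: (lin_ext bE (lin_comp (shear_linear i j (- y)) (shear_linear i j y)) (h := id)) => // f.
rewrite /= shearE; have [->|fi] := eqVneq f i; last by rewrite shearE (negbTE fi).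
have l := shear_linear i j (- y); rewrite (linD _ _ l) (linZ _ _ l).
by rewrite !shearE eqxx (eq_sym j i) (negbTE ne) scaleNr addrNK.
Qed.

Lemma shear_fin n (i j : E) y : i != j -> i \in In n -> j \in In n -> fin n (shear i j y).
Proof.
move=> ne iI jI; apply: fin_intro; [exact: shear_linear|exact: can_inj (shearK y ne)| |].
  move=> e eI; rewrite shearE; case: eqP => _; last exact: (W_val eI).
  apply: (subspaceD (W_subspace n)); first exact: (W_val iI).
  apply: (subspaceZ (W_subspace n)); exact: (W_val jI).
move=> e eI; rewrite shearE; case: eqP => // ei.
by have eI' : e \notin In n := eI; rewrite ei iI in eI'.
Qed.

Lemma shear_leadp (i j : E) y : strict leB j i -> leadp (shear i j y).
Proof.
move=> /andP[ne ji] e; split.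
  rewrite shearE; have [->|_] := eqVneq e i; last by rewrite crdE eqxx oner_neq0.
  by rewrite crdD crdZ !crdE eqxx (negbTE ne) mulr0 addr0 oner_neq0.
move=> f; rewrite shearE; have [->|_] := eqVneq e i.
  rewrite crdD crdZ !crdE; have [<-|] := eqVneq i f; first by move=> _; apply: leB_refl.
  by have [<-//|] := eqVneq j f; rewrite mulr0 addr0 eqxx.
by rewrite crdE; have [<-|] := eqVneq e f; rewrite ?eqxx // => _; apply: leB_refl.
Qed.

(* For [y != 0] the lines through [i + y j] and [j + y^-1 i] agree. *)
Lemma shear_swap s (i j : E) y a b : i != j -> (s i < s j)%O -> y != 0 ->
  shear i j y @` Fsig s a b = shear j i y^-1 @` Fsig (s \o swap i j) a b.
Proof.
move=> ne lt y0; rewrite !FsigE.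
have nji : j == i = false by rewrite eq_sym (negbTE ne).
have mono : dn s a b j -> dn s a b i.
  rewrite /dn /= /dnb; case: b => h; first exact: le_trans (ltW lt) h.
  exact: lt_trans lt h.
have swi : dn (s \o swap i j) a b i = dn s a b j by rewrite /dn /= /dnb /= swapE eqxx.
have swj : dn (s \o swap i j) a b j = dn s a b i.
  by rewrite /dn /= /dnb /= swapE nji eqxx.
have swf f : f != i -> f != j -> dn (s \o swap i j) a b f = dn s a b f.
  by move=> fi fj; rewrite /dn /= /dnb /= swapE (negbTE fi) (negbTE fj).
set P := dn s a b in mono swi swj swf *; set Q := dn (s \o swap i j) a b in swi swj swf *.
have l1 := shear_linear i j y; have l2 := shear_linear j i y^-1.
have hP := CS_subspace bE P; have hQ := CS_subspace bE Q.
apply/seteqP; split=> _ [v + <-].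
  have h2 := image_subspace l2 hQ.
  apply: (CS_min (preimage_subspace l1 h2)) => f Pf /=; rewrite shearE.
  have [fi|fi] := eqVneq f i.
    exists (y *: \val j); first by apply: (subspaceZ hQ); apply: CS_val; rewrite swj -fi.
    by rewrite (linZ _ _ l2) shearE eqxx scalerDr scalerA mulfV // scale1r addrC.
  have [fj|fj] := eqVneq f j.
    rewrite fj in Pf *; exists (\val j - y^-1 *: \val i).
      apply: (subspaceB hQ); first by apply: CS_val; rewrite swj; apply: mono.
      by apply: (subspaceZ hQ); apply: CS_val; rewrite swi.
    by rewrite (linB _ _ l2) (linZ _ _ l2) !shearE eqxx (negbTE ne) addrK.
  exists (\val f); first by apply: CS_val; rewrite swf.
  by rewrite shearE (negbTE fj).
have h1 := image_subspace l1 hP.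
apply: (CS_min (preimage_subspace l2 h1)) => f Qf /=; rewrite shearE.
have [fj|fj] := eqVneq f j.
  exists (y^-1 *: \val i); first by apply: (subspaceZ hP); apply: CS_val; rewrite -swj -fj.
  by rewrite (linZ _ _ l1) shearE eqxx scalerDr scalerA mulVf // scale1r addrC.
have [fi|fi] := eqVneq f i.
  rewrite fi swi in Qf *; exists (\val i - y *: \val j).
    apply: (subspaceB hP); first by apply: CS_val; apply: mono.
    by apply: (subspaceZ hP); apply: CS_val.
  by rewrite (linB _ _ l1) (linZ _ _ l1) !shearE eqxx nji addrK.
exists (\val f); first by apply: CS_val; rewrite -swf.
by rewrite shearE (negbTE fi).
Qed.

Lemma hat_lt_closure s t : Worbit sigma0 s -> hat_lt leB s t ->
  Borbit B s `<=` iclosure X (Borbit B t).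
Proof.
move=> Ws [i [j [ij sij ->]]] _ [b Bb <-] C [clC subC]; have [ne lij] := andP ij.
have [Gb _] := Bb; have [m fb0] := GE_fin Gb.
have [n [mn ok sub]] := level_of [:: i; j] m Ws.
have iI : i \in In n by apply: sub; rewrite inE eqxx.
have jI : j \in In n by apply: sub; rewrite !inE eqxx orbT.
have fb := fin_le mn fb0; have [lb _ _ _] := fb.
have lpb : leadp b := B_leadp Bb.
have okt := okn_swap ok iI jI ne.
(* At [y = 0] the family gives the chosen point. For [y] non-zero, [shear_swap] turns it into a
   point of the other orbit, since adding a multiple of [i] to the later [j] preserves leading
   terms. *)
pose g (p : nat -> K) := b \o shear i j (p 0%N).
have fg p : range (@line K) p -> fin n (g p).
  by move=> _; apply: fin_comp fb _; apply: shear_fin.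
have pg (l : {scalar V}) e : exists2 P : (nat -> K) -> K, polyfun P &
    forall p, range (@line K) p -> P p = l (g p (\val e)).
  exists (fun p => l (b (\val e)) + p 0%N * (crd bE i (\val e) * l (b (\val j)))).
    apply: polyfun_add; first exact: polyfun_const.
    apply: polyfun_mul; [exact: polyfun_coord|exact: polyfun_const].
  move=> p _; rewrite /g /= /shear (linD _ _ lb) (linZ _ _ lb) linearD; congr (_ + _).
  by rewrite linearZ mulrA.
have lm := family_liftmap
  (Z := setT) ok fg pg (fun _ _ => Logic.I).
rewrite setIT in lm.
have [_ /(_ n) zC] := clC.
have zp := zclosed_pull lm zC.
have zE : range (@line K) `&` (fun p => act (g p) (Fl_sig s)) @^-1` (C `&` lev n)
    `<=` [set p | C (act (g p) (Fl_sig s))] by move=> p [_ []].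
have : C (act (g (line 0)) (Fl_sig s)).
  apply: zE; apply: (zclosed_line K_infinite zp) => y y0; split; first by exists y.
  have fy : fin n (g (line y)) by apply: fg; exists y.
  split; last exact: (lev_intro fy ok).
  apply: subC; exists (b \o shear j i y^-1).
    have fk : fin n (b \o shear j i y^-1).
      by apply: fin_comp fb _; apply: shear_fin; rewrite // eq_sym.
    have [lk _ _ _] := fk.
    apply: (leadp_B fk) => e /=.
    by apply: (leadpP lb lpb); apply: shear_leadp.
  rewrite /g (act_comp b (shear i j _)) (act_comp b (shear j i _)); congr act.
  rewrite !act_FlE.
  apply/seteqP; split=> Y [a [c ->]]; exists a, c; first by rewrite (shear_swap _ _ ne).
  by rewrite -(shear_swap _ _ ne).
congr C; congr act; apply/funext => v; rewrite /g /= /shear /line eqxx.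
by rewrite mul0r scale0r addr0.
Qed.

Lemma iclosureS Z Z' : Z `<=` iclosure X Z' -> iclosure X Z `<=` iclosure X Z'.
Proof.
by move=> sub G hG C [clC Z'C]; apply: hG; split=> // H /sub; apply.
Qed.

Lemma bruhat_closure s t : Worbit sigma0 s -> bruhat_le leB s t ->
  Borbit B s `<=` iclosure X (Borbit B t).
Proof.
move=> Ws [ct|<-]; last exact: sub_gen_smallest.
have [//] : Worbit sigma0 t /\ Borbit B s `<=` iclosure X (Borbit B t).
elim: ct Ws => {s t} [s t st|s u t _ IH1 _ IH2] Ws.
  by split; [apply: hat_lt_Worbit st|apply: hat_lt_closure].
have [Wu h1] := IH1 Ws; have [Wt h2] := IH2 Wu; split=> // G /h1.
exact: iclosureS.
Qed.

(** If the rank of [t] at [(e, a)] were larger, then for [b] in [B] the part of the member of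
    [b F_t] at [a] bounded by [e] would be too large to avoid the span of the [f <= e] with
    [s f > a]. Transversality for [{s <= a}] would fail on the orbit of [t], hence on its
    closure. *)
Lemma closure_brank s t n : okn n s -> okn n t ->
  Borbit B s `<=` iclosure X (Borbit B t) ->
  forall e a, (brank leB (In n) t e a <= brank leB (In n) s e a)%N.
Proof.
move=> oks okt sub e a; rewrite leqNgt; apply/negP => lt.
pose J := dnb s a true.
have okj : okJ n a J.
  by split=> [f fn|]; [rewrite /J /dnb (proj1 oks)|exact: (proj2 oks)].
have clN := iclosed_ntransv okj.
have os : Borbit B s (act id (Fl_sig s)).
  exists id => //; split; first exact: (fin_GE (fin_id n)).
  exact: act_id.
have : [set G | FlE sigma0 G /\ ~ transv a J G] (act id (Fl_sig s)).
  apply: (sub _ os); split=> // _ [b Bb <-]; have [Gb _] := Bb.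
  have Wt : Worbit sigma0 t by apply/WorbitP; exists n.
  split; first exact: (FlE_GE Gb Wt).
  have [m0 fb0] := GE_fin Gb.
  pose m := maxn n m0; have nm : (n <= m)%N := leq_maxl n m0.
  have fb := fin_le (leq_maxr n m0) fb0; have [lb bb _ _] := fb.
  have lpb : leadp b := B_leadp Bb.
  have okmt := okn_le nm okt.
  move=> /(transvE _ _ fb okmt) tr.
  (* Outside [E_n] both maps equal [sigma0], so the strict inequality persists at level [m]. *)
  have lt' : (brank leB (In m) s e a < brank leB (In m) t e a)%N.
    rewrite /brank !(count_In _ nm) (_ : count _ [seq _ <- _ | _] =
      count (fun f => (t f <= a)%O && leB f e) [seq f <- In m | f \notin In n]).
      by rewrite ltn_add2r.
    apply: eq_in_count => f; rewrite mem_filter => /andP[fn _].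
    by rewrite (proj1 oks) // (proj1 okt).
  pose M := b @` CS bE (dn t a true `&` below true e).
  pose N := CS bE ([set f | ~~ J f] `&` below true e).
  have hM : subspace M by apply: image_subspace => //; apply: CS_subspace.
  have hN : subspace N := CS_subspace _ _.
  have hS : subspace (CS bE (below true e)) := CS_subspace _ _.
  have [|||v [v0 Mv Nv _]] := rk_meet (bE := bE) (In_uniq m) hM hN hS.
  - move=> v [[u hu <-] _].
    have hu' : CS bE (below true e) u by apply: CS_mono hu => f [].
    have [->|u0] := eqVneq u 0; first by rewrite lin0 //; apply: subspace0.
    have [f lf] := lead_ex u0.
    apply/(lead_F0 _ _ (leadpP lb lpb lf)).
    exact: (lead_CS lf hu').
  - by move=> v [Nv _]; apply: CS_mono Nv => f [].
  - rewrite (fin_rk fb); last exact: CS_subspace.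
    rewrite !rk_CS; try exact: In_uniq.
    have -> : count (fun f => `[< below true e f >]) (In m) =
        (brank leB (In m) s e a +
         count (fun f => `[< ([set f | ~~ J f] `&` below true e) f >]) (In m))%N.
      apply: count_split => f; rewrite /below /= asboolb /J /dnb.
      have -> : `[< ([set f | ~~ (s f <= a)%O] `&` [set f | leB f e]) f >] =
          ~~ (s f <= a)%O && leB f e by apply/asboolP/andP.
      by case: (s f <= a)%O; case: (leB f e).
    rewrite ltn_add2r; apply: leq_trans lt' _; apply: eq_leq; apply: eq_count => f.
    by symmetry; apply/asboolP/andP.
  case/eqP: v0; apply: tr; split.
    by have [u hu <-] := Mv; exists u => //; rewrite FsigE; apply: CS_mono hu => f [].
  by apply: CS_mono Nv => f [].
move=> [_]; apply.
exact: (orbit_transv a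
  (fin_id n) lead_val oks).
Qed.

Lemma closure_order s t : Worbit sigma0 s -> Worbit sigma0 t ->
  (Borbit B s `<=` iclosure X (Borbit B t) <-> bruhat_le leB s t).
Proof.
move=> Ws Wt; split; last exact: bruhat_closure.
have [n1 [_ ok1 _]] := level_of [::] 0 Ws.
have [n [le okt _]] := level_of [::] n1 Wt.
have oks := okn_le le ok1 => sub.
have [offs cnts] := oks; have [offt cntt] := okt.
apply: (brank_bruhat leB_refl leB_anti leB_trans leB_total (I := In n)) => //.
- by move=> f fn; rewrite offs // offt.
- by apply: count_perm => a b; rewrite cnts cntt.
exact: closure_brank.
Qed.

End Flags.

Theorem theorem1
  (K : closedFieldType) (charK : [pchar K] =i pred0)
  (V : lmodType K) (E : set V) (E_basis : is_basis E)
  (E_countable : (E #= [set: nat])%card)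
  (En : nat -> set V) (En_finite : forall n, finite_set (En n))
  (En_mono : forall n, En n `<=` En n.+1) (En_cover : E = \bigcup_n En n)
  (d : Order.disp_t) (A : orderType d)
  (sigma0 : E -> A) (sigma0_surj : forall a, exists e, sigma0 e = a)
  (B : set (V -> V)) (B_borel : splitting_borel E En B)
  (leB : rel E) (leB_refl : reflexive leB) (leB_anti : antisymmetric leB)
  (leB_trans : transitive leB) (leB_total : total leB)
  (B_leB : B = stab E (flag_of leB (@id E))) :
  let F := Fl_sig sigma0 in
  let P := stab E F in
  let X := Fl_ind En sigma0 in
  (* (a) *)
  [/\ [/\ exists Phi : set (V -> V) -> set (set V),
            set_bij [set lcoset g P | g in GE E] (FlE sigma0) Phi /\
            (forall g, GE E g -> Phi (lcoset g P) = act g F),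
          FlE sigma0 = \bigcup_(sigma in Worbit sigma0) Borbit B sigma,
          trivIset (Worbit sigma0) (Borbit B),
          FlE sigma0 = \bigcup_(w in [set: weyl E]) Borbit B (sigma0 \o winv w) &
          forall w w' : weyl E,
            (same_coset sigma0 w w' ->
               Borbit B (sigma0 \o winv w) = Borbit B (sigma0 \o winv w')) /\
            (~ same_coset sigma0 w w' ->
               Borbit B (sigma0 \o winv w) `&` Borbit B (sigma0 \o winv w')
                 = set0)],
      (* (b) *)
      forall G M sigma, FlE sigma0 G -> labelling sigma0 G M ->
        Worbit sigma0 sigma ->
        (Borbit B sigma G <-> relative_position leB M sigma),
      (* (c) *)
      forall sigma, Worbit sigma0 sigma ->
        ilocally_closed X (Borbit B sigma) /\
        ind_isomorphic (subind X (Borbit B sigma))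
                       (affine_space K (n_inv leB sigma)) &
      (* (d) *)
      forall sigma tau, Worbit sigma0 sigma -> Worbit sigma0 tau ->
        (Borbit B sigma `<=` iclosure X (Borbit B tau) <->
         bruhat_le leB sigma tau)].
Proof.
rewrite B_leB {B B_borel B_leB} => F P X.
have [e0 _] := ex_basis_vector E_countable.
split; [split| | |].
- exact: (coset_bijection E_basis En_finite En_mono En_cover leB_refl leB_anti leB_trans
    leB_total sigma0_surj).
- exact: (FlE_bigcup E_basis En_finite En_mono En_cover leB_refl leB_anti leB_trans
    leB_total sigma0_surj).
- exact: (trivIset_orbits E_basis En_finite En_mono En_cover leB_refl leB_anti leB_trans
    leB_total).
- exact: (FlE_bigcup_weyl E_basis En_finite En_mono En_cover leB_refl leB_anti leB_trans
    leB_total sigma0_surj).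
- exact: (orbits_coset E_basis En_finite En_mono En_cover leB_refl leB_anti leB_trans
    leB_total).
- exact: (relpos_orbitP E_basis En_finite En_mono En_cover leB_refl leB_anti leB_trans
    leB_total sigma0_surj).
- exact: (orbit_affine E_basis En_finite En_mono En_cover leB_refl leB_anti leB_trans
    leB_total sigma0_surj e0 E_countable).
exact: (closure_order E_basis En_finite En_mono En_cover leB_refl leB_anti leB_trans
  leB_total sigma0_surj e0 (@closed_field_infinite K)).
Qed.
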